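(* Let $\mathcal{L}$ and $\mathcal{ID}^{\sqcup\!\times}_*$ and $W$ be as in the context. Then $W$ maps $\mathcal{L}$ onto $\mathcal{ID}^{\sqcup\!\times}_*$, and for every $\mu \in \mathcal{L}$, \[ \exp\big(i F_\mu(z)\big) = \eta_{W(\mu)}(e^{iz}) \qquad \text{for all } z \in \mathbb{C}^+ . \] Moreover, for $\mu, \mu' \in \mathcal{L}$ we have $W(\mu) = W(\mu')$ if and only if $\mu'$ is the translate of $\mu$ by $2\pi n$ for some $n \in \mathbb{Z}$; that is, the pre-image in $\mathcal{L}$ of each $\nu \in \mathcal{ID}^{\sqcup\!\times}_*$ is exactly one equivalence class modulo translations by $2\pi\mathbb{Z}$.
   Context: For a Borel probability measure $\mu$ on $\mathbb{R}$, let $G_\mu(z)=\int_{\mathbb{R}} \frac{1}{z-x}\,d\mu(x)$ and $F_\mu(z) = 1/G_\mu(z)$ for $z$ in the upper half-plane $\mathbb{C}^+$. Let $\mathcal{L}$ be the set of probability measures $\mu$ on $\mathbb{R}$ such that $F_\mu(z+2\pi)=F_\mu(z)+2\pi$ for all $z\in\mathbb{C}^+$. For a probability measure $\nu$ on the unit circle $\mathbb{T}$, let $\psi_\nu(z)=\int_{\mathbb{T}}\frac{z\zeta}{1-z\zeta}\,d\nu(\zeta)$ and $\eta_\nu(z)=\frac{\psi_\nu(z)}{1+\psi_\nu(z)}$ for $z$ in the open unit disc $\mathbb{D}$. Let $\mathcal{ID}^{\sqcup\!\times}_*$ be the set of probability measures $\nu$ on $\mathbb{T}$ such that $\eta_\nu'(0)\neq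 0$ and $\eta_\nu(z)=0$ only for $z=0$ (these are exactly the measures infinitely divisible with respect to multiplicative Boolean convolution, other than the Haar measure). The wrapping map $W$ sends a probability measure $\mu$ on $\mathbb{R}$ to the probability measure on $\mathbb{T}$ given by $\int_{\mathbb{T}} f\,dW(\mu)=\int_{\mathbb{R}} f(e^{-ix})\,d\mu(x)$ (push-forward under $x\mapsto e^{-ix}$). *)

(* Defs.v *)
From mathcomp Require Import all_boot all_order all_algebra.
From mathcomp Require Import all_classical all_reals all_analysis.
From mathcomp Require Export complex.
Set Implicit Arguments. Unset Strict Implicit. Unset Printing Implicit Defensive.
Import Order.TTheory GRing.Theory Num.Theory.
Local Open Scope classical_set_scope.
Local Open Scope ring_scope.
Local Open Scope complex_scope.

Section Defs.
Variable R : realType.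

Definition cexp (z : R[i]) : R[i] :=
  (expR (complex.Re z))%:C * (cos (complex.Im z) +i* sin (complex.Im z)).

Definition RInt d (T : measurableType d) (m : set T -> \bar R) (f : T -> R) : R :=
  fine (\int[m]_x (f x)%:E).

Definition CInt d (T : measurableType d) (m : set T -> \bar R) (f : T -> R[i]) : R[i] :=
  RInt m (fun x => complex.Re (f x)) +i* RInt m (fun x => complex.Im (f x)).

Definition G_mu (mu : set R -> \bar R) (z : R[i]) : R[i] :=
  CInt mu (fun x : R => (z - x%:C)^-1).
Definition F_mu (mu : set R -> \bar R) (z : R[i]) : R[i] := (G_mu mu z)^-1.

Definition in_L (mu : set R -> \bar R) : Prop :=
  forall z : R[i], 0 < complex.Im z ->
    F_mu mu (z + (2 * pi)%:C) = F_mu mu z + (2 * pi)%:C.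

(* The unit circle T is encoded as the subset {(a,b) | a^2+b^2 = 1} of R*R,
   the point (a,b) standing for the complex number a + ib.  A probability
   measure on T is a probability measure on R*R (Borel = product sigma-algebra)
   giving mass 1 to this circle. *)
Definition circle : set (R * R) := [set p | p.1 ^+ 2 + p.2 ^+ 2 = 1].
Definition toC (p : R * R) : R[i] := p.1 +i* p.2.

Definition psi_nu (nu : set (R * R) -> \bar R) (z : R[i]) : R[i] :=
  CInt nu (fun p => z * toC p / (1 - z * toC p)).
Definition eta_nu (nu : set (R * R) -> \bar R) (z : R[i]) : R[i] :=
  psi_nu nu z / (1 + psi_nu nu z).

Definition ID_star (nu : set (R * R) -> \bar R) : Prop :=
  nu circle = 1%E /\
  (exists L : R[i], L != 0 /\
     forall eps : R, 0 < eps -> exists delta : R, 0 < delta /\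
       forall z : R[i], z != 0 -> `|z| < 1 -> `|z| < delta%:C ->
         `|(eta_nu nu z - eta_nu nu 0) / z - L| < eps%:C) /\
  (forall z : R[i], `|z| < 1 -> eta_nu nu z = 0 -> z = 0).

Definition wrapT (x : R) : R * R := (cos x, - sin x).

Definition is_wrap (mu : set R -> \bar R) (nu : set (R * R) -> \bar R) : Prop :=
  forall A : set (R * R), measurable A -> nu A = mu (wrapT @^-1` A).

Definition is_translate (mu mu' : set R -> \bar R) (a : R) : Prop :=
  forall A : set R, measurable A -> mu' A = mu ((fun x => x + a) @^-1` A).

End Defs.
Arguments wrapT {R} x.

(* Main.v *)
(** For [mu] in L the relation [F (z - 2 pi k) = F z - 2 pi k] reads
    [int 1 / (z - x - 2 pi k) dmu(x) = 1 / (F z - 2 pi k)]; summing over [k] with Fejer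
    weights gives [int cot ((z - x) / 2) dmu(x) = cot (F z / 2)], which is the exponential
    formula [exp (i F z) = eta (e^{iz})].

    Conversely, for [nu] in ID_* write [eta z = z q z] with [q] zero-free and [|q| <= 1], and
    [q = exp l].  Then [F z = z - i l (e^{iz})] commutes with the translation by [2 pi] and
    satisfies [Im F >= Im z], so [1 / F] is the Cauchy transform of a probability measure:
    this is Herglotz's theorem moved to the half-plane by the Cayley transform, the
    representing measure being a Helly limit of discrete measures at the roots of unity and
    the growth of [F] excluding an atom at the point that corresponds to infinity.

    If [W mu = W mu'] then [F_mu' - F_mu] is continuous with values in [2 pi Z], hence
    constant, and the Cauchy transform determines the measure. *)

Require Import Defs.
From mathcomp Require Import all_boot all_order all_algebra.
From mathcomp Require Import all_classical all_reals all_analysis.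
From mathcomp Require Import complex measurable_realfun.
From mathcomp Require Import ring lra.
Import Order.TTheory GRing.Theory Num.Theory.
Import numFieldNormedType.Exports.
Local Open Scope classical_set_scope.
Local Open Scope ring_scope.
Local Open Scope complex_scope.

Set Implicit Arguments.
Unset Strict Implicit.
Unset Printing Implicit Defensive.

(** Holomorphy enters only through second-order remainder estimates ([c11]), and derivatives along a
    path only through [quad_telescope]: increments bounded by [A (t - s) + B (t - s)^2] add up to at
    most [A]. With [A = 0] this gives the integral of an exponential, the logarithm of a zero-free
    function and the constancy of [F_mu' - F_mu]; with [A] of the order of a mesh it gives a Cauchy
    formula over the roots of unity. Fejer weights answer a domination problem. Symmetric partial
    sums of the cotangent series are not bounded uniformly in [Re w], whereas a Fejer mean is an
    average of [e^{iwt}] against a nonnegative kernel, hence has a bound in terms of [Im w] alone,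
    valid for all [x] under the integral. That [eta'(0)] does not vanish for [mu] in L is a matter
    of growth: a double zero of eta at [0] would make [Im F(iy)] grow like [2y], while [F(iy)]
    behaves like [iy] for every probability measure. In the converse direction measures are images
    of the uniform law on [[0, 1]] under monotone functions, so that weak compactness becomes
    pointwise compactness of bounded monotone functions. *)

(** * Real modulus and complex exponential *)

Section ComplexModulus.
Context {R : realType}.
Implicit Types (z u : R[i]) (x y : R).
Local Notation Re := (@complex.Re R).
Local Notation Im := (@complex.Im R).

(* The norm [`|z|] lives in [R[i]]; [md z] is the modulus as a real number. *)
Definition md z : R := Num.sqrt (Re z ^+ 2 + Im z ^+ 2).

Lemma normE z : `|z| = (md z)%:C. Proof. exact: normc_def. Qed.

Lemma ReD z u : Re (z + u) = Re z + Re u. Proof. by case: z u => ? ? []. Qed.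
Lemma ImD z u : Im (z + u) = Im z + Im u. Proof. by case: z u => ? ? []. Qed.
Lemma ReN z : Re (- z) = - Re z. Proof. by case: z. Qed.
Lemma ImN z : Im (- z) = - Im z. Proof. by case: z. Qed.
Lemma ReM z u : Re (z * u) = Re z * Re u - Im z * Im u.
Proof. by case: z u => ? ? []. Qed.
Lemma ImM z u : Im (z * u) = Re z * Im u + Im z * Re u.
Proof. by case: z u => a b [c d] /=; rewrite [b * c]mulrC addrC. Qed.
Lemma ReC x : Re x%:C = x. Proof. by []. Qed.
Lemma ImC x : Im x%:C = 0. Proof. by []. Qed.
Lemma Re1 : Re 1 = 1. Proof. by []. Qed.
Lemma Im1 : Im 1 = 0. Proof. by []. Qed.
Lemma Re_sum I (r : seq I) (P : pred I) (f : I -> R[i]) :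
  Re (\sum_(i <- r | P i) f i) = \sum_(i <- r | P i) Re (f i).
Proof. exact: (big_morph Re ReD). Qed.
Lemma Im_sum I (r : seq I) (P : pred I) (f : I -> R[i]) :
  Im (\sum_(i <- r | P i) f i) = \sum_(i <- r | P i) Im (f i).
Proof. exact: (big_morph Im ImD). Qed.
Lemma Re_nat n : Re n%:R = n%:R.
Proof. by elim: n => // n ih; rewrite -natr1 ReD ih Re1 natr1. Qed.
Lemma Im_nat n : Im n%:R = 0.
Proof. by elim: n => // n ih; rewrite -natr1 ImD ih Im1 addr0. Qed.
Lemma Re_conj z : Re (conjc z) = Re z. Proof. by case: z. Qed.
Lemma Im_conj z : Im (conjc z) = - Im z. Proof. by case: z. Qed.
Definition CE := (ReD, ImD, ReN, ImN, ReM, ImM, ReC, ImC, Re1, Im1, Re_nat, Im_nat, Re_conj, Im_conj).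

Lemma complex_eq z u : Re z = Re u -> Im z = Im u -> z = u.
Proof. by case: z u => ? ? [? ?] /= -> ->. Qed.

Lemma md_ge0 z : 0 <= md z. Proof. exact: sqrtr_ge0. Qed.
Lemma md_sq z : md z ^+ 2 = Re z ^+ 2 + Im z ^+ 2.
Proof. by rewrite sqr_sqrtr// addr_ge0// sqr_ge0. Qed.
Lemma mdM z u : md (z * u) = md z * md u.
Proof. by apply: complexI; rewrite -normE normrM !normE rmorphM. Qed.
Lemma mdN z : md (- z) = md z.
Proof. by apply: complexI; rewrite -!normE normrN. Qed.
Lemma mdB z u : md (z - u) = md (u - z). Proof. by rewrite -mdN opprB. Qed.
Lemma mdV z : md z^-1 = (md z)^-1.
Proof. by apply: complexI; rewrite -normE normfV normE fmorphV. Qed.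
Lemma mdX z n : md (z ^+ n) = md z ^+ n.
Proof. by apply: complexI; rewrite -normE normrX normE rmorphXn. Qed.
Lemma mdC x : md x%:C = `|x|.
Proof. by rewrite /md /= expr0n/= addr0 sqrtr_sqr. Qed.
Lemma md0 : md 0 = 0. Proof. by rewrite (mdC 0) normr0. Qed.
Lemma md1 : md 1 = 1. Proof. by rewrite (mdC 1) normr1. Qed.
Lemma md_nat n : md n%:R = n%:R.
Proof. by apply: complexI; rewrite -normE normr_nat rmorph_nat. Qed.
Lemma md_i : md 'i = 1. Proof. by rewrite /md /= expr0n/= add0r expr1n sqrtr1. Qed.
Lemma md_conj z : md (conjc z) = md z. Proof. by rewrite /md !CE sqrrN. Qed.
Lemma mdD z u : md (z + u) <= md z + md u.
Proof. by rewrite -lecR rmorphD/= -!normE ler_normD. Qed.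
Lemma md_sum I (r : seq I) (P : pred I) (f : I -> R[i]) :
  md (\sum_(i <- r | P i) f i) <= \sum_(i <- r | P i) md (f i).
Proof.
elim/big_ind2 : _ => [|a b c d h1 h2|//]; first by rewrite md0.
exact: le_trans (mdD _ _) (lerD h1 h2).
Qed.
Lemma md_eq0 z : (md z == 0) = (z == 0).
Proof.
by rewrite -(inj_eq (@complexI R)) -normE (_ : 0%:C = 0)// normr_eq0.
Qed.
Lemma md_gt0 z : (0 < md z) = (z != 0).
Proof. by rewrite lt0r md_ge0 andbT md_eq0. Qed.
Lemma md_le0 z : md z <= 0 -> z = 0.
Proof. by move=> h; apply/eqP; rewrite -md_eq0 eq_le h md_ge0. Qed.
Lemma mdB_le0 z u : md (z - u) <= 0 -> z = u.
Proof. by move=> /md_le0/eqP; rewrite subr_eq0 => /eqP. Qed.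
Lemma Re_le_md z : `|Re z| <= md z.
Proof. by rewrite -sqrtr_sqr ler_wsqrtr// lerDl sqr_ge0. Qed.
Lemma Im_le_md z : `|Im z| <= md z.
Proof. by rewrite -sqrtr_sqr ler_wsqrtr// lerDr sqr_ge0. Qed.
Lemma Re_le z : Re z <= md z. Proof. exact: le_trans (ler_norm _) (Re_le_md _). Qed.
Lemma Im_le z : Im z <= md z. Proof. exact: le_trans (ler_norm _) (Im_le_md _). Qed.
Lemma md_le z : md z <= `|Re z| + `|Im z|.
Proof.
rewrite -(@ler_pXn2r _ 2)// ?nnegrE ?md_ge0 ?addr_ge0// md_sq.
rewrite -(real_normK (num_real (Re z))) -(real_normK (num_real (Im z))).
rewrite sqrrD lerD2r lerDl -mulr_natr mulr_ge0// mulr_ge0//.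
Qed.
Lemma mdBD z u w : md (z - w) <= md (z - u) + md (u - w).
Proof. by apply: le_trans (mdD _ _); rewrite addrA subrK. Qed.
Lemma md_sub z u : md z - md u <= md (z - u).
Proof. by rewrite lerBlDr; apply: le_trans (mdD _ _); rewrite subrK. Qed.
Lemma inv_ReE z : Re z^-1 = Re z / md z ^+ 2.
Proof. by rewrite md_sq; case: z. Qed.
Lemma inv_ImE z : Im z^-1 = - Im z / md z ^+ 2.
Proof. by rewrite md_sq; case: z => a b /=; rewrite mulNr. Qed.
Lemma mulc_conj z : z * (conjc z) = (md z ^+ 2)%:C.
Proof.
by apply: complex_eq; rewrite md_sq !CE; case: z => a b /=; ring.
Qed.
Lemma md1_conj z : md z = 1 -> (conjc z) = z^-1.
Proof.
move=> h; have z0 : z != 0 by rewrite -md_gt0 h.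
by apply: (mulfI z0); rewrite mulfV// mulc_conj h expr1n.
Qed.
Lemma real_complex_Z x z : x%:C * z = (x * Re z) +i* (x * Im z).
Proof. by apply: complex_eq; rewrite !CE/= ?mul0r ?subr0 ?addr0. Qed.
Lemma ReZ x z : Re (x%:C * z) = x * Re z. Proof. by rewrite !CE; ring. Qed.
Lemma ImZ x z : Im (x%:C * z) = x * Im z. Proof. by rewrite !CE; ring. Qed.

Lemma cexp0 : cexp 0 = 1 :> R[i].
Proof. by rewrite /cexp /= expR0 cos0 sin0 mul1r. Qed.
Lemma cexpD z u : cexp (z + u) = cexp z * cexp u.
Proof.
by apply: complex_eq; rewrite /cexp !CE/= expRD cosD sinD; ring.
Qed.
Lemma cexp_neq0 z : cexp z != 0.
Proof.
apply/eqP => h; have := cexpD z (- z); rewrite h mul0r subrr cexp0.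
by move/eqP; rewrite oner_eq0.
Qed.
Lemma cexpN z : cexp (- z) = (cexp z)^-1.
Proof.
apply: (mulfI (cexp_neq0 z)); rewrite -cexpD subrr cexp0 mulfV//.
exact: cexp_neq0.
Qed.
Lemma cexpB z u : cexp (z - u) = cexp z / cexp u.
Proof. by rewrite cexpD cexpN. Qed.
Lemma md_cexp z : md (cexp z) = expR (Re z).
Proof.
rewrite /cexp mdM mdC gtr0_norm ?expR_gt0// /md /= cos2Dsin2 sqrtr1 mulr1//.
Qed.
Lemma cexpMn z n : cexp (z *+ n) = cexp z ^+ n.
Proof. by elim: n => [|n ih]; rewrite ?mulr0n ?cexp0// mulrS cexpD ih exprS. Qed.
Lemma cexp_i x : cexp ('i * x%:C) = cos x +i* sin x.
Proof.
have -> : 'i * x%:C = 0 +i* x :> R[i].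
  by apply: complex_eq; rewrite !CE/= ?mul0r ?mulr0 ?mul1r ?subr0 ?add0r ?addr0.
by rewrite /cexp/= expR0 mul1r.
Qed.
Lemma cexp_2pi : cexp ('i * (2 * pi)%:C) = 1 :> R[i].
Proof. by rewrite cexp_i mulr_natl cos2pi sin2pi. Qed.

Lemma cexp_2pi_int (n : int) : cexp ('i * (n%:~R * (2 * pi))%:C) = 1 :> R[i].
Proof.
have h (m : nat) : cexp ('i * (m%:R * (2 * pi))%:C) = 1 :> R[i].
  by rewrite rmorphM rmorph_nat mulrCA [m%:R * _]mulr_natl cexpMn cexp_2pi expr1n.
case: n => m; first exact: h.
by rewrite NegzE mulrNz mulNr rmorphN mulrN cexpN h invr1.
Qed.

End ComplexModulus.
Local Notation Re := (@complex.Re _).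
Local Notation Im := (@complex.Im _).
(** The form in which most limits are taken below: an error [C / N] for every [N]. No sign of [C] is
    asked for, since the case [N = 1] settles it. *)
Lemma le0_divn (R : realType) (x C : R) :
  (forall N, (0 < N)%N -> x <= C / N%:R) -> x <= 0.
Proof.
move=> h; rewrite leNgt; apply/negP => x0.
have C0 : 0 < C by have := h 1%N isT; rewrite divr1; apply: lt_le_trans.
have [N hN] : exists N : nat, C / x < N%:R.
  exists (Num.Def.truncn (C / x)).+1; exact: truncnS_gt.
have N0 : (0 < N)%N by rewrite -(ltr_nat R); apply: lt_trans hN; rewrite divr_gt0.
have := h _ N0; rewrite ler_pdivlMr ?ltr0n//; move: hN; rewrite ltr_pdivrMr// mulrC.
by move=> /lt_le_trans h1 /h1; rewrite ltxx.
Qed.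

(** * Telescoping along the unit interval *)

Section Telescope.
Context {R : realType}.

(** Over [N] equal steps the linear parts add up to [A] and the quadratic ones to [B / N]. With
    [A = 0] a path of vanishing derivative is constant, without any derivative being defined. *)
Lemma quad_telescope (phi : R -> R[i]) (A B : R) :
  (forall s t, 0 <= s -> s <= t -> t <= 1 ->
     md (phi t - phi s) <= A * (t - s) + B * (t - s) ^+ 2) ->
  md (phi 1 - phi 0) <= A.
Proof.
move=> h; rewrite -subr_le0; apply: (@le0_divn R _ B) => N N0.
have NR : 0 < N%:R :> R by rewrite ltr0n.
have step n : (n <= N)%N -> md (phi (n%:R / N%:R) - phi 0) <= n%:R * (A / N%:R + B / N%:R ^+ 2).
  elim: n => [|n ih] nN; first by rewrite !mul0r subrr md0.
  have a0 : 0 <= n%:R / N%:R :> R by rewrite divr_ge0.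
  have ab : n%:R / N%:R <= n.+1%:R / N%:R :> R by rewrite ler_pM2r ?invr_gt0// ler_nat.
  have b1 : n.+1%:R / N%:R <= 1 :> R by rewrite ler_pdivrMr// mul1r ler_nat.
  have e : n.+1%:R / N%:R - n%:R / N%:R = N%:R^-1 :> R.
    by rewrite -mulrBl -natr1 addrAC subrr add0r mul1r.
  apply: le_trans (mdBD _ (phi (n%:R / N%:R)) _) _.
  have -> : n.+1%:R * (A / N%:R + B / N%:R ^+ 2) =
     (A / N%:R + B / N%:R ^+ 2) + n%:R * (A / N%:R + B / N%:R ^+ 2).
    by rewrite -natr1; ring.
  rewrite lerD ?ih 1?ltnW//.
  by have := h _ _ a0 ab b1; rewrite e exprVn.
have := step N (leqnn N); rewrite divff ?gt_eqF// => e.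
rewrite lerBlDr; apply: le_trans e _.
by rewrite le_eqVlt; apply/orP; left; apply/eqP; field; rewrite gt_eqF.
Qed.
End Telescope.

(** * Second-order bounds for exponential, sine and cosine *)

Section ExpBounds.
Context {R : realType}.
Implicit Types (x y : R).

(** Convexity only: [1 + x <= expR x] taken at [x] and at [- x] gives
    [0 <= expR x - 1 - x <= x (expR x - 1)], and a second use bounds the last factor. *)
Lemma expR_quad (x B : R) : `|x| <= B -> `|expR x - 1 - x| <= expR B * x ^+ 2.
Proof.
move=> xB.
have h1 : 1 + x <= expR x := expR_ge1Dx x.
have h2 : 1 - x <= expR (- x) := expR_ge1Dx (- x).
have e0 : 0 < expR x := expR_gt0 x.
have ee : expR (- x) * expR x = 1 by rewrite -expRD addNr expR0.
have h3 : expR x - 1 <= x * expR x by nra.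
have hB : expR x <= expR B by rewrite ler_expR (le_trans (ler_norm _) xB).
have hB1 : 1 <= expR B by rewrite -expR0 ler_expR (le_trans _ xB).
rewrite ger0_norm; last lra.
have [x0|x0] := leP 0 x; nra.
Qed.

Lemma sin_le_norm x : `|sin x| <= `|x|.
Proof.
have [c _ /=] := @MVT_segment R sin cos 0 `|x| (normr_ge0 x)
   (fun y _ => is_derive_sin y) (continuous_subspaceT (@continuous_sin R)).
rewrite sin0 !subr0 => h.
have -> : `|sin x| = `|sin `|x| |.
  by have [x0|x0] := leP 0 x; rewrite ?(ger0_norm x0)// (ltr0_norm x0) sinN normrN.
by rewrite h normrM normr_id ler_piMl// cos_max.
Qed.

Lemma cos_quad x : 0 <= 1 - cos x <= x ^+ 2.
Proof.
rewrite subr_ge0 cos_le1/=.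
have -> : x = (x / 2) *+ 2 by rewrite -mulr_natr divfK// pnatr_eq0.
set t := x / 2.
have h := sin_le_norm t.
have h2 : sin t ^+ 2 <= t ^+ 2.
  by rewrite -(real_normK (num_real (sin t))) -(real_normK (num_real t)) ler_pXn2r ?nnegrE.
rewrite cos_mulr2n cos2sin2 -mulr_natr; nra.
Qed.

Lemma sin_quad x : `|sin x - x| <= x ^+ 2.
Proof.
wlog x0 : x / 0 <= x.
  move=> h; have [/h//|x0] := leP 0 x.
  have := h (- x); rewrite sinN oppr_ge0 (ltW x0) => /(_ isT).
  by rewrite -opprD normrN sqrrN.
have [c ci /=] := @MVT_segment R (fun x => sin x - x) (fun x => cos x - 1) 0 x x0
   (fun y _ => is_deriveB (is_derive_sin y) (is_derive_id y 1)) (continuous_subspaceT 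
    (fun y => cvgB (@continuous_sin R y) cvg_id)).
rewrite sin0 !subr0 => ->; rewrite normrM (ger0_norm x0) expr2 ler_wpM2r//.
have /andP[c0 cx] : 0 <= c <= x by move: ci; rewrite in_itv.
rewrite distrC ger0_norm ?subr_ge0 ?cos_le1//.
have -> : c = (c / 2) *+ 2 by rewrite -mulr_natr divfK// pnatr_eq0.
have := sin_le_norm (c / 2); rewrite (ger0_norm (_ : 0 <= c / 2)) ?divr_ge0//.
have := sin_max (c/2); set s := `|_|%R => s1 s2.
have s0 : 0 <= s by exact: normr_ge0.
rewrite cos_mulr2n cos2sin2 -(real_normK (num_real (sin _))) -/s -mulr_natr; nra.
Qed.

(** The real part is split as [(e^x - 1 - x) - e^x (1 - cos y)], the imaginary part as
    [(e^x - 1) y + e^x (sin y - y)]; each piece is of second order. The constant is merely large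
    enough to absorb the four of them. *)
Lemma cexp_quad (d : R[i]) (B : R) : md d <= B ->
  md (cexp d - 1 - d) <= (8 * expR B * (1 + B)) * md d ^+ 2.
Proof.
move=> dB; have d0 := md_ge0 d.
have B0 : 0 <= B by apply: le_trans dB.
set x := Re d; set y := Im d.
have xd : `|x| <= md d := Re_le_md d.
have yd : `|y| <= md d := Im_le_md d.
have xB : `|x| <= B := le_trans xd dB.
have hx := expR_quad xB.
have K1 : 1 <= expR B by rewrite -expR0 ler_expR.
have hK : expR x <= expR B by rewrite ler_expR (le_trans (ler_norm _) xB).
have e0 : 0 < expR x := expR_gt0 x.
have /andP[c0 cy] := cos_quad y.
have sy := sin_quad y.
set m := md d in dB d0 xd yd *.
have x2 : x ^+ 2 <= m ^+ 2.
  by rewrite -(real_normK (num_real x)) ler_pXn2r ?nnegrE.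
have y2 : y ^+ 2 <= m ^+ 2.
  by rewrite -(real_normK (num_real y)) ler_pXn2r ?nnegrE.
set K := expR B in hx K1 hK *.
have m2 : 0 <= m ^+ 2 by apply: sqr_ge0.
have ex1 : `|expR x - 1| <= K * (1 + B) * m.
  have := ler_normD (expR x - 1 - x) x; rewrite subrK => /le_trans; apply.
  have : K * x ^+ 2 <= K * (B * m) by rewrite ler_wpM2l//; nra.
  nra.
apply: le_trans (md_le _) _; rewrite /cexp !CE -/x -/y/=.
have -> : expR x * cos y - 0 * sin y - 1 - x
   = (expR x - 1 - x) - expR x * (1 - cos y) by ring.
have -> : expR x * sin y + 0 * cos y - 0 - y
   = (expR x - 1) * y + expR x * (sin y - y) by ring.
have t1 : `|expR x * (1 - cos y)| <= K * m ^+ 2.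
  rewrite normrM gtr0_norm// (ger0_norm c0) ler_pM// ?(ltW e0)//.
  exact: le_trans y2.
have t2 : `|(expR x - 1) * y| <= K * (1 + B) * m * m.
  by rewrite normrM ler_pM.
have t3 : `|expR x * (sin y - y)| <= K * m ^+ 2.
  rewrite normrM gtr0_norm// ler_pM// ?(ltW e0)//.
  exact: le_trans y2.
have := ler_normB (expR x - 1 - x) (expR x * (1 - cos y)).
have := ler_normD ((expR x - 1) * y) (expR x * (sin y - y)).
have : K * x ^+ 2 <= K * m ^+ 2 by rewrite ler_wpM2l//; lra.
have : 0 <= K * B * m ^+ 2 by rewrite !mulr_ge0//; lra.
have : 0 <= K * m ^+ 2 by rewrite !mulr_ge0//; lra.
move: t2; rewrite -mulrA -expr2 => t2.
lra.
Qed.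

Lemma cexp_surj (z : R[i]) : z != 0 -> exists d, cexp d = z.
Proof.
move=> z0; have m0 : 0 < md z by rewrite md_gt0.
have [a ha] : exists a : R, cos a = Re z / md z /\ sin a = Im z / md z.
  have h : -1 <= Re z / md z <= 1.
    by rewrite -ler_norml normrM normfV (gtr0_norm m0) ler_pdivrMr// mul1r Re_le_md.
  have hc := acosK h.
  have hs := sin_acos h.
  have e : 1 - (Re z / md z) ^+ 2 = (Im z / md z) ^+ 2.
    rewrite !exprMn -[1](@divff _ (md z ^+ 2)) ?expf_neq0 ?gt_eqF//.
    rewrite exprVn -mulrBl md_sq; congr (_ / _); ring.
  rewrite e sqrtr_sqr in hs.
  have [i0|i0] := leP 0 (Im z / md z).
    by exists (acos (Re z / md z)); rewrite hc hs ger0_norm.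
  exists (- acos (Re z / md z)); rewrite cosN sinN hc hs ltr0_norm// opprK//.
exists (ln (md z) +i* a); case: ha => hc hs.
rewrite /cexp /= lnK ?posrE// hc hs real_complex_Z/=.
by apply: complex_eq => /=; rewrite mulrCA divff ?gt_eqF// mulr1.
Qed.
End ExpBounds.

(** * Measurability and integration of complex functions *)

Section MeasurableComplex.
Context d {T : measurableType d} {R : realType}.
Implicit Types f g : T -> R[i].

Definition mfC f := measurable_fun setT (fun x => Re (f x)) /\
  measurable_fun setT (fun x => Im (f x)).

Lemma mfC_cst (c : R[i]) : mfC (fun=> c).
Proof. by split; exact: measurable_cst. Qed.
Lemma mfC_real (f : T -> R) : measurable_fun setT f -> mfC (fun x => (f x)%:C).
Proof. by move=> mf; split => //=; exact: measurable_cst. Qed.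
Lemma mfCD f g : mfC f -> mfC g -> mfC (fun x => f x + g x).
Proof.
move=> [f1 f2] [g1 g2]; split.
  by under eq_fun do rewrite ReD; exact: measurable_funD.
by under eq_fun do rewrite ImD; exact: measurable_funD.
Qed.
Lemma mfCM f g : mfC f -> mfC g -> mfC (fun x => f x * g x).
Proof.
move=> [f1 f2] [g1 g2]; split.
  by under eq_fun do rewrite ReM; apply: measurable_funB; exact: measurable_funM.
by under eq_fun do rewrite ImM; apply: measurable_funD; exact: measurable_funM.
Qed.
Lemma mfCN f : mfC f -> mfC (fun x => - f x).
Proof.
by move=> [f1 f2]; split; under eq_fun do rewrite ?ReN ?ImN; exact: measurable_funN.
Qed.
Lemma mfCB f g : mfC f -> mfC g -> mfC (fun x => f x - g x).
Proof. by move=> mf mg; apply: mfCD => //; exact: mfCN. Qed.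
Lemma mfC_sum I (s : seq I) (h : I -> T -> R[i]) : (forall i, mfC (h i)) ->
  mfC (fun x => \sum_(i <- s) h i x).
Proof.
move=> mh; split; under eq_fun do rewrite ?Re_sum ?Im_sum; apply: measurable_sum => i.
  by have [] := mh i.
by have [] := mh i.
Qed.
Lemma mfC_comp d' (T' : measurableType d') (f : T' -> R[i]) (X : T -> T') :
  (measurable_fun setT (fun x => Re (f x)) /\
  measurable_fun setT (fun x => Im (f x))) ->
  measurable_fun setT X -> mfC (f \o X).
Proof.
by move=> [f1 f2] mX; split; [exact: (measurableT_comp f1)|exact: (measurableT_comp f2)].
Qed.

Lemma measurable_invr : measurable_fun setT (fun x : R => x^-1).
Proof.
(* Away from [0] the inverse is continuous; at [0] it has the default value [0]. *)
have -> : (fun x : R => x^-1) = (fun x => if x == 0 then 0 else x^-1).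
  by apply/funext => x; case: eqP => [->|//]; rewrite invr0.
apply: measurable_fun_if => //.
- by apply: measurable_fun_eqr => //; exact: measurable_cst.
- have -> : [set: R] `&` (fun x : R => x == 0) @^-1` [set false] = ~` [set 0].
    rewrite setTI; apply/seteqP; split => x /=; first by move=> /negbT/eqP.
    by move/eqP/negbTE.
  apply: open_continuous_measurable_fun.
    by apply: closed_openC; apply: accessible_closed_set1; apply: hausdorff_accessible; exact: norm_hausdorff.
  move=> x; rewrite inE /= => /eqP x0.
  exact: inv_continuous.
Qed.

Lemma mfCV f : mfC f -> mfC (fun x => (f x)^-1).
Proof.
move=> [f1 f2].
have mm : measurable_fun setT (fun x => (md (f x) ^+ 2)^-1).
  apply: (measurableT_comp measurable_invr).
  under eq_fun do rewrite md_sq.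
  by apply: measurable_funD; exact: measurable_funX.
split; under eq_fun do rewrite ?inv_ReE ?inv_ImE; apply: measurable_funM => //.
exact: measurable_funN.
Qed.
Lemma mfC_div f g : mfC f -> mfC g -> mfC (fun x => f x / g x).
Proof. by move=> mf mg; apply: mfCM => //; exact: mfCV. Qed.
End MeasurableComplex.

Section ComplexIntegral.
Context d {T : measurableType d} {R : realType} (P : probability T R).
Variable D : set T.
Hypotheses (mD : measurable D) (PD : P D = 1%E).
Implicit Types (f g : T -> R[i]) (u v : T -> R).

Lemma full_setC : P (~` D) = 0.
Proof. by rewrite probability_setC// PD subee. Qed.

Lemma integrable_bdd u (M : R) : measurable_fun setT u ->
  (forall x, D x -> `|u x| <= M) -> P.-integrable setT (EFin \o u).
Proof.
move=> mu uM; apply/(negligible_integrable _ _ _ full_setC) => //.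
- exact: measurableC.
- exact/measurable_EFinP.
rewrite setDE setCK setTI; apply: measurable_bounded_integrable => //.
- exact: (le_lt_trans (probability_le1 P mD) (ltry 1)).
- exact: measurable_funTS.
exists M; split; first exact: num_real.
by move=> x Mx y Dy /=; apply: le_trans (uM _ Dy) (ltW Mx).
Qed.

Lemma RInt_full u : P.-integrable setT (EFin \o u) ->
  RInt P u = (\int[P]_(x in D) u x)%R.
Proof.
move=> iu; rewrite /RInt /Rintegral.
rewrite (negligible_integral _ _ iu full_setC)//; last exact: measurableC.
by rewrite setDE setCK setTI.
Qed.

Lemma integrable_full u : P.-integrable setT (EFin \o u) ->
  P.-integrable D (EFin \o u).
Proof. by move=> iu; apply: integrableS iu. Qed.

Lemma RInt_le u v : P.-integrable setT (EFin \o u) -> P.-integrable setT (EFin \o v) ->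
  (forall x, D x -> u x <= v x) -> RInt P u <= RInt P v.
Proof.
move=> iu iv uv; rewrite !RInt_full//; apply: le_Rintegral => //; exact: integrable_full.
Qed.

Lemma RInt_eq u v : P.-integrable setT (EFin \o u) -> P.-integrable setT (EFin \o v) ->
  (forall x, D x -> u x = v x) -> RInt P u = RInt P v.
Proof.
move=> iu iv uv; apply/eqP; rewrite eq_le !RInt_le// => x /uv ->//.
Qed.

Lemma RInt_cst (c : R) : RInt P (fun=> c) = c.
Proof.
exact: etrans (@Rintegral_cst _ _ _ P setT measurableT c)
  (etrans (congr1 (fun t => c * fine t) (probability_setT P)) (mulr1 c)).
Qed.

Lemma RIntD u v : P.-integrable setT (EFin \o u) -> P.-integrable setT (EFin \o v) ->
  RInt P (fun x => u x + v x) = RInt P u + RInt P v.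
Proof. by move=> iu iv; exact: RintegralD. Qed.

Lemma RIntZ c u : P.-integrable setT (EFin \o u) ->
  RInt P (fun x => c * u x) = c * RInt P u.
Proof. by move=> iu; exact: RintegralZl. Qed.

Lemma integrableZ_R c u : P.-integrable setT (EFin \o u) ->
  P.-integrable setT (EFin \o (fun x => c * u x)).
Proof. by move=> iu; exact: (integrableZl _ c iu). Qed.
Lemma integrableD_R u v : P.-integrable setT (EFin \o u) -> P.-integrable setT (EFin \o v) ->
  P.-integrable setT (EFin \o (fun x => u x + v x)).
Proof. by move=> iu iv; exact: (integrableD _ iu iv). Qed.

Lemma RInt_dct (u_ : nat -> T -> R) u (M : R) :
  (forall n, measurable_fun setT (u_ n)) -> measurable_fun setT u ->
  (forall n x, D x -> `|u_ n x| <= M) ->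
  (forall x, D x -> u_ ^~ x @ \oo --> u x) ->
  (fun n => RInt P (u_ n)) @ \oo --> RInt P u.
Proof.
move=> mu_ mu uM uu.
have uM' x : D x -> `|u x| <= M.
  move=> Dx; rewrite -(cvg_lim _ (uu x Dx))//.
  rewrite -lim_norm; last by apply/cvg_ex; eexists; exact: uu.
  apply: limr_le; last by near=> n; exact: uM.
  apply: is_cvg_norm; apply/cvg_ex; eexists; exact: uu.
have ig : P.-integrable D (EFin \o (fun=> M)).
  apply: integrable_full; apply: (@integrable_bdd _ `|M|); first exact: measurable_cst.
  by [].
have mD_ v : measurable_fun setT v -> measurable_fun D (EFin \o v).
  by move=> mv; apply/measurable_EFinP; exact: measurable_funTS.
have cv x : D x -> (fun n => (EFin \o u_ n) x) @ \oo --> (EFin \o u) x.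
  by move=> Dx; apply: cvg_EFin; [exact: nearW|exact: uu].
have bd n x : D x -> (`|(EFin \o u_ n) x| <= (EFin \o (fun=> M)) x)%E.
  by move=> Dx; rewrite /= lee_fin; exact: uM.
have [_ _ cvgI] := @dominated_convergence _ _ _ P D mD (fun n => EFin \o u_ n) (EFin \o u)
  (EFin \o (fun=> M)) (fun n => mD_ _ (mu_ n)) (mD_ _ mu)
  (aeW _ cv) ig
  (aeW _ (fun x n => bd n x)).
have iu_ n : P.-integrable setT (EFin \o u_ n) := integrable_bdd (mu_ n) (uM n).
have iu : P.-integrable setT (EFin \o u) := integrable_bdd mu uM'.
rewrite (RInt_full iu); under eq_fun do rewrite (RInt_full (iu_ _)).
apply: fine_cvg; rewrite fineK; first exact: cvgI.
exact: integrable_fin_num (integrable_full iu).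
Unshelve. all: by end_near. Qed.
End ComplexIntegral.
(** Stated with the real-valued [md], so that the estimates apply as they are; [ccvgE] identifies it
    with convergence in the topology of [R[i]]. *)
Definition ccvg {R : realType} (u : nat -> R[i]) (l : R[i]) :=
  forall e : R, 0 < e -> exists N : nat, forall n, (N <= n)%N -> md (u n - l) <= e.

Section ComplexConvergence.
Context {R : realType}.
Implicit Types (u v : nat -> R[i]) (l : R[i]).

Lemma ccvg_unique u l l' : ccvg u l -> ccvg u l' -> l = l'.
Proof.
move=> h h'; apply: mdB_le0; apply/ler_addgt0Pr => e e0.
have [N hN] := h _ (divr_gt0 e0 (ltr0n R 2)).
have [N' hN'] := h' _ (divr_gt0 e0 (ltr0n R 2)).
have {}hN := hN _ (leq_maxl N N'); have {}hN' := hN' _ (leq_maxr N N').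
rewrite add0r (splitr e); apply: le_trans (mdBD _ (u (maxn N N')) _) _.
by rewrite mdB lerD.
Qed.

Lemma ccvg_Re u l : ccvg u l -> (fun n => Re (u n)) @ \oo --> Re l.
Proof.
move=> h; apply/cvgrPdist_le => e e0; have [N hN] := h e e0.
exists N => // n /= Nn; rewrite distrC -ReN -ReD.
exact: le_trans (Re_le_md _) (hN _ Nn).
Qed.
Lemma ccvg_Im u l : ccvg u l -> (fun n => Im (u n)) @ \oo --> Im l.
Proof.
move=> h; apply/cvgrPdist_le => e e0; have [N hN] := h e e0.
exists N => // n /= Nn; rewrite distrC -ImN -ImD.
exact: le_trans (Im_le_md _) (hN _ Nn).
Qed.
Lemma ccvgP u l : (fun n => Re (u n)) @ \oo --> Re l ->
  (fun n => Im (u n)) @ \oo --> Im l -> ccvg u l.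
Proof.
move=> /cvgrPdist_le h1 /cvgrPdist_le h2 e e0.
have e2 : 0 < e / 2 by rewrite divr_gt0.
have [N _ hN] := h1 _ e2; have [N' _ hN'] := h2 _ e2.
exists (maxn N N') => n; rewrite geq_max => /andP[Nn Nn'].
apply: le_trans (md_le _) _; rewrite (splitr e) ReD ImD ReN ImN.
by rewrite distrC [X in _ + X]distrC lerD// ?hN ?hN'.
Qed.

Lemma ccvg_le u l (r : nat -> R) : (forall n, md (u n - l) <= r n) ->
  r @ \oo --> 0 -> ccvg u l.
Proof.
move=> h /cvgrPdist_le hr e e0; have [N _ hN] := hr _ e0.
exists N => n Nn; apply: le_trans (h n) _.
by have := hN _ Nn; rewrite sub0r normrN; apply: le_trans; exact: ler_norm.
Qed.

Lemma ccvg_cst l : ccvg (fun=> l) l.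
Proof. by move=> e e0; exists 0%N => n _; rewrite subrr md0 ltW. Qed.

Lemma ccvg_eq u v l : (forall n, u n = v n) -> ccvg u l -> ccvg v l.
Proof. by move=> uv h e e0; have [N hN] := h e e0; exists N => n /hN; rewrite uv. Qed.
End ComplexConvergence.

Section CInt.
Context d {T : measurableType d} {R : realType} (P : probability T R).
Implicit Types (f g : T -> R[i]).

Definition ibl f := P.-integrable setT (EFin \o (fun x => Re (f x))) /\
  P.-integrable setT (EFin \o (fun x => Im (f x))).

Lemma iblD f g : ibl f -> ibl g -> ibl (fun x => f x + g x).
Proof.
move=> [f1 f2] [g1 g2]; split.
  rewrite (_ : (fun x => _) = (fun x => Re (f x) + Re (g x))); last by apply/funext => x; rewrite ReD.
  exact: integrableD_R.
rewrite (_ : (fun x => _) = (fun x => Im (f x) + Im (g x))); last by apply/funext => x; rewrite ImD.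
exact: integrableD_R.
Qed.
Lemma iblZ c f : ibl f -> ibl (fun x => c * f x).
Proof.
move=> [f1 f2]; split.
  rewrite (_ : (fun x => _) = (fun x => Re c * Re (f x) + (- Im c) * Im (f x))); last by apply/funext => x; rewrite ReM mulNr.
  by apply: integrableD_R; exact: integrableZ_R.
rewrite (_ : (fun x => _) = (fun x => Re c * Im (f x) + Im c * Re (f x))); last by apply/funext => x; rewrite ImM.
by apply: integrableD_R; exact: integrableZ_R.
Qed.
Lemma ibl_cst c : ibl (fun=> c).
Proof.
by split; apply: (integrable_bdd measurableT (probability_setT P) (M := md c));
  [exact: measurable_cst|move=> x _; exact: Re_le_md|exact: measurable_cst|move=> x _; exact: Im_le_md].
Qed.
Lemma CIntD f g : ibl f -> ibl g -> CInt P (fun x => f x + g x) = CInt P f + CInt P g.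
Proof.
move=> [f1 f2] [g1 g2]; apply: complex_eq; rewrite !CE /CInt /=.
  by rewrite -RIntD//; congr RInt; apply/funext => x; rewrite ReD.
by rewrite -RIntD//; congr RInt; apply/funext => x; rewrite ImD.
Qed.
Lemma CIntZ c f : ibl f -> CInt P (fun x => c * f x) = c * CInt P f.
Proof.
move=> [f1 f2]; apply: complex_eq; rewrite !CE /CInt /=.
  rewrite -mulNr -!RIntZ// -RIntD; [|exact: integrableZ_R..].
  by congr RInt; apply/funext => x; rewrite ReM mulNr.
rewrite -!RIntZ// -RIntD; [|exact: integrableZ_R..].
by congr RInt; apply/funext => x; rewrite ImM.
Qed.
Lemma CInt_cst c : CInt P (fun=> c) = c.
Proof. by apply: complex_eq; rewrite /CInt/= RInt_cst. Qed.
Lemma CIntN f : ibl f -> CInt P (fun x => - f x) = - CInt P f.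
Proof.
by move=> hf; under eq_fun do rewrite -mulN1r; rewrite CIntZ// mulN1r.
Qed.
Lemma iblN f : ibl f -> ibl (fun x => - f x).
Proof. by move=> hf; under eq_fun do rewrite -mulN1r; exact: iblZ. Qed.
Lemma iblB f g : ibl f -> ibl g -> ibl (fun x => f x - g x).
Proof. by move=> hf hg; apply: iblD => //; exact: iblN. Qed.
Lemma CIntB f g : ibl f -> ibl g -> CInt P (fun x => f x - g x) = CInt P f - CInt P g.
Proof. by move=> hf hg; rewrite CIntD ?CIntN//; exact: iblN. Qed.
Lemma ibl_sum I (s : seq I) (h : I -> T -> R[i]) : (forall i, ibl (h i)) ->
  ibl (fun x => \sum_(i <- s) h i x).
Proof.
move=> hh; elim: s => [|i s ih].
  by under eq_fun do rewrite big_nil; exact: ibl_cst.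
by under eq_fun do rewrite big_cons; exact: iblD.
Qed.
Lemma CInt_sum I (s : seq I) (h : I -> T -> R[i]) : (forall i, ibl (h i)) ->
  CInt P (fun x => \sum_(i <- s) h i x) = \sum_(i <- s) CInt P (h i).
Proof.
move=> hh; elim: s => [|i s ih].
  by under eq_fun do rewrite big_nil; rewrite CInt_cst big_nil.
by under eq_fun do rewrite big_cons; rewrite CIntD ?big_cons ?ih//; exact: ibl_sum.
Qed.
Lemma Re_CInt f : Re (CInt P f) = RInt P (fun x => Re (f x)).
Proof. by []. Qed.
Lemma Im_CInt f : Im (CInt P f) = RInt P (fun x => Im (f x)).
Proof. by []. Qed.

Variable D : set T.
Hypotheses (mD : measurable D) (PD : P D = 1%E).

Lemma ibl_bdd f M : mfC f -> (forall x, D x -> md (f x) <= M) -> ibl f.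
Proof.
move=> [m1 m2] fM; split; apply: (integrable_bdd mD PD (M := M)) => // x Dx.
  exact: le_trans (Re_le_md _) (fM _ Dx).
exact: le_trans (Im_le_md _) (fM _ Dx).
Qed.
Lemma CInt_eq f g : ibl f -> ibl g -> (forall x, D x -> f x = g x) ->
  CInt P f = CInt P g.
Proof.
move=> [f1 f2] [g1 g2] fg; apply: complex_eq; rewrite /CInt/=;
  by apply: (RInt_eq mD PD) => // x Dx; rewrite fg.
Qed.
(** Rotating by the conjugate of the integral [I] reduces to a real integral:
    [|I|^2 = Re CInt (conj I * f) <= |I| M]. *)
Lemma md_CInt f M : ibl f -> (forall x, D x -> md (f x) <= M) -> md (CInt P f) <= M.
Proof.
move=> hf fM; set I := CInt P f.
have [->|I0] := eqVneq I 0.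
  (* For [I = 0] there is nothing to rotate; [0 <= M] comes from a point of [D], which is nonempty
     as it has mass one. *)
  rewrite md0; have : D !=set0.
    apply/set0P/eqP => D0; move: PD; rewrite D0 measure0 => /esym/eqP.
    by rewrite onee_eq0.
  by move=> [x Dx]; apply: le_trans (fM _ Dx); exact: md_ge0.
have m0 : 0 < md I by rewrite md_gt0.
rewrite -(ler_pM2l m0) -expr2.
have -> : md I ^+ 2 = Re (CInt P (fun x => (conjc I) * f x)).
  by rewrite CIntZ// -/I mulrC mulc_conj ReC.
rewrite Re_CInt -[leRHS](@RInt_cst _ _ _ P).
apply: (RInt_le mD PD).
- by have [] := iblZ ((conjc I)) hf.
- by have [] := ibl_cst (md I * M)%:C.
move=> x Dx; apply: le_trans (Re_le _) _.
by rewrite mdM md_conj ler_wpM2l ?fM// ltW.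
Qed.
Lemma CInt_dct (f_ : nat -> T -> R[i]) f M : (forall n, mfC (f_ n)) -> mfC f ->
  (forall n x, D x -> md (f_ n x) <= M) -> (forall x, D x -> ccvg (f_ ^~ x) (f x)) ->
  ccvg (fun n => CInt P (f_ n)) (CInt P f).
Proof.
move=> mf_ mf fM ff; apply: ccvgP; rewrite /CInt/=.
  apply: (RInt_dct mD PD (M := M)) => [n||n x Dx|x Dx].
  - by have [] := mf_ n.
  - by have [] := mf.
  - exact: le_trans (Re_le_md _) (fM _ _ Dx).
  - exact: ccvg_Re (ff _ Dx).
apply: (RInt_dct mD PD (M := M)) => [n||n x Dx|x Dx].
- by have [] := mf_ n.
- by have [] := mf.
- exact: le_trans (Im_le_md _) (fM _ _ Dx).
- exact: ccvg_Im (ff _ Dx).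
Qed.
End CInt.

Section PushForward.
Context d {T : measurableType d} d' {T' : measurableType d'} {R : realType}.

Lemma CInt_push (P : probability T R) (Q : probability T' R) (X : T -> T') (f : T' -> R[i]) :
  measurable_fun setT X -> (forall A, measurable A -> Q A = P (X @^-1` A)) ->
  mfC f -> ibl P (f \o X) -> CInt Q f = CInt P (f \o X).
Proof.
move=> mX QP [mf1 mf2] [i1 i2].
have h (u : T' -> R) : measurable_fun setT u -> P.-integrable setT (EFin \o (u \o X)) ->
    RInt Q u = RInt P (u \o X).
  move=> mu iu; rewrite /RInt; congr fine.
  rewrite (@eq_measure_integral _ _ _ setT (pushforward P X)); last first.
    by move=> A mA _; exact: QP.
  rewrite integral_pushforward//; first by apply/measurable_EFinP.
by apply: complex_eq; rewrite /CInt /= h.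
Qed.
End PushForward.
Section PushProbability.
Context d {T : measurableType d} d' {T' : measurableType d'} {R : realType}.

Definition push (P : probability T R) (X : T -> T') (mX : measurable_fun setT X) :
  probability T' R := distribution P (mfun_Sub (mem_set mX : X \in mfun)).

Lemma pushE P X (mX : measurable_fun setT X) A : push P mX A = P (X @^-1` A).
Proof. by []. Qed.
End PushProbability.

(** * The uniform law on the unit interval and integrals over subintervals *)

Section Uniform01.
Context {R : realType}.
Implicit Types (f g : R -> R[i]) (s t : R).

(* [uniform_prob] lives on [measurableTypeR R], which carries the same measurable
   sets as [R] but another display. *)
Lemma measurable_toR : measurable_fun setT (idfun : measurableTypeR R -> R).
Proof. by move=> _ A mA; rewrite setTI. Qed.
Definition U01 : probability R R := push (uniform_prob (@ltr01 R)) measurable_toR.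

Lemma U01_itv s t : 0 <= s -> s <= t -> t <= 1 -> U01 `]s, t]%classic = (t - s)%:E.
Proof.
move=> s0 st t1; rewrite -[LHS]/(uniform_prob (@ltr01 R) `]s, t]%classic) /uniform_prob.
rewrite integral_uniform_pdf.
have -> : `]s, t]%classic `&` `[0, 1]%classic = `]s, t]%classic :> set R.
  apply/seteqP; split => x /=; rewrite !in_itv/=; first by case.
  by move=> /andP[sx xt]; rewrite sx xt; split => //; lra.
rewrite (eq_integral (fun=> 1%:E)); last first.
  move=> x; rewrite inE /= in_itv/= /uniform_pdf => /andP[sx xt].
  by rewrite ifT ?subr0 ?invr1//; apply/andP; split; lra.
rewrite integral_cst//= mul1e lebesgue_measure_itv/= lte_fin.
case: (ltP s t) => ts; first by rewrite EFinB.
have -> : s = t by lra.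
by rewrite subrr.
Qed.

Lemma U01_unit : U01 `]0, 1]%classic = 1%E.
Proof. by rewrite U01_itv// subr0. Qed.

Lemma RInt_indic s t : 0 <= s -> s <= t -> t <= 1 ->
  RInt U01 (fun x => \1_(`]s, t]%classic) x) = t - s.
Proof.
move=> s0 st t1; rewrite /RInt integral_indic//= setIT.
by rewrite [X in fine X](U01_itv s0 st t1).
Qed.
End Uniform01.
Arguments U01 : simpl never.

Section CIntBound.
Context d {T : measurableType d} {R : realType} (P : probability T R).
Variable D : set T.
Hypotheses (mD : measurable D) (PD : P D = 1%E).

Lemma md_CInt_le (f : T -> R[i]) (u : T -> R) : ibl P f -> P.-integrable setT (EFin \o u) ->
  (forall x, D x -> md (f x) <= u x) -> md (CInt P f) <= RInt P u.
Proof.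
move=> hf iu fu; set I := CInt P f.
have [->|I0] := eqVneq I 0.
  rewrite md0 -(@RInt_cst _ _ _ P 0); apply: (RInt_le mD PD) => //.
    by have [] := ibl_cst P 0.
  by move=> x Dx; apply: le_trans (fu _ Dx); exact: md_ge0.
have m0 : 0 < md I by rewrite md_gt0.
rewrite -(ler_pM2l m0) -expr2.
have -> : md I ^+ 2 = Re (CInt P (fun x => (conjc I) * f x)).
  by rewrite CIntZ// -/I mulrC mulc_conj ReC.
rewrite Re_CInt -RIntZ//; apply: (RInt_le mD PD).
- by have [] := iblZ ((conjc I)) hf.
- exact: integrableZ_R.
move=> x Dx; apply: le_trans (Re_le _) _.
by rewrite mdM md_conj ler_wpM2l ?fu// ltW.
Qed.
End CIntBound.

Section Riemann.
Context {R : realType}.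
Implicit Types (f g : R -> R[i]) (s t : R).
Local Notation U := (@U01 R).

(** Integrals over subintervals remain integrals against the one law [U01]; half-open intervals make
    adjacent pieces add up exactly. *)
Definition cutI f s t x : R[i] := (\1_(`]s, t]%classic) x)%:C * f x.

Lemma measurable_unit : measurable (`]0, 1]%classic : set R).
Proof. exact: measurable_itv. Qed.
Local Notation mU := measurable_unit.

Lemma mfC_cutI f s t : mfC f -> mfC (cutI f s t).
Proof.
move=> mf; apply: mfCM => //; apply: mfC_real.
by apply: measurable_indic; exact: measurable_itv.
Qed.

Lemma md_cutI f s t x : md (cutI f s t x) <= md (f x).
Proof.
rewrite /cutI mdM mdC indicE; case: (_ \in _) => /=.
  by rewrite normr1 mul1r.
by rewrite normr0 mul0r md_ge0.
Qed.

(** The local Riemann estimate. For Lipschitz [f] one can take [dl] proportional to [t - s], and the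
    error is then the quadratic term that [quad_telescope] allows. *)
Lemma CInt_cutI f M s t c (dl : R) : mfC f -> (forall x, 0 < x <= 1 -> md (f x) <= M) ->
  0 <= s -> s <= t -> t <= 1 -> (forall x, s < x <= t -> md (f x - c) <= dl) ->
  md (CInt U (cutI f s t) - (t - s)%:C * c) <= dl * (t - s).
Proof.
move=> mf fM s0 st t1 fc.
have i1 : U.-integrable setT (EFin \o (fun x => \1_(`]s, t]%classic) x)).
  apply: (integrable_bdd mU U01_unit (M := 1)).
    by apply: measurable_indic; exact: measurable_itv.
  by move=> x _; rewrite indicE; case: (_ \in _); rewrite ?normr1 ?normr0.
have hf : ibl U (cutI f s t).
  apply: (ibl_bdd mU U01_unit (M := M)); first exact: mfC_cutI.
  by move=> x; rewrite /= in_itv/= => /fM; apply: le_trans; exact: md_cutI.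
have hc : ibl U (cutI (fun=> c) s t).
  apply: (ibl_bdd mU U01_unit (M := md c)); first by apply: mfC_cutI; exact: mfC_cst.
  by move=> x _; exact: md_cutI.
have -> : (t - s)%:C * c = CInt U (cutI (fun=> c) s t).
  rewrite /cutI; under eq_fun do rewrite mulrC; rewrite CIntZ; last first.
    by split => //=; have [] := ibl_cst U 0.
  rewrite mulrC; congr (_ * _); apply: complex_eq => /=.
    by rewrite RInt_indic.
  by rewrite RInt_cst.
rewrite -CIntB// -(RInt_indic s0 st t1) -RIntZ//.
apply: (md_CInt_le mU U01_unit); [exact: iblB|exact: integrableZ_R|].
move=> x _; rewrite /cutI -mulrBr mdM mdC indicE mulrC.
have [xst|xst] := boolP (x \in `]s, t]%classic); last by rewrite normr0 !mulr0.
by rewrite normr1 !mulr1; apply: fc; move: xst; rewrite inE /= in_itv.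
Qed.

Lemma CInt_cutD f M s t : mfC f -> (forall x, 0 < x <= 1 -> md (f x) <= M) ->
  0 <= s -> s <= t -> 
  CInt U (cutI f 0 t) = CInt U (cutI f 0 s) + CInt U (cutI f s t).
Proof.
move=> mf fM s0 st.
have hf a b : ibl U (cutI f a b).
  apply: (ibl_bdd mU U01_unit (M := M)); first exact: mfC_cutI.
  by move=> x; rewrite /= in_itv/= => /fM; apply: le_trans; exact: md_cutI.
rewrite -CIntD//; congr CInt; apply/funext => x; rewrite /cutI -mulrDl -rmorphD/=.
congr (_%:C * _); rewrite !indicE !mem_setE !in_itv/=.
have [x0|x0] := ltP 0 x; have [xs|xs] := leP x s; rewrite /= ?add0r ?addr0//.
- by rewrite (le_trans xs st).
- by rewrite (lt_geF (le_lt_trans s0 xs)) in x0 *.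
Qed.

Lemma cutI_unit (f : R -> R[i]) K : mfC f -> (forall x, 0 < x <= 1 -> md (f x) <= K) ->
  CInt U (cutI f 0 1) = CInt U f.
Proof.
move=> mf fK.
have hf : ibl U f.
  by apply: (ibl_bdd mU U01_unit (M := K)) => // x /=; rewrite in_itv.
have hc : ibl U (cutI f 0 1).
  apply: (ibl_bdd mU U01_unit (M := K)); first exact: mfC_cutI.
  by move=> x; rewrite /= in_itv/= => /fK; apply: le_trans; exact: md_cutI.
apply: (CInt_eq mU U01_unit) => // x; rewrite /cutI indicE => Dx.
by rewrite mem_set// mul1r.
Qed.
Lemma CInt_cut0 f s : CInt U (cutI f s s) = 0.
Proof.
rewrite (_ : cutI f s s = fun=> 0) ?CInt_cst//; apply/funext => x.
rewrite /cutI indicE memNset ?mul0r//= in_itv/= => /andP[sx xs].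
by have := lt_le_trans sx xs; rewrite ltxx.
Qed.
End Riemann.

(** * Integrals of exponentials over the unit interval *)

Section ExpIntegrals.
Context {R : realType}.
Implicit Types (c w z : R[i]) (t s : R).
Local Notation U := (@U01 R).
Local Notation mU := (@measurable_unit R).

Lemma mfC_cexp d (T : measurableType d) (f : T -> R[i]) : mfC f -> mfC (fun x => cexp (f x)).
Proof.
move=> [m1 m2].
have mc : measurable_fun setT (fun x => cos (Im (f x))).
  apply: (measurableT_comp _ m2); apply: continuous_measurable_fun; exact: continuous_cos.
have ms : measurable_fun setT (fun x => sin (Im (f x))).
  apply: (measurableT_comp _ m2); apply: continuous_measurable_fun; exact: continuous_sin.
have me : measurable_fun setT (fun x => expR (Re (f x))).
  by apply: (measurableT_comp _ m1); exact: measurable_expR.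
by split; rewrite /cexp; under eq_fun do rewrite ?ReZ ?ImZ /=; exact: measurable_funM.
Qed.

Lemma cexp_lip (d : R[i]) (B : R) : md d <= B ->
  md (cexp d - 1) <= (1 + 8 * expR B * (1 + B) * B) * md d.
Proof.
move=> dB; have h := cexp_quad dB; have d0 := md_ge0 d.
have B0 := le_trans d0 dB.
have := mdD (cexp d - 1 - d) d; rewrite subrK => /le_trans; apply.
rewrite mulrDl mul1r addrC lerD2l; apply: le_trans h _.
rewrite expr2 mulrA ler_wpM2r// ler_wpM2l// !mulr_ge0// ?expR_ge0// addr_ge0//.
Qed.

Lemma Re_iM z : Re ('i * z) = - Im z.
Proof. by case: z => a b /=; rewrite mul0r mul1r sub0r. Qed.
Lemma Im_iM z : Im ('i * z) = Re z.
Proof. by case: z => a b /=; rewrite mul0r mul1r add0r. Qed.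

Definition ex c t : R[i] := cexp ('i * (c * t%:C)).

Lemma exD c c' t : ex (c + c') t = ex c t * ex c' t.
Proof. by rewrite /ex -cexpD -mulrDr -mulrDl. Qed.
Lemma ex_add c t s : ex c (t + s) = ex c t * ex c s.
Proof. by rewrite /ex -cexpD -mulrDr rmorphD/= mulrDr. Qed.
Lemma ex1 c : ex c 1 = cexp ('i * c). Proof. by rewrite /ex mulr1. Qed.
Lemma ex0 c : ex c 0 = 1. Proof. by rewrite /ex !mulr0 cexp0. Qed.
Lemma ex0t t : ex 0 t = 1. Proof. by rewrite /ex mul0r mulr0 cexp0. Qed.
Lemma md_ex c t : md (ex c t) = expR (- (Im c * t)).
Proof. by rewrite /ex md_cexp Re_iM mulrC ImZ mulrC. Qed.
Lemma mfC_ex c : mfC (ex c).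
Proof.
apply: mfC_cexp; apply: mfCM; first exact: mfC_cst.
by apply: mfCM; [exact: mfC_cst|exact: mfC_real].
Qed.
Lemma md_ex_le c t : 0 <= t <= 1 -> md (ex c t) <= expR (md c).
Proof.
move=> /andP[t0 t1]; rewrite md_ex ler_expR.
apply: le_trans (ler_norm _) _; rewrite normrN normrM (ger0_norm t0).
by apply: le_trans (ler_piMr _ t1) (Im_le_md c).
Qed.
Lemma ibl_ex c : ibl U (ex c).
Proof.
apply: (ibl_bdd mU U01_unit (mfC_ex c) (M := expR (md c))) => t /=.
by rewrite in_itv/= => /andP[t0 t1]; apply: md_ex_le; rewrite (ltW t0).
Qed.
Lemma mdIC c t : md ('i * (c * t%:C)) = md c * `|t|.
Proof. by rewrite !mdM md_i mul1r mdC. Qed.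
Lemma ex_lip c (x y : R) : 0 <= x -> x <= y -> y <= 1 ->
  md (ex c y - ex c x) <=
  expR (md c) * (1 + 8 * expR (md c) * (1 + md c) * md c) * md c * (y - x).
Proof.
move=> x0 xy y1.
have -> : ex c y - ex c x = ex c x * (ex c (y - x) - 1).
  by rewrite mulrBr -ex_add mulr1 [x + _]addrC subrK.
rewrite mdM.
rewrite -3!mulrA ler_pM ?md_ge0 ?md_ex_le ?x0 ?(le_trans xy)//.
have yx : `|y - x| = y - x by rewrite ger0_norm// subr_ge0.
have h : md ('i * (c * (y - x)%:C)) <= md c.
  by rewrite mdIC yx ler_piMr ?md_ge0//; lra.
by have := cexp_lip h; rewrite mdIC yx -!mulrA.
Qed.


(** The fundamental theorem of calculus by telescoping: [phi] compares ['i * c] times the integral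
    up to [t] with [ex c t], and its increments are of second order. Keeping the factor ['i * c] on
    the left includes [c = 0]. *)
Lemma CInt_ex c : 'i * c * CInt U (ex c) = cexp ('i * c) - 1.
Proof.
set E := expR (md c); set K := 8 * E * (1 + md c).
pose L := E * (1 + K * md c) * md c.
have E0 : 0 <= E := expR_ge0 _; have c0 := md_ge0 c.
have K0 : 0 <= K by rewrite !mulr_ge0// addr_ge0.
have L0 : 0 <= L by rewrite !mulr_ge0// addr_ge0// mulr_ge0.
have mE t : 0 < t <= 1 -> md (ex c t) <= E.
  by move=> /andP[t0 t1]; apply: md_ex_le; rewrite (ltW t0).
pose phi t := 'i * c * CInt U (cutI (ex c) 0 t) - ex c t.
suff : phi 1 = phi 0.
  rewrite /phi (cutI_unit (mfC_ex c) mE) CInt_cut0 mulr0 sub0r ex0 ex1.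
  by move=> /(canRL (subrK _)) ->; rewrite addrC.
apply: mdB_le0; apply: (@quad_telescope _ _ _ (md c * L + E * (K * md c ^+ 2))) => s t s0 st t1.
have d0 : 0 <= t - s by rewrite subr_ge0.
have d1 : t - s <= 1 by lra.
have hI : md (CInt U (cutI (ex c) s t) - (t - s)%:C * ex c s) <= L * (t - s) * (t - s).
  apply: (CInt_cutI (mfC_ex c) mE s0 st t1) => x /andP[sx xt].
  apply: le_trans (ex_lip c s0 (ltW sx) (le_trans xt t1)) _.
  by rewrite -/E -/K ler_wpM2l// lerD2r.
have hd : md ('i * (c * (t - s)%:C)) = md c * (t - s) by rewrite mdIC ger0_norm.
have hdc : md ('i * (c * (t - s)%:C)) <= md c by rewrite hd ler_piMr.
have := cexp_quad hdc; rewrite -/E -/K hd => hE.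
have -> : phi t - phi s = 'i * c * (CInt U (cutI (ex c) s t) - (t - s)%:C * ex c s)
    - ex c s * (ex c (t - s) - 1 - 'i * (c * (t - s)%:C)).
  rewrite /phi (CInt_cutD (mfC_ex c) mE s0 st).
  have -> : ex c t = ex c s * ex c (t - s) by rewrite -ex_add [s + _]addrC subrK.
  by ring.
rewrite mul0r add0r; apply: le_trans (mdD _ _) _; rewrite mdN.
have -> : (md c * L + E * (K * md c ^+ 2)) * (t - s) ^+ 2 =
   md c * (L * (t - s) * (t - s)) + E * (K * (md c * (t - s)) ^+ 2) by ring.
rewrite mdM (mdM (_ * c)) [md (_ * c)]mdM md_i mul1r; apply: lerD; first by rewrite ler_wpM2l.
apply: ler_pM; rewrite ?md_ge0//.
by apply: md_ex_le; rewrite s0 (le_trans st).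
Qed.

(** Invariance under the reflection of [[0, 1]] is read off the explicit integral; exponentials
    suffice, the Fejer kernel being a combination of them. *)
Lemma CInt_ex_flip c : CInt U (fun t => ex c (1 - t)) = CInt U (ex c).
Proof.
have [->|c0] := eqVneq c 0; first by congr CInt; apply/funext => t; rewrite !ex0t.
have i0 : 'i * c != 0 by rewrite mulf_neq0// -md_gt0 md_i ltr01.
have -> : CInt U (fun t => ex c (1 - t)) = cexp ('i * c) * CInt U (ex (- c)).
  rewrite -CIntZ; last exact: ibl_ex.
  congr CInt; apply/funext => t; rewrite ex_add ex1; congr (_ * _).
  by rewrite /ex rmorphN/= mulrN mulNr.
apply: (mulfI i0); rewrite CInt_ex mulrCA.
have -> : 'i * c * CInt U (ex (- c)) = - ('i * - c * CInt U (ex (- c))) by ring.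
by rewrite CInt_ex mulrN mulrN cexpN mulrBr divff ?cexp_neq0// mulr1 opprB.
Qed.
End ExpIntegrals.

(** * The Fejer kernel *)

Section Fejer.
Context {R : realType}.
Implicit Types (c w z : R[i]) (t : R).
Local Notation U := (@U01 R).
Local Notation mU := (@measurable_unit R).

Lemma conjcX z n : (conjc (z ^+ n)) = (conjc z) ^+ n.
Proof. exact: (rmorphXn (@conjc R)). Qed.
Lemma conjc_sum I (r : seq I) (P : pred I) (f : I -> R[i]) :
  (conjc (\sum_(i <- r | P i) f i)) = \sum_(i <- r | P i) (conjc (f i)).
Proof. exact: (rmorph_sum (@conjc R)). Qed.

Definition fej_sum n t : R[i] := \sum_(a < n.+1) ex (- (2 * pi)%:C) t ^+ a.
(** The Fejer kernel with period 1 as a squared geometric sum: nonnegativity is then visible, while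
    [fejE] gives its Fourier expansion. *)
Definition fej n t : R := md (fej_sum n t) ^+ 2 / n.+1%:R.

Lemma ex_realX (x t : R) (a : nat) : ex x%:C t ^+ a = ex (a%:R * x)%:C t.
Proof.
elim: a => [|a ih]; first by rewrite expr0 mul0r ex0t.
by rewrite exprSr ih -natr1 mulrDl mul1r rmorphD/= exD.
Qed.
Lemma ex_conj (x t : R) : (conjc (ex x%:C t)) = ex (- x%:C) t.
Proof.
rewrite md1_conj; last by rewrite md_ex mul0r oppr0 expR0.
by rewrite /ex -cexpN mulNr mulrN.
Qed.

Lemma fejE n t : (fej n t)%:C = n.+1%:R^-1%:C *
  \sum_(a < n.+1) \sum_(b < n.+1) ex (- ((a%:R - b%:R) * (2 * pi))%:C) t.
Proof.
rewrite /fej rmorphM/= mulrC; congr (_ * _).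
rewrite -mulc_conj /fej_sum conjc_sum mulr_suml; apply: eq_bigr => a _.
rewrite mulr_sumr; apply: eq_bigr => b _.
rewrite conjcX -rmorphN ex_conj -rmorphN opprK !ex_realX -exD -rmorphD/= -rmorphN.
by congr (ex _%:C t); ring.
Qed.

Lemma fej_ge0 n t : 0 <= fej n t.
Proof. by rewrite divr_ge0// sqr_ge0. Qed.

(** A geometric sum of ratio [q] times [q - 1] is [q ^+ n.+1 - 1], of modulus at most 2. The kernel
    is therefore small except near the two ends of the interval. *)
Lemma fej_decay n t : fej n t * md (ex (- (2 * pi)%:C) t - 1) ^+ 2 <= 4 / n.+1%:R.
Proof.
rewrite /fej mulrAC ler_pM2r ?invr_gt0// -exprMn -mdM mulrC -subrX1.
have h : md (ex (- (2 * pi)%:C) t ^+ n.+1 - 1) <= 2.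
  apply: le_trans (mdD _ _) _; rewrite mdN md1 mdX md_ex/= oppr0 mul0r oppr0 expR0.
  by rewrite expr1n -natr1.
have -> : 4 = 2 ^+ 2 :> R by rewrite -natrX.
by rewrite ler_pXn2r ?nnegrE ?md_ge0.
Qed.

(** Up to [1/2] one has [sin x >= x - x^2 >= x / 2]; beyond, [sin x >= sin (1/2) >= 1/4], and
    [x < 2]. *)
Lemma sin_lower (x : R) : 0 <= x -> x <= pi / 2 -> x / 8 <= sin x.
Proof.
move=> x0 xpi.
have pi2 : pi / 2 < 2 :> R := pihalf_lt2 R.
have pi1 : 1 <= pi / 2 :> R := pihalf_ge1 R.
have [x1|x1] := leP x (1 / 2).
  have := sin_quad x; rewrite ler_norml => /andP[h _]; nra.
have h2 : sin (1/2) <= sin x.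
  by rewrite ltW// ltr_sin// ?in_itv/=; lra.
have := sin_quad (1 / 2 : R); rewrite ler_norml => /andP[h _].
lra.
Qed.

(** The right-hand side is [2 sin (pi t)], symmetric under [t -> 1 - t], so that [sin_lower] on the
    first half is enough. *)
Lemma ex2pi_lower t : 0 <= t <= 1 -> t * (1 - t) / 4 <= md (ex (- (2 * pi)%:C) t - 1).
Proof.
move=> /andP[t0 t1].
have e : md (ex (- (2 * pi)%:C) t - 1) ^+ 2 = (2 * sin (pi * t)) ^+ 2.
  have -> : ex (- (2 * pi)%:C) t = cos ((pi * t) *+ 2) +i* (- sin ((pi * t) *+ 2)).
    rewrite /ex -rmorphN -rmorphM/= cexp_i.
    have -> : - (2 * pi) * t = - ((pi * t) *+ 2) by rewrite -mulr_natr; ring.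
    by rewrite cosN sinN.
  rewrite md_sq !CE/= cos_mulr2n sin_mulr2n.
  have := cos2Dsin2 (pi * t); set C := cos _; set S := sin _ => h.
  have -> : C ^+ 2 = 1 - S ^+ 2 by lra.
  have -> : ((1 - S ^+ 2) *+ 2 - 1 - 1) = - 2 * S ^+ 2 by rewrite -mulr_natr; ring.
  have C2 : C ^+ 2 = 1 - S ^+ 2 by lra.
  have -> : (C * S *- 2 - 0) ^+ 2 = 4 * (C ^+ 2) * S ^+ 2 by rewrite -mulr_natr; ring.
  rewrite C2; ring.
have pi2 : 1 <= pi / 2 :> R := pihalf_ge1 R.
have s : t * (1 - t) / 8 <= sin (pi * t).
  have [h|h] := leP t (1 / 2).
    apply: le_trans (sin_lower _ _); nra.
  have -> : sin (pi * t) = sin (pi * (1 - t)).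
    rewrite mulrBr mulr1 sinB sinpi cospi; ring.
  apply: le_trans (sin_lower _ _); nra.
have s0 : 0 <= t * (1 - t) by nra.
rewrite -(@ler_pXn2r _ 2)// ?nnegrE ?md_ge0//; last by lra.
by rewrite e ler_pXn2r// ?nnegrE; lra.
Qed.

(* Fejer means of the partial fraction expansion of [hcot], the cotangent
   [(i/2) cot (w/2)] written with exponentials. *)
Definition fcot n w : R[i] := n.+1%:R^-1%:C *
  \sum_(a < n.+1) \sum_(b < n.+1) 'i / (w - ((a%:R - b%:R) * (2 * pi))%:C).
Definition hcot w : R[i] := 2^-1 * (1 + cexp ('i * w)) / (1 - cexp ('i * w)).

Lemma md_exp_lt1 w : 0 < Im w -> md (cexp ('i * w)) < 1.
Proof. by move=> w0; rewrite md_cexp Re_iM -expR0 ltr_expR oppr_lt0. Qed.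
Lemma sub1_neq0 z : md z < 1 -> 1 - z != 0.
Proof. by move=> h; apply/eqP => /subr0_eq e; move: h; rewrite -e md1 ltxx. Qed.

Lemma cexp_shift w (k : int) : cexp ('i * (w - (k%:~R * (2 * pi))%:C)) = cexp ('i * w).
Proof. by rewrite mulrBr cexpB cexp_2pi_int divr1. Qed.
Lemma natB_int (a b : nat) : a%:R - b%:R = (a%:Z - b%:Z)%:~R :> R.
Proof. by rewrite intrB. Qed.

(** Shifting [w] by [2 pi k] does not change [e^{iw}], so [1 - e^{iw}] times the term
    ['i / (w - 2 pi k)] is the integral of [ex (w - 2 pi k)]. Summed with the weights, the
    exponentials in [k] form the Fejer kernel. *)
Lemma fcot_integral n w : 0 < Im w -> (1 - cexp ('i * w)) * fcot n w =
  CInt U (fun t => ex w t * (fej n t)%:C).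
Proof.
move=> w0.
under eq_fun do rewrite fejE mulrCA mulr_sumr.
rewrite CIntZ; last first.
  apply: ibl_sum => a; under eq_fun do rewrite mulr_sumr.
  by apply: ibl_sum => b; under eq_fun do rewrite -exD; exact: ibl_ex.
rewrite CInt_sum; last first.
  move=> a; under eq_fun do rewrite mulr_sumr.
  by apply: ibl_sum => b; under eq_fun do rewrite -exD; exact: ibl_ex.
rewrite /fcot mulrCA; congr (_ * _); rewrite mulr_sumr; apply: eq_bigr => a _.
rewrite [in RHS](_ : (fun t => _) = (fun t => \sum_(b < n.+1)
    ex (w - ((a%:R - b%:R) * (2 * pi))%:C) t)); last first.
  by apply/funext => t; rewrite mulr_sumr; apply: eq_bigr => b _; rewrite exD.
rewrite CInt_sum; last by move=> b; exact: ibl_ex.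
rewrite mulr_sumr; apply: eq_bigr => b _.
set c := w - _.
have c0 : c != 0.
  by apply/eqP => /(congr1 (@complex.Im R)); rewrite /c !CE/= oppr0 addr0 => h; rewrite h ltxx in w0.
have i0 : 'i != 0 :> R[i] by rewrite -md_gt0 md_i.
apply: (mulfI (mulf_neq0 i0 c0)); rewrite CInt_ex /c natB_int cexp_shift.
rewrite -natB_int -/c.
have -> : 'i * c * ((1 - cexp ('i * w)) * ('i / c)) =
   ('i * 'i) * (1 - cexp ('i * w)) * (c / c) by ring.
have ii : 'i * 'i = -1 :> R[i] by rewrite -expr2 sqr_i.
by rewrite divff// ii; ring.
Qed.

Lemma CInt_fej n : CInt U (fun t => (fej n t)%:C) = 1.
Proof.
under eq_fun do rewrite fejE.
rewrite CIntZ; last by apply: ibl_sum => a; apply: ibl_sum => b; exact: ibl_ex.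
rewrite CInt_sum; last by move=> a; apply: ibl_sum => b; exact: ibl_ex.
rewrite (eq_bigr (fun=> 1)) => [|a _].
  by rewrite sumr_const card_ord -(rmorph_nat (real_complex R)) -rmorphM/= mulVf.
rewrite CInt_sum; last by move=> b; exact: ibl_ex.
rewrite (bigD1 a)//= big1 ?addr0; last first.
  move=> b ba; set c := - _.
  have c0 : c != 0.
    rewrite oppr_eq0 -(rmorph0 (real_complex R)) (inj_eq (@complexI R)).
    rewrite mulf_neq0 ?mulf_neq0 ?(gt_eqF (pi_gt0 R))// subr_eq0 eqr_nat.
    by rewrite eq_sym; apply: contra ba => /eqP/val_inj ->.
  have i0 : 'i != 0 :> R[i] by rewrite -md_gt0 md_i.
  apply: (mulfI (mulf_neq0 i0 c0)); rewrite CInt_ex mulr0 /c natB_int -[- _]add0r cexp_shift.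
  by rewrite mulr0 cexp0 subrr.
rewrite subrr mul0r (_ : - 0%:C = 0); last by rewrite (rmorph0 (real_complex R)) oppr0.
by under eq_fun do rewrite ex0t; rewrite CInt_cst.
Qed.

Lemma ibl_fej n : ibl U (fun t => (fej n t)%:C).
Proof.
under eq_fun do rewrite fejE.
by apply: iblZ; apply: ibl_sum => a; apply: ibl_sum => b; exact: ibl_ex.
Qed.

Lemma fej_flip n t : fej n (1 - t) = fej n t.
Proof.
rewrite /fej; congr (_ ^+ 2 / _).
have -> : fej_sum n (1 - t) = (conjc (fej_sum n t)); last by rewrite md_conj.
rewrite /fej_sum conjc_sum; apply: eq_bigr => a _.
rewrite conjcX -rmorphN ex_conj; congr (_ ^+ _).
rewrite ex_add; have -> : ex (- (2 * pi : R))%:C 1 = 1.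
  by rewrite ex1 rmorphN mulrN cexpN cexp_2pi invr1.
by rewrite mul1r /ex; congr (cexp (_ * _)); rewrite -rmorphN -!rmorphM/=; congr (_%:C); ring.
Qed.

(** The kernel concentrates at both ends of the interval, where [ex w] takes the values 1 and
    [e^{iw}]; averaging with the reflected integral leads to their mean [(1 + e^{iw}) / 2], the
    numerator of [hcot]. *)
Lemma CInt_fej_flip n w :
  CInt U (fun t => ex w (1 - t) * (fej n t)%:C) = CInt U (fun t => ex w t * (fej n t)%:C).
Proof.
under eq_fun do rewrite -fej_flip.
have E s : ex w s * (fej n s)%:C = n.+1%:R^-1%:C *
  \sum_(a < n.+1) \sum_(b < n.+1) ex (w - ((a%:R - b%:R) * (2 * pi))%:C) s.
  rewrite fejE mulrCA mulr_sumr; congr (_ * _); apply: eq_bigr => a _.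
  by rewrite mulr_sumr; apply: eq_bigr => b _; rewrite exD.
have fl c : ibl U (fun t => ex c (1 - t)).
  have -> : (fun t => ex c (1 - t)) = (fun t => ex c 1 * ex (- c) t).
    by apply/funext => t; rewrite ex_add; congr (_ * _); rewrite /ex rmorphN/= mulrN mulNr.
  by apply: iblZ; exact: ibl_ex.
under eq_fun do rewrite E.
have -> : (fun t => ex w t * (fej n t)%:C) = _ := funext E.
rewrite !CIntZ; last 2 first.
  by apply: ibl_sum => a; apply: ibl_sum => b; exact: ibl_ex.
  by apply: ibl_sum => a; apply: ibl_sum => b; exact: fl.
congr (_ * _); rewrite !CInt_sum; last 2 first.
  by move=> a; apply: ibl_sum => b; exact: ibl_ex.
  by move=> a; apply: ibl_sum => b; exact: fl.
apply: eq_bigr => a _; rewrite !CInt_sum; last 2 first.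
  by move=> b; exact: ibl_ex.
  by move=> b; exact: fl.
by apply: eq_bigr => b _; rewrite CInt_ex_flip.
Qed.
End Fejer.

(** * Convergence of the Fejer means to the cotangent *)

Section CotLimit.
Context {R : realType}.
Implicit Types (c w z : R[i]) (t : R).
Local Notation U := (@U01 R).
Local Notation mU := (@measurable_unit R).

Lemma CInt_real d (T : measurableType d) (P : probability T R) (u : T -> R) :
  CInt P (fun x => (u x)%:C) = (RInt P u)%:C.
Proof. by apply: complex_eq => //=; rewrite RInt_cst. Qed.

Lemma RInt_fej n : RInt U (fej n) = 1.
Proof. by apply: complexI; rewrite -CInt_real CInt_fej. Qed.

Lemma integrable_fej n : U.-integrable setT (EFin \o (fun t => fej n t)).
Proof. by have [] := @ibl_fej R n. Qed.

Lemma ibl_ex_fej n v : ibl U (fun t => ex v t * (fej n t)%:C).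
Proof.
under eq_fun do rewrite fejE mulrCA mulr_sumr.
apply: iblZ; apply: ibl_sum => a; under eq_fun do rewrite mulr_sumr.
by apply: ibl_sum => b; under eq_fun do rewrite -exD; exact: ibl_ex.
Qed.

Lemma md_sub1_ge z : 1 - md z <= md (1 - z).
Proof. by have := md_sub 1 z; rewrite md1. Qed.

(** Since the kernel is nonnegative of mass one and [|ex w| <= 1], the bound depends neither on [n]
    nor on [Re w]: this is the dominating constant for the integral over [x] with [w = z - x]. *)
Lemma fcot_bound n w : 0 < Im w ->
  md (fcot n w) <= (1 - expR (- Im w))^-1.
Proof.
move=> w0; have h := fcot_integral n w0.
have e1 : md (cexp ('i * w)) = expR (- Im w) by rewrite md_cexp Re_iM.
have l1 := md_exp_lt1 w0; rewrite e1 in l1.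
have s0 : 0 < 1 - expR (- Im w) by rewrite subr_gt0.
have hI : md (CInt U (fun t => ex w t * (fej n t)%:C)) <= 1.
  rewrite -(RInt_fej n); apply: (md_CInt_le mU U01_unit).
  - exact: ibl_ex_fej.
  - exact: integrable_fej.
  move=> t; rewrite /= in_itv/= => /andP[t0 t1].
  rewrite mdM mdC (ger0_norm (fej_ge0 _ _)) ler_piMl ?fej_ge0// md_ex -expR0 ler_expR.
  by rewrite oppr_le0 mulr_ge0// ltW.
have s1 : 1 - expR (- Im w) <= md (1 - cexp ('i * w)).
  by rewrite -e1; exact: md_sub1_ge.
rewrite -[leRHS]mul1r ler_pdivlMr// mulrC; apply: le_trans hI.
by rewrite -h [leRHS]mdM; apply: ler_wpM2r s1; exact: md_ge0.
Qed.

Definition ex_lipc w := expR (md w) * (1 + 8 * expR (md w) * (1 + md w) * md w) * md w.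

(** Taking [M ^ 2] terms, [M = m.+1], gives an error of order [1 / M] without square roots. In
    [65 = 1 + 64] the 1 comes from the mass of the kernel and [64 = 16 * 4] from its decay. *)
Lemma fcot_dist (m : nat) w : 0 < Im w ->
  md (fcot (m.+1 ^ 2).-1 w - hcot w) <=
   (md (1 - cexp ('i * w)))^-1 * (65 * ex_lipc w ^+ 2) / m.+1%:R.
Proof.
set L := ex_lipc w; move=> w0; set n := (m.+1 ^ 2).-1.
have nE : n.+1 = (m.+1 ^ 2)%N by rewrite /n prednK// expn_gt0.
have s0 : 1 - cexp ('i * w) != 0 by apply: sub1_neq0; exact: md_exp_lt1.
have ibw c c' : ibl U (fun t => c * ex w t * (fej n t)%:C) /\ ibl U (fun t => c' * ex w (1 - t) * (fej n t)%:C).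
  have E : (fun t => ex w (1 - t)) = (fun t => ex w 1 * ex (- w) t).
    by apply/funext => t; rewrite ex_add; congr (_ * _); rewrite /ex rmorphN/= mulrN mulNr.
  split; first by under eq_fun do rewrite -mulrA; apply: iblZ; exact: ibl_ex_fej.
  have -> : (fun t => c' * ex w (1 - t) * (fej n t)%:C) = (fun t => c' * ex w 1 * (ex (- w) t * (fej n t)%:C)).
    by apply/funext => t; rewrite [ex w (1 - t)](congr1 (fun f => f t) E) !mulrA.
  by apply: iblZ; exact: ibl_ex_fej.
(* Half the sum of the integrand and its reflection, minus the limit, factors into a product
   vanishing at both ends: exactly where the kernel concentrates. *)
have split_ : (fun t => 2^-1 * ((ex w t - 1) * (1 - ex w (1 - t))) * (fej n t)%:C) =
    (fun t => (2^-1 * ex w t * (fej n t)%:C + 2^-1 * ex w (1 - t) * (fej n t)%:C) -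
              2^-1 * (1 + cexp ('i * w)) * (fej n t)%:C).
  apply/funext => t; rewrite -ex1.
  have -> : ex w 1 = ex w t * ex w (1 - t) by rewrite -ex_add addrC subrK.
  ring.
have key : (1 - cexp ('i * w)) * (fcot n w - hcot w) =
  CInt U (fun t => 2^-1 * ((ex w t - 1) * (1 - ex w (1 - t))) * (fej n t)%:C).
  rewrite mulrBr (fcot_integral n w0) /hcot mulrCA mulfV// mulr1.
  rewrite split_.
  have [i1 i2] := ibw 2^-1 2^-1.
  rewrite CIntB; [|by apply: iblD|by apply: iblZ; exact: ibl_fej].
  rewrite CIntD// CIntZ; last exact: ibl_fej.
  rewrite CInt_fej mulr1; congr (_ - _).
  have cz c f : ibl U (fun t => f t * (fej n t)%:C) ->
      CInt U (fun t => c * f t * (fej n t)%:C) = c * CInt U (fun t => f t * (fej n t)%:C).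
    by move=> hf; rewrite -CIntZ//; congr CInt; apply/funext => t; rewrite mulrA.
  have [j1 j2] := ibw 1 1.
  have {}j1 : ibl U (fun t => ex w t * (fej n t)%:C) by move: j1; under eq_fun do rewrite mul1r.
  have {}j2 : ibl U (fun t => ex w (1 - t) * (fej n t)%:C) by move: j2; under eq_fun do rewrite mul1r.
  rewrite (cz _ _ j1) (cz _ _ j2) CInt_fej_flip -mulrDl.
  have -> : 2^-1 + 2^-1 = 1 :> R[i] by field.
  by rewrite mul1r.
have L0 : 0 <= L by rewrite /L /ex_lipc !mulr_ge0 ?expR_ge0 ?md_ge0// addr_ge0// !mulr_ge0 ?expR_ge0 ?addr_ge0 ?md_ge0.
set M : R := m.+1%:R; have M0 : 0 < M by rewrite ltr0n.
have nM : n.+1%:R = M ^+ 2 :> R by rewrite nE natrX.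
have hI : md (CInt U (fun t => 2^-1 * ((ex w t - 1) * (1 - ex w (1 - t))) * (fej n t)%:C))
   <= 65 * L ^+ 2 / M.
  have [i1 i2] := ibw 2^-1 2^-1.
  apply: (@le_trans _ _ (RInt U (fun t => L ^+ 2 / M * fej n t + 64 * L ^+ 2 / M))); last first.
    rewrite RIntD; last 2 first.
      by apply: integrableZ_R; exact: integrable_fej.
      by have [] := ibl_cst U (64 * L ^+ 2 / M)%:C.
    rewrite RIntZ ?RInt_fej ?RInt_cst; last exact: integrable_fej.
    rewrite mulr1 -mulrDl -[X in (X + _) / _]mul1r -mulrDl.
    by rewrite (_ : 1 + 64 = 65 :> R)// -natr1 addrC.
  apply: (md_CInt_le mU U01_unit).
  - by rewrite split_; apply: iblB; [exact: iblD|apply: iblZ; exact: ibl_fej].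
  - apply: integrableD_R; first by apply: integrableZ_R; exact: integrable_fej.
    by have [] := ibl_cst U (64 * L ^+ 2 / M)%:C.
  move=> t; rewrite /= in_itv/= => /andP[t0 t1].
  have g0 := fej_ge0 n t.
  have gd := fej_decay n t; rewrite nM in gd.
  have lo : t * (1 - t) / 4 <= md (ex (- (2 * pi)%:C) t - 1) by apply: ex2pi_lower; rewrite (ltW t0).
  have a1 : md (ex w t - 1) <= L * t.
    by have := @ex_lip R w 0 t (lexx _) (ltW t0) t1; rewrite ex0 subr0.
  have a2 : md (1 - ex w (1 - t)) <= L * (1 - t).
    have := @ex_lip R w 0 (1 - t) (lexx _); rewrite ex0 subr0 mdB; apply; lra.
  have t10 : 0 <= 1 - t by lra.
  have b0 : 0 <= t * (1 - t) by rewrite mulr_ge0// ltW.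
  rewrite !mdM mdC (ger0_norm g0) mdV md_nat.
  have a3 : 2^-1 * (md (ex w t - 1) * md (1 - ex w (1 - t))) <= L ^+ 2 * (t * (1 - t)).
    have : md (ex w t - 1) * md (1 - ex w (1 - t)) <= L * t * (L * (1 - t)).
      by rewrite ler_pM ?md_ge0.
    have : 0 <= L * t * (L * (1 - t)) := mulr_ge0 (mulr_ge0 L0 (ltW t0)) (mulr_ge0 L0 t10).
    have -> : L * t * (L * (1 - t)) = L ^+ 2 * (t * (1 - t)) by ring.
    lra.
  apply: le_trans (ler_wpM2r g0 a3) _.
  set s := md (ex _ t - 1) in gd lo.
  set q := t * (1 - t) in b0 lo *.
  have s0' : 0 <= s by exact: md_ge0.
  clearbody q s L; move: (fej n t) g0 gd => f g0 gd.
  have c1 : f * q ^+ 2 <= 64 / M ^+ 2.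
    have : q ^+ 2 <= 16 * s ^+ 2 by nra.
    move=> /(ler_wpM2l g0) h; apply: le_trans h _.
    have -> : 64 / M ^+ 2 = 16 * (4 / M ^+ 2) by ring.
    by rewrite mulrCA ler_wpM2l.
  (* A weighted arithmetic-geometric inequality: it replaces the first-order zero [q = t (1 - t)] by
     its square, which the decay of the kernel controls, at the cost of [1 / M] times the mass. *)
  have c2 : q <= M^-1 + M * q ^+ 2.
    have : 0 <= (M * q - 1) ^+ 2 by exact: sqr_ge0.
    have : 0 <= M * q by rewrite mulr_ge0// ltW.
    move=> h1 h2; rewrite -(ler_pM2l M0) mulrDr divff ?gt_eqF//.
    nra.
  have c3 : q * f <= M^-1 * f + 64 / M.
    apply: le_trans (ler_wpM2r g0 c2) _; rewrite mulrDl lerD2l -mulrA [_ ^+ 2 * _]mulrC.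
    apply: le_trans (ler_wpM2l (ltW M0) c1) _.
    rewrite le_eqVlt; apply/orP; left; apply/eqP; field; by rewrite gt_eqF.
  have := ler_wpM2l (sqr_ge0 L) c3.
  have -> : L ^+ 2 * (q * f) = L ^+ 2 * q * f by ring.
  by have -> : L ^+ 2 * (M^-1 * f + 64 / M) = L ^+ 2 / M * f + 64 * L ^+ 2 / M by ring.
rewrite -[leRHS]mulrA ler_pdivlMl ?md_gt0//.
by rewrite -mdM key.
Qed.

Lemma fcot_cvg w : 0 < Im w -> ccvg (fun m => fcot (m.+1 ^ 2).-1 w) (hcot w).
Proof.
move=> w0; apply: (ccvg_le (fun m => fcot_dist m w0)).
rewrite -[X in _ --> X](mulr0 ((md (1 - cexp ('i * w)))^-1 *
  (65 * ex_lipc w ^+ 2))).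
apply: cvgMr; exact: cvg_harmonic.
Qed.

Lemma mfC_fcot d (T : measurableType d) (f : T -> R[i]) n : mfC f -> mfC (fun x => fcot n (f x)).
Proof.
move=> mf; apply: mfCM; first exact: mfC_cst.
apply: mfC_sum => a; apply: mfC_sum => b; apply: mfC_div; first exact: mfC_cst.
by apply: mfCB => //; exact: mfC_cst.
Qed.
Lemma mfC_hcot d (T : measurableType d) (f : T -> R[i]) : mfC f -> mfC (fun x => hcot (f x)).
Proof.
move=> mf; have me : mfC (fun x => cexp ('i * f x)).
  by apply: mfC_cexp; apply: mfCM => //; exact: mfC_cst.
apply: mfC_div; last by apply: mfCB => //; exact: mfC_cst.
by apply: mfCM; [exact: mfC_cst|apply: mfCD => //; exact: mfC_cst].
Qed.
End CotLimit.

(** * Means of the Cauchy kernel and the reciprocal Cauchy transform *)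

Section Jensen.
Context d {T : measurableType d} {R : realType} (P : probability T R).

(** Nonnegativity of the variance, the mean of [|f - I|^2]. It turns a circle containing all values
    into a disc containing their mean. *)
Lemma md_CInt_sq (f : T -> R[i]) : ibl P f ->
  P.-integrable setT (EFin \o (fun x => md (f x) ^+ 2)) ->
  md (CInt P f) ^+ 2 <= RInt P (fun x => md (f x) ^+ 2).
Proof.
move=> hf hf2; set I := CInt P f.
have e x : md (f x - I) ^+ 2 = md (f x) ^+ 2 + ((- 2) * Re (conjc I * f x) + md I ^+ 2).
  by rewrite !md_sq !CE; ring.
have h : 0 <= RInt P (fun x => md (f x - I) ^+ 2).
  by apply: Rintegral_ge0 => x _; exact: sqr_ge0.
have i1 : P.-integrable setT (EFin \o (fun x => Re (conjc I * f x))).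
  by have [] := iblZ (conjc I) hf.
have i0 : P.-integrable setT (EFin \o (fun=> md I ^+ 2)).
  by have [] := ibl_cst P (md I ^+ 2)%:C.
move: h; rewrite (funext e).
rewrite RIntD//; last by apply: integrableD_R => //; exact: integrableZ_R.
rewrite RIntD//; last exact: integrableZ_R.
rewrite RIntZ// RInt_cst -Re_CInt CIntZ// -/I [conjc I * I]mulrC mulc_conj ReC; lra.
Qed.

Lemma RInt_gt0 (u : T -> R) : P.-integrable setT (EFin \o u) ->
  (forall x, 0 < u x) -> 0 < RInt P u.
Proof.
move=> iu u0; have mu := measurable_int _ iu.
rewrite lt_neqAle Rintegral_ge0 ?andbT; last by move=> x _; exact: ltW.
apply/eqP => h.
have h0 : (\int[P]_x `|(EFin \o u) x| = 0)%E.
  rewrite (eq_integral (EFin \o u)); last by move=> x _; rewrite gee0_abs// lee_fin ltW.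
  by rewrite -(fineK (integrable_fin_num measurableT iu)); congr EFin; rewrite [RHS]h.
have /ae_eq_integral_abs : measurable_fun setT (EFin \o u) by [].
move=> /(_ P measurableT) [] /(_ h0) [N [mN N0 hN]] _.
have : P setT = 0%E.
  apply: subset_measure0 N0 => // x _; apply: hN => /= /(_ I) [] e.
  by have := u0 x; rewrite e ltxx.
by rewrite (probability_setT P) => /eqP; rewrite onee_eq0.
Qed.
End Jensen.

Section CauchyTransform.
Context {R : realType}.
Variable mu : probability R R.
Implicit Types (z : R[i]) (x : R).

Lemma cauchy_im z x : Im (z - x%:C) = Im z.
Proof. by rewrite !CE subr0. Qed.
Lemma upper_neq0 z : 0 < Im z -> z != 0.
Proof. by move=> z0; apply/eqP => e; rewrite e ltxx in z0. Qed.
Lemma cauchy_neq0 z x : 0 < Im z -> z - x%:C != 0.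
Proof. by move=> z0; apply: upper_neq0; rewrite cauchy_im. Qed.
Lemma mfC_id_real : mfC (fun x : R => x%:C).
Proof. by apply: mfC_real; exact: measurable_id. Qed.
Lemma mfC_cauchy z : mfC (fun x : R => (z - x%:C)^-1).
Proof. by apply: mfCV; apply: mfCB; [exact: mfC_cst|exact: mfC_id_real]. Qed.
Lemma md_cauchy z x : 0 < Im z -> md (z - x%:C)^-1 <= (Im z)^-1.
Proof.
move=> z0; rewrite mdV lef_pV2 ?posrE// ?md_gt0 ?cauchy_neq0//.
by rewrite -(cauchy_im z x) Im_le.
Qed.
Lemma ibl_cauchy z : 0 < Im z -> ibl mu (fun x : R => (z - x%:C)^-1).
Proof.
move=> z0; apply: (ibl_bdd measurableT (probability_setT mu) (mfC_cauchy z)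
  (M := (Im z)^-1)) => x _.
exact: md_cauchy.
Qed.

Lemma G_Im_lt0 z : 0 < Im z -> Im (G_mu mu z) < 0.
Proof.
move=> z0; rewrite -oppr_gt0 /G_mu Im_CInt -mulN1r -RIntZ; last by have [] := ibl_cauchy z0.
apply: RInt_gt0; first by apply: integrableZ_R; have [] := ibl_cauchy z0.
move=> x; rewrite mulN1r inv_ImE mulNr opprK cauchy_im divr_gt0//.
by rewrite exprn_gt0// md_gt0 cauchy_neq0.
Qed.
Lemma G_neq0 z : 0 < Im z -> G_mu mu z != 0.
Proof. by move=> /G_Im_lt0 h; apply/eqP => e; rewrite e ltxx in h. Qed.
Lemma F_neq0 z : 0 < Im z -> F_mu mu z != 0.
Proof. by move=> z0; rewrite invr_eq0 G_neq0. Qed.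
Lemma G_invF z : G_mu mu z = (F_mu mu z)^-1.
Proof. by rewrite invrK. Qed.

(* Each [1 / (z - x)] lies on the circle [Im z |u|^2 + Im u = 0], so their mean
   lies in the disc it bounds. *)
Lemma F_Im_ge z : 0 < Im z -> Im z <= Im (F_mu mu z).
Proof.
move=> z0; have hG := G_neq0 z0; have hf := ibl_cauchy z0.
have e x : md (z - x%:C)^-1 ^+ 2 = - (Im z)^-1 * Im (z - x%:C)^-1.
  rewrite inv_ImE cauchy_im mdV; field.
  by rewrite !gt_eqF// md_gt0 cauchy_neq0.
have := md_CInt_sq hf; rewrite (funext e).
rewrite RIntZ ?Im_CInt; last by have [] := hf.
move=> /(_ (integrableZ_R _ hf.2)); rewrite -[RInt mu _]/(Im (G_mu mu z)) -/(G_mu mu z).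
have m0 : 0 < md (G_mu mu z) ^+ 2 by rewrite exprn_gt0// md_gt0.
rewrite /F_mu inv_ImE mulNr -mulrN ler_pdivlMl// => h.
by rewrite ler_pdivlMr.
Qed.
Lemma F_Im_gt0 z : 0 < Im z -> 0 < Im (F_mu mu z).
Proof. by move=> z0; apply: lt_le_trans (F_Im_ge z0). Qed.

Lemma in_L_int z (k : int) : in_L mu -> 0 < Im z ->
  F_mu mu (z + (k%:~R * (2 * pi))%:C) = F_mu mu z + (k%:~R * (2 * pi))%:C.
Proof.
move=> hL.
have h (n : nat) z' : 0 < Im z' ->
    F_mu mu (z' + (n%:R * (2 * pi))%:C) = F_mu mu z' + (n%:R * (2 * pi))%:C.
  elim: n => [|n ih] z0; first by rewrite mul0r !addr0.
  by rewrite -natr1 mulrDl mul1r rmorphD/= !addrA hL ?ih// !CE addr0.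
move=> z0; case: k => n; first exact: h.
rewrite NegzE mulrNz mulNr rmorphN/=.
have := h n.+1 (z - (n.+1%:R * (2 * pi))%:C); rewrite subrK => -> //; first by rewrite addrK.
by rewrite cauchy_im.
Qed.

Lemma fcot_F n z : in_L mu -> 0 < Im z ->
  CInt mu (fun x => fcot n (z - x%:C)) = fcot n (F_mu mu z).
Proof.
move=> hL z0; have im c : Im (z - c%:C) = Im z by rewrite !CE subr0.
have ib (a b : nat) : ibl mu (fun x : R => 'i / (z - x%:C - ((a%:R - b%:R) * (2 * pi))%:C)).
  apply: iblZ; under eq_fun do rewrite addrAC; apply: ibl_cauchy.
  by rewrite im.
rewrite /fcot CIntZ; last by apply: ibl_sum => a; apply: ibl_sum => b.
congr (_ * _); rewrite CInt_sum; last by move=> a; apply: ibl_sum => b.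
apply: eq_bigr => a _; rewrite CInt_sum//; apply: eq_bigr => b _.
under eq_fun do rewrite addrAC.
rewrite CIntZ; last by apply: ibl_cauchy; rewrite im.
congr (_ * _); rewrite -[LHS]/(G_mu mu _) G_invF; congr (_^-1).
have e : - ((a%:R - b%:R) * (2 * pi)) = (- (a%:Z - b%:Z))%:~R * (2 * pi) :> R.
  by rewrite natB_int mulrNz mulNr.
by rewrite -!rmorphN/= e in_L_int.
Qed.

(** Both sides are limits of one sequence, [fcot] at [F z]: the right-hand side directly, the
    left-hand side by dominated convergence, with a constant depending on [Im z] only. *)
Lemma hcot_F z : in_L mu -> 0 < Im z ->
  CInt mu (fun x => hcot (z - x%:C)) = hcot (F_mu mu z).
Proof.
move=> hL z0; have F0 := F_Im_gt0 z0.
apply: ccvg_unique (fcot_cvg F0).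
apply: (ccvg_eq (u := fun m => CInt mu (fun x => fcot (m.+1 ^ 2).-1 (z - x%:C)))).
  by move=> m; exact: fcot_F.
have mz : mfC (fun x : R => z - x%:C) by apply: mfCB; [exact: mfC_cst|exact: mfC_id_real].
apply: (CInt_dct measurableT (probability_setT mu) (M := (1 - expR (- Im z))^-1)).
- by move=> n; exact: mfC_fcot.
- exact: mfC_hcot.
- by move=> n x _; rewrite -(cauchy_im z x); apply: fcot_bound; rewrite cauchy_im.
- by move=> x _; apply: fcot_cvg; rewrite cauchy_im.
Qed.
End CauchyTransform.

(** * Measures on the circle and the eta-transform *)

Section Circle.
Context {R : realType}.
Implicit Types (z w u : R[i]) (p : R * R).

Lemma circleP p : @circle R p -> md (toC p) = 1.
Proof. by rewrite /circle /= /md /toC /= => ->; rewrite sqrtr1. Qed.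

Lemma measurable_circle : measurable (@circle R).
Proof.
have m : measurable_fun setT (fun p : R * R => p.1 ^+ 2 + p.2 ^+ 2).
  by apply: measurable_funD; apply: measurable_funX; [exact: measurable_fst|exact: measurable_snd].
have := m measurableT [set 1] (measurable_set1 _).
by rewrite setTI.
Qed.

Lemma mfC_toC : mfC (@toC R : R * R -> R[i]).
Proof. by split; [exact: measurable_fst|exact: measurable_snd]. Qed.

Lemma measurable_wrapT : measurable_fun setT (@wrapT R).
Proof.
apply/measurable_fun_pairP; split.
  by apply: continuous_measurable_fun; exact: continuous_cos.
apply: measurable_funN; apply: continuous_measurable_fun; exact: continuous_sin.
Qed.
Lemma wrapT_circle x : @circle R (wrapT x).
Proof. by rewrite /circle/= sqrrN cos2Dsin2. Qed.
Lemma toC_wrapT x : toC (@wrapT R x) = cexp (- ('i * x%:C)).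
Proof. by rewrite -mulrN -rmorphN cexp_i cosN sinN. Qed.

Lemma sub1M_neq0 z w : md z < 1 -> md w = 1 -> 1 - z * w != 0.
Proof. by move=> z1 w1; apply: sub1_neq0; rewrite mdM w1 mulr1. Qed.
Lemma md_inv1 z w : md z < 1 -> md w = 1 -> md (1 - z * w)^-1 <= (1 - md z)^-1.
Proof.
move=> z1 w1; rewrite mdV lef_pV2 ?posrE ?md_gt0 ?sub1M_neq0 ?subr_gt0//.
by apply: le_trans (md_sub1_ge _); rewrite mdM w1 mulr1.
Qed.

Section CircleMeasure.
Variable nu : probability (R * R)%type R.
Hypothesis nuC : nu (@circle R) = 1%E.

(* [eta_nu z = z * (Vc z / Uc z)]; the quotient is bounded by 1. *)
Definition Uc z := CInt nu (fun p => (1 - z * toC p)^-1).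
Definition Vc z := CInt nu (fun p => toC p / (1 - z * toC p)).

Lemma mfC_Uc z : mfC (fun p : R * R => (1 - z * toC p)^-1).
Proof.
apply: mfCV; apply: mfCB; first exact: mfC_cst.
by apply: mfCM; [exact: mfC_cst|exact: mfC_toC].
Qed.
Lemma mfC_Vc z : mfC (fun p : R * R => toC p / (1 - z * toC p)).
Proof. by apply: mfCM; [exact: mfC_toC|exact: mfC_Uc]. Qed.
Lemma ibl_Uc z : md z < 1 -> ibl nu (fun p => (1 - z * toC p)^-1).
Proof.
move=> z1; apply: (ibl_bdd measurable_circle nuC (mfC_Uc z) (M := (1 - md z)^-1)).
by move=> p /circleP p1; exact: md_inv1.
Qed.
Lemma ibl_Vc z : md z < 1 -> ibl nu (fun p => toC p / (1 - z * toC p)).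
Proof.
move=> z1; apply: (ibl_bdd measurable_circle nuC (mfC_Vc z) (M := (1 - md z)^-1)).
by move=> p /circleP p1; rewrite mdM p1 mul1r; exact: md_inv1.
Qed.

Lemma psiE z : md z < 1 -> psi_nu nu z = z * Vc z.
Proof.
move=> z1; rewrite -CIntZ; last exact: ibl_Vc.
by congr CInt; apply/funext => p; rewrite mulrA.
Qed.
Lemma psi1E z : md z < 1 -> 1 + psi_nu nu z = Uc z.
Proof.
move=> z1; rewrite psiE// -CIntZ; last exact: ibl_Vc.
rewrite -[X in X + _](CInt_cst nu 1) -CIntD; last 2 first.
  exact: ibl_cst.
  by apply: iblZ; exact: ibl_Vc.
apply: (CInt_eq measurable_circle nuC).
- apply: iblD; first exact: ibl_cst.
  by apply: iblZ; exact: ibl_Vc.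
- exact: ibl_Uc.
move=> p /circleP p1; have h := sub1M_neq0 z1 p1.
by field.
Qed.
Lemma UcE z : md z < 1 -> Uc z = 1 + z * Vc z.
Proof. by move=> z1; rewrite -psiE// psi1E. Qed.

(* [u = 1 / (1 - z zeta)] lies on the circle [|u - 1| = |z| |u|]. *)
Lemma Uc_disc z : md z < 1 -> md (Uc z - 1) <= md z * md (Uc z).
Proof.
move=> z1; have hU := ibl_Uc z1.
set r := md z in z1 *; have r0 : 0 <= r := md_ge0 z.
have e p : @circle R p -> (1 - r ^+ 2) * md (1 - z * toC p)^-1 ^+ 2 =
    2 * Re (1 - z * toC p)^-1 - 1.
  move=> /circleP p1; have h := sub1M_neq0 z1 p1; set s := 1 - z * toC p in h *.
  have m0 : md s != 0 by rewrite md_eq0.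
  rewrite inv_ReE mdV exprVn.
  have : r ^+ 2 = 1 - 2 * Re s + md s ^+ 2.
    have -> : r = md (1 - s) by rewrite /s opprB addrC subrK mdM p1 mulr1.
    by rewrite !md_sq !CE; ring.
  by move=> ->; field.
have i2 : nu.-integrable setT (EFin \o (fun p => md (1 - z * toC p)^-1 ^+ 2)).
  apply: (integrable_bdd measurable_circle nuC (M := (1 - r)^-1 ^+ 2)).
    under eq_fun do rewrite md_sq.
    by have [h1 h2] := mfC_Uc z; apply: measurable_funD; exact: measurable_funX.
  move=> p /circleP p1; rewrite ger0_norm ?sqr_ge0// ler_pXn2r ?nnegrE ?md_ge0//.
    exact: md_inv1.
  by rewrite invr_ge0 subr_ge0 ltW.
have J := md_CInt_sq hU i2.
have e2 : (1 - r ^+ 2) * RInt nu (fun p => md (1 - z * toC p)^-1 ^+ 2) =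
    2 * Re (Uc z) - 1.
  have i0 : nu.-integrable setT (EFin \o (fun=> -1)) by have [] := ibl_cst nu (-1)%:C.
  have iR := hU.1.
  have i1 : nu.-integrable setT (EFin \o (fun p => 2 * Re (1 - z * toC p)^-1)).
    exact: integrableZ_R.
  have -> : 2 * Re (Uc z) - 1 =
      RInt nu (fun p => 2 * Re (1 - z * toC p)^-1 + -1).
    by rewrite RIntD// RInt_cst RIntZ.
  rewrite -RIntZ//; apply: (RInt_eq measurable_circle nuC).
  - exact: integrableZ_R.
  - exact: integrableD_R.
  by move=> p pC; rewrite e.
rewrite -(@ler_pXn2r _ 2)// ?nnegrE ?md_ge0 ?mulr_ge0 ?md_ge0// exprMn.
have -> : md (Uc z - 1) ^+ 2 = md (Uc z) ^+ 2 - (2 * Re (Uc z) - 1).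
  by rewrite !md_sq !CE; ring.
have r1 : r ^+ 2 < 1 by rewrite expr_lt1.
rewrite -e2; have := ler_wpM2l (ltW (_ : 0 < 1 - r ^+ 2)) J; rewrite subr_gt0 => /(_ r1).
rewrite -/(Uc z); lra.
Qed.

Lemma Uc_neq0 z : md z < 1 -> Uc z != 0.
Proof.
move=> z1; apply/eqP => h; have := Uc_disc z1.
by rewrite h md0 mulr0 sub0r mdN md1 ler10.
Qed.
Lemma Uc_lower z : md z < 1 -> 1 / 2 <= md (Uc z).
Proof.
move=> z1; have := Uc_disc z1; have := md_sub 1 (Uc z); rewrite md1 mdB => h1 h2.
have : md z * md (Uc z) <= md (Uc z) by rewrite ler_piMl ?md_ge0// ltW.
lra.
Qed.
Lemma etaE z : md z < 1 -> eta_nu nu z = z * (Vc z / Uc z).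
Proof. by move=> z1; rewrite /eta_nu psi1E// psiE// mulrA. Qed.
Lemma md_eta z : md z < 1 -> md (eta_nu nu z) <= md z.
Proof.
move=> z1; rewrite etaE// mulrA mdM mdV ler_pdivrMr ?md_gt0 ?Uc_neq0//.
by have := Uc_disc z1; rewrite UcE// [1 + _]addrC addrK.
Qed.
Lemma eta0 : eta_nu nu 0 = 0.
Proof. by rewrite etaE ?md0 ?ltr01// mul0r. Qed.
End CircleMeasure.

(** As [1 + psi] is [Uc], eta equals [1 - 1 / Uc], which is injective in [Uc]. *)
Lemma eta_psi (nu nu' : probability (R * R)%type R) z :
  nu (@circle R) = 1%E -> nu' (@circle R) = 1%E -> md z < 1 ->
  eta_nu nu z = eta_nu nu' z -> Uc nu z = Uc nu' z.
Proof.
move=> h h' z1; rewrite !etaE// => e.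
have U0 := Uc_neq0 h z1; have U0' := Uc_neq0 h' z1.
have e1 : z * (Vc nu z / Uc nu z) = 1 - (Uc nu z)^-1.
  by rewrite {2}UcE//; rewrite UcE// in U0 *; field.
have e2 : z * (Vc nu' z / Uc nu' z) = 1 - (Uc nu' z)^-1.
  by rewrite {2}UcE//; rewrite UcE// in U0' *; field.
move: e; rewrite e1 e2 => /addrI /oppr_inj /invr_inj //.
Qed.

Section Wrap.
Variables (mu : probability R R) (nu : probability (R * R)%type R).
Hypothesis hw : is_wrap mu nu.

Lemma wrap_circle : nu (@circle R) = 1%E.
Proof.
rewrite hw; last exact: measurable_circle.
have -> : wrapT @^-1` (@circle R) = setT.
  by apply/seteqP; split => // x _; exact: wrapT_circle.
exact: probability_setT.
Qed.

Lemma hcot_eta (w : R[i]) : 0 < Im w ->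
  let e := cexp ('i * w) in hcot w = e / (1 - e) + 2^-1 /\ 1 - e != 0.
Proof.
move=> w0 e; have e0 : 1 - e != 0 by apply: sub1_neq0; exact: md_exp_lt1.
by split=> //; rewrite /hcot -/e; field.
Qed.

(** At [zeta = e^{-ix}] the integrand of psi is [hcot (z - x) - 1/2]. By [hcot_F], psi is then
    [v / (1 - v)] with [v = e^{i F z}], and eta undoes the map [v -> v / (1 - v)]. *)
Lemma eta_wrap z : in_L mu -> 0 < Im z ->
  cexp ('i * F_mu mu z) = eta_nu nu (cexp ('i * z)).
Proof.
move=> hL z0; have hC := wrap_circle.
have u1 := md_exp_lt1 z0; set u := cexp ('i * z) in u1 *.
have m0 : mfC (fun p : R * R => u * toC p / (1 - u * toC p)).
  by under eq_fun do rewrite -mulrA; apply: mfCM; [exact: mfC_cst|exact: mfC_Vc].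
have key x : u * toC (wrapT x) / (1 - u * toC (wrapT x)) = hcot (z - x%:C) - 2^-1.
  have [-> _] := @hcot_eta (z - x%:C) ltac:(by rewrite cauchy_im).
  by rewrite addrK toC_wrapT /u -cexpD mulrBr.
have ih : ibl mu (fun x : R => hcot (z - x%:C)).
  have -> : (fun x : R => hcot (z - x%:C)) = (fun x => u * (toC (wrapT x) / (1 - u * toC (wrapT x))) + 2^-1).
    by apply/funext => x; rewrite mulrA key subrK.
  apply: iblD; last exact: ibl_cst.
  apply: iblZ; apply: (ibl_bdd measurableT (probability_setT mu) (M := (1 - md u)^-1)).
    exact: (mfC_comp (mfC_Vc u) measurable_wrapT).
  by move=> x _; have /circleP p1 := wrapT_circle x; rewrite mdM p1 mul1r; exact: md_inv1.
have ps : psi_nu nu u = hcot (F_mu mu z) - 2^-1.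
  rewrite -(hcot_F hL z0) -(CInt_cst mu 2^-1) -CIntB//; last exact: ibl_cst.
  rewrite /psi_nu (CInt_push measurable_wrapT hw m0).
    by congr CInt; apply/funext => x; rewrite /= key.
  rewrite (_ : _ \o _ = (fun x : R => hcot (z - x%:C) - 2^-1)); last by apply/funext => x; rewrite /= key.
  by apply: iblB => //; exact: ibl_cst.
have [e e0] := hcot_eta (F_Im_gt0 mu z0); set v := cexp _ in e e0 *.
rewrite /eta_nu ps e addrK.
have -> : 1 + v / (1 - v) = (1 - v)^-1 by field.
by rewrite invrK divfK.
Qed.
End Wrap.
End Circle.
Arguments conjc : simpl never.

(** * Averages over roots of unity *)

Section RootsOfUnity.
Context {R : realType}.
Implicit Types (z w u : R[i]).

Definition ruN (M : nat) (j : nat) : R[i] := cexp ('i * (j%:R * (2 * pi / M%:R))%:C).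

Lemma ru_md M j : md (ruN M j) = 1.
Proof. by rewrite md_cexp Re_iM/= oppr0 expR0. Qed.
Lemma ru_neq0 M j : ruN M j != 0.
Proof. by rewrite -md_gt0 ru_md. Qed.
Lemma ruD M j k : ruN M (j + k) = ruN M j * ruN M k.
Proof. by rewrite /ruN -cexpD -mulrDr -rmorphD/= natrD mulrDl. Qed.
Lemma ru0 M : ruN M 0 = 1.
Proof. by rewrite /ruN mul0r mulr0 cexp0. Qed.
Lemma ruX M j k : ruN M j ^+ k = ruN M (j * k).
Proof. by elim: k => [|k ih]; rewrite ?muln0 ?ru0// exprS ih mulnS ruD. Qed.
Lemma ruM M : (0 < M)%N -> ruN M M = 1.
Proof.
move=> M0; rewrite /ruN mulrCA divff ?mulr1 ?cexp_2pi//.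
by rewrite pnatr_eq0 -lt0n.
Qed.

Lemma cos_lt1 (x : R) : 0 < x -> x < 2 * pi -> cos x < 1.
Proof.
move=> x0 x2.
have -> : x = (x / 2) *+ 2 by rewrite -mulr_natr divfK.
have s0 : 0 < sin (x / 2) by apply: sin_gt0_pi; apply/andP; split; lra.
have : 0 < sin (x / 2) ^+ 2 by rewrite exprn_gt0.
rewrite cos_mulr2n cos2sin2 -mulr_natr; lra.
Qed.

Lemma ru_neq1 M j : (0 < j)%N -> (j < M)%N -> ruN M j != 1.
Proof.
move=> j0 jM; apply/eqP => /(congr1 (@complex.Re R)).
rewrite /ruN cexp_i/= => h.
have M0 : 0 < M%:R :> R by rewrite ltr0n (leq_ltn_trans _ jM).
have p0 := pi_gt0 R.
have := @cos_lt1 (j%:R * (2 * pi / M%:R)); rewrite h ltxx => H; apply/notF/H.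
  by apply: mulr_gt0; rewrite ?ltr0n//; apply: divr_gt0 => //; rewrite mulr_gt0.
by rewrite mulrA ltr_pdivrMr// [j%:R * _]mulrC ltr_pM2l ?mulr_gt0// ltr_nat.
Qed.

Lemma ru_sum M k : (0 < M)%N -> (0 < k)%N -> (k < M)%N -> \sum_(j < M) ruN M (j * k) = 0.
Proof.
move=> M0 k0 kM; have h := ru_neq1 k0 kM.
apply: (mulfI (_ : ruN M k - 1 != 0)); first by rewrite subr_eq0.
rewrite mulr0; have -> : \sum_(j < M) ruN M (j * k) = \sum_(j < M) ruN M k ^+ j.
  by apply: eq_bigr => j _; rewrite ruX mulnC.
by rewrite -subrX1 ruX mulnC -ruX ruM// expr1n subrr.
Qed.

(* Finite geometric series together with orthogonality of the characters. *)
Lemma ru_poisson M u : (0 < M)%N -> md u < 1 ->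
  \sum_(j < M) (1 - u * ruN M j)^-1 = M%:R / (1 - u ^+ M).
Proof.
move=> M0 u1.
have uM : md (u ^+ M) < 1 by rewrite mdX exprn_ilt1 ?md_ge0// -lt0n.
have u0 := sub1_neq0 uM.
have e j : (1 - u * ruN M j)^-1 = (1 - u ^+ M)^-1 * \sum_(k < M) u ^+ k * ruN M (j * k).
  have h := sub1M_neq0 u1 (ru_md M j).
  apply: (mulfI h); rewrite mulfV// mulrCA.
  have -> : \sum_(k < M) u ^+ k * ruN M (j * k) = \sum_(k < M) (u * ruN M j) ^+ k.
    by apply: eq_bigr => k _; rewrite exprMn ruX.
  set S := \sum_(k < M) _; set v := u * ruN M j in S *.
  have -> : (1 - v) * S = - ((v - 1) * S) by ring.
  rewrite -subrX1 opprB exprMn ruX mulnC -ruX ruM// expr1n mulr1.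
  by rewrite mulVf.
under eq_bigr do rewrite e.
rewrite -mulr_sumr mulrC; congr (_ * _).
rewrite exchange_big/=; case: M M0 {uM u0 e} => // M _.
rewrite big_ord_recl/= [X in _ + X]big1 ?addr0.
  under eq_bigr do rewrite expr0 mul1r muln0 ru0.
  by rewrite sumr_const card_ord.
move=> k _; rewrite -mulr_sumr ru_sum ?mulr0//.
by rewrite /bump/= add1n ltnS ltn_ord.
Qed.
End RootsOfUnity.
Arguments ruN : simpl never.

(** * Discrete Poisson integrals and uniqueness of measures on the circle *)

Section CircleUniqueness.
Context {R : realType}.
Implicit Types (z w u : R[i]) (p q : R * R).

Lemma toC_inj : injective (@toC R).
Proof. by move=> [a b] [c d] [] -> ->. Qed.

(* Poisson kernel: [(1 - |u|^2) / |1 - u|^2]. *)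
Definition poi u : R := 2 * Re (1 - u)^-1 - 1.

Lemma poiE u : md u < 1 -> poi u * md (1 - u) ^+ 2 = 1 - md u ^+ 2.
Proof.
move=> u1; have h : md (1 - u) != 0 by rewrite md_eq0 sub1_neq0.
rewrite /poi inv_ReE mulrBl mul1r -mulrA divfK ?expf_neq0//.
by rewrite !md_sq !CE; ring.
Qed.
Lemma poi_ge0 u : md u < 1 -> 0 <= poi u.
Proof.
move=> u1; have h : 0 < md (1 - u) ^+ 2 by rewrite exprn_gt0// md_gt0 sub1_neq0.
by rewrite -(pmulr_lge0 _ h) poiE// subr_ge0 expr_le1 ?md_ge0// ltW.
Qed.
(* [|1 - r t|^2 = (1 - r)^2 + r |1 - t|^2] for [|t| = 1]. *)
Lemma poi_decay (r : R) u : 0 < r < 1 -> md u = 1 ->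
  poi (r%:C * u) * md (1 - u) ^+ 2 <= (1 - r ^+ 2) / r.
Proof.
move=> /andP[r0 r1] u1.
have ur : md (r%:C * u) = r by rewrite mdM mdC u1 mulr1 gtr0_norm.
have h1 : md (r%:C * u) < 1 by rewrite ur.
have := poiE h1; have := poi_ge0 h1; rewrite ur => p0 pE.
have e : md (1 - r%:C * u) ^+ 2 = (1 - r) ^+ 2 + r * md (1 - u) ^+ 2.
  have := congr1 (fun x => x ^+ 2) u1; rewrite expr1n !md_sq !CE => h.
  have {}h : Im u ^+ 2 = 1 - Re u ^+ 2 by rewrite -h addrC addKr.
  by ring: h.
rewrite ler_pdivlMr// -pE e; have : 0 <= poi (r%:C * u) * (1 - r) ^+ 2.
  by rewrite mulr_ge0// sqr_ge0.
set P := poi _; lra.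
Qed.

Definition ruP M j : R * R := (Re (ruN M j), Im (ruN M j)) : R * R.
Lemma toC_ruP M j : toC (ruP M j) = ruN M j :> R[i].
Proof. by apply: complex_eq. Qed.

(** By [ru_poisson] the average over the roots is exactly the Poisson kernel at [(r u) ^+ M], so for
    fixed [r] the mass of the discretised kernel is off by a geometrically small amount. *)
Lemma avg_poi (M : nat) (r : R) u : (0 < M)%N -> 0 < r < 1 -> md u = 1 ->
  `|(\sum_(j < M) poi (r%:C * u * ruN M j)) / M%:R - 1| <= 2 * r ^+ M / (1 - r).
Proof.
move=> M0 /andP[r0 r1] u1.
have ur : md (r%:C * u) = r by rewrite mdM mdC u1 mulr1 gtr0_norm.
have h1 : md (r%:C * u) < 1 by rewrite ur.
have M1 : M%:R != 0 :> R by rewrite pnatr_eq0 -lt0n.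
set v := (r%:C * u) ^+ M.
have vr : md v = r ^+ M by rewrite mdX ur.
have rM : r ^+ M <= r by rewrite -[leRHS]expr1 ler_wiXn2l// ltW.
have v1 : md v < 1 by rewrite vr (le_lt_trans rM).
have -> : (\sum_(j < M) poi (r%:C * u * ruN M j)) / M%:R - 1 =
    2 * Re (v / (1 - v)).
  rewrite /poi sumrB -mulr_sumr -Re_sum ru_poisson// -/v.
  have -> : M%:R / (1 - v) = M%:R%:C * (1 - v)^-1 by rewrite (rmorph_nat (real_complex R)).
  rewrite ReZ sumr_const card_ord mulrBl -mulr_natr mul1r divff//.
  have v0 := sub1_neq0 v1.
  have -> : v / (1 - v) = (1 - v)^-1 - 1 by field.
  rewrite !CE; field.
  exact: M1.
rewrite normrM ger0_norm// -mulrA ler_wpM2l//.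
apply: le_trans (Re_le_md _) _; rewrite mdM mdV vr ler_wpM2l ?exprn_ge0 ?(ltW r0)//.
have h : 1 - r <= md (1 - v).
  by apply: le_trans (md_sub1_ge v); rewrite lerD2l lerN2 vr.
by rewrite lef_pV2 ?posrE ?subr_gt0 ?md_gt0 ?sub1_neq0.
Qed.

Lemma expn_small (r e : R) : 0 < r < 1 -> 0 < e -> exists2 M, (0 < M)%N & r ^+ M <= e.
Proof.
move=> /andP[r0 r1] e0.
have /cvgrPdist_le/(_ _ e0)[N _ hN] : (GRing.exp r : nat -> R) @ \oo --> 0.
  by apply: cvg_expr; rewrite gtr0_norm.
exists N.+1 => //; have := hN N.+1 (leqnSn _); rewrite sub0r normrN => /(le_trans _); apply.
exact: ler_norm.
Qed.

(** The Poisson integral of [f] discretised over the [M]-th roots of unity. As a function of [p] it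
    is a finite combination of Poisson kernels, so its integral against [nu] involves only finitely
    many values of [Uc nu]. *)
Definition smoothed (f : R * R -> R) M (r : R) p : R :=
  (\sum_(j < M) f (ruP M j) * poi (r%:C * toC p * conjc (ruN M j))) / M%:R.

Lemma ru_conj M j : (j <= M)%N -> (0 < M)%N -> conjc (ruN M j) = ruN M (M - j) :> R[i].
Proof.
move=> jM M0; rewrite md1_conj ?ru_md//; apply: (mulfI (ru_neq0 M j)).
by rewrite mulfV ?ru_neq0// -ruD subnKC// ruM.
Qed.

Lemma sum_conj_ru M (g : R[i] -> R) : (0 < M)%N ->
  \sum_(j < M) g (conjc (ruN M j)) = \sum_(j < M) g (ruN M j).
Proof.
case: M => // M _.
have -> : \sum_(j < M.+1) g (conjc (ruN M.+1 j)) = \sum_(j < M.+1) g (ruN M.+1 j.+1).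
  rewrite [RHS](reindex_inj rev_ord_inj)/=; apply: eq_bigr => j _.
  by rewrite ru_conj ?(ltnW (ltn_ord j))// subSS subSn// leq_ord.
by rewrite big_ord_recr/= ruM// -(ru0 M.+1) big_ord_recl addrC.
Qed.

(** Two errors: [B a] from the mass of the kernel, and the Lipschitz error, where the distance [m]
    to a root is bounded by [(dl + m^2 / dl) / 2] because [poi_decay] controls second moments. *)
Lemma smoothed_close (f : R * R -> R) (B L : R) M (r dl a : R) p :
  (forall q, @circle R q -> `|f q| <= B) ->
  (forall q q', @circle R q -> @circle R q' -> `|f q - f q'| <= L * md (toC q - toC q')) ->
  0 <= L -> (0 < M)%N -> 0 < r < 1 -> 0 < dl -> @circle R p ->
  a = 2 * r ^+ M / (1 - r) ->
  `|f p - smoothed f M r p| <= B * a + L / 2 * (dl * (1 + a) + (1 - r ^+ 2) / r / dl).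
Proof.
move=> fB fL L0 M0 r01 dl0 pC aE; have p1 := circleP pC.
have /andP[r0 r1] := r01.
have MR : 0 < M%:R :> R by rewrite ltr0n.
pose u j := toC p * conjc (ruN M j).
have u1 j : md (u j) = 1 by rewrite mdM p1 md_conj ru_md mulr1.
pose P j := poi (r%:C * u j).
have Pm j : md (r%:C * u j) < 1 by rewrite mdM mdC u1 mulr1 gtr0_norm.
have P0 j : 0 <= P j by apply: poi_ge0.
have qC j : @circle R (ruP M j).
  rewrite /circle/=; have := congr1 (fun x => x ^+ 2) (@ru_md R M j).
  by rewrite expr1n md_sq.
have av : `|(\sum_(j < M) P j) / M%:R - 1| <= a.
  rewrite aE; have := avg_poi M0 r01 p1.
  rewrite -(sum_conj_ru (fun x => poi (r%:C * toC p * x)))//.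
  by under eq_bigr do rewrite -mulrA.
have sE : smoothed f M r p = (\sum_(j < M) f (ruP M j) * P j) / M%:R.
  by congr (_ / _); apply: eq_bigr => j _; rewrite -mulrA.
have -> : f p - smoothed f M r p = - (f p * ((\sum_(j < M) P j) / M%:R - 1)) +
    (\sum_(j < M) (f p - f (ruP M j)) * P j) / M%:R.
  have -> : \sum_(j < M) (f p - f (ruP M j)) * P j =
      f p * \sum_(j < M) P j - \sum_(j < M) f (ruP M j) * P j.
    by rewrite mulr_sumr -sumrB; apply: eq_bigr => j _; rewrite mulrBl.
  by rewrite sE; ring.
apply: le_trans (ler_normD _ _) _; apply: lerD.
  by rewrite normrN normrM ler_pM ?normr_ge0// fB.
have dist j : md (toC p - ruN M j) = md (1 - u j).
  have -> : toC p - ruN M j = - (ruN M j * (1 - u j)).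
    have h : ruN M j * (ruN M j)^-1 = 1 :> R[i] by rewrite mulfV ?ru_neq0.
    rewrite /u md1_conj; last exact: ru_md.
    have -> : ruN M j * (1 - toC p / ruN M j) = ruN M j - toC p * (ruN M j * (ruN M j)^-1) by ring.
    by rewrite h mulr1 opprB.
  by rewrite mdN mdM ru_md mul1r.
rewrite normrM normfV (gtr0_norm MR) ler_pdivrMr//.
apply: le_trans (ler_norm_sum _ _ _) _.
apply: (@le_trans _ _ (\sum_(j < M) (L / 2 * dl * P j + L / 2 * ((1 - r ^+ 2) / r / dl)))).
  apply: ler_sum => j _; rewrite normrM (ger0_norm (P0 j)).
  have h1 := fL _ _ pC (qC j); rewrite toC_ruP dist in h1.
  have h2 := poi_decay r01 (u1 j); rewrite -/(P j) in h2.
  set m := md (1 - u j) in h1 h2; have m0 : 0 <= m := md_ge0 _.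
  apply: (@le_trans _ _ (L * (m * P j))); first by rewrite mulrA ler_wpM2r.
  have -> : L / 2 * dl * P j + L / 2 * ((1 - r ^+ 2) / r / dl) =
     L * (2^-1 * (dl * P j + (1 - r ^+ 2) / r / dl)) by field; rewrite !gt_eqF.
  rewrite ler_wpM2l//.
  have h3 : P j * m ^+ 2 / dl <= (1 - r ^+ 2) / r / dl by rewrite ler_pM2r// invr_gt0.
  have h4 : 2 * (m * P j) <= dl * P j + P j * m ^+ 2 / dl.
    rewrite -subr_ge0.
    have -> : dl * P j + P j * m ^+ 2 / dl - 2 * (m * P j) = P j * (dl - m) ^+ 2 / dl.
      by field; rewrite gt_eqF.
    exact: divr_ge0 (mulr_ge0 (P0 j) (sqr_ge0 _)) (ltW dl0).
  lra.
rewrite big_split/= -mulr_sumr sumr_const card_ord -[_ *+ M]mulr_natr.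
have h : (\sum_(j < M) P j) <= (1 + a) * M%:R.
  move: av; rewrite ler_norml => /andP[_]; rewrite lerBlDl ler_pdivrMr//.
have : L / 2 * dl * (\sum_(j < M) P j) <= L / 2 * dl * ((1 + a) * M%:R).
  by rewrite ler_wpM2l// !mulr_ge0// ltW.
move: (\sum_(j < M) P j) => S; lra.
Qed.
End CircleUniqueness.
Section MeasureUniqueness.
Context {R : realType}.
Implicit Types (z w u : R[i]) (p q : R * R).
Local Notation mC := (@measurable_circle R).

Lemma RInt_abs_le d (T : measurableType d) (P : probability T R) (D : set T) (u : T -> R) (c : R) :
  measurable D -> P D = 1%E -> P.-integrable setT (EFin \o u) ->
  (forall x, D x -> `|u x| <= c) -> `|RInt P u| <= c.
Proof.
move=> mD PD iu uc; rewrite -mdC -CInt_real; apply: (md_CInt mD PD).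
  by split => //=; have [] := ibl_cst P 0.
by move=> x Dx; rewrite mdC uc.
Qed.

Lemma integrable_poi (nu : probability (R * R)%type R) z : nu (@circle R) = 1%E -> md z < 1 ->
  nu.-integrable setT (EFin \o (fun p => poi (z * toC p))) /\
  RInt nu (fun p => poi (z * toC p)) = 2 * Re (Uc nu z) - 1.
Proof.
move=> nuC z1; have [iR _] := ibl_Uc nuC z1.
have i0 : nu.-integrable setT (EFin \o (fun=> -1)) by have [] := ibl_cst nu (-1)%:C.
have i1 : nu.-integrable setT (EFin \o (fun p => 2 * Re (1 - z * toC p)^-1)).
  exact: integrableZ_R.
split; first by apply: integrableD_R.
by rewrite /poi RIntD// RInt_cst RIntZ.
Qed.

Lemma RInt_sum d (T : measurableType d) (P : probability T R) I (s : seq I) (h : I -> T -> R) :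
  (forall i, P.-integrable setT (EFin \o h i)) ->
  P.-integrable setT (EFin \o (fun x => \sum_(i <- s) h i x)) /\
  RInt P (fun x => \sum_(i <- s) h i x) = \sum_(i <- s) RInt P (h i).
Proof.
move=> hh; elim: s => [|i s [ih1 ih2]].
  by under eq_fun do rewrite big_nil; rewrite RInt_cst big_nil; split => //; have [] := ibl_cst P 0.
under eq_fun do rewrite big_cons; split; first exact: integrableD_R.
by rewrite RIntD// ih2 big_cons.
Qed.

Lemma smoothed_int (nu : probability (R * R)%type R) f M (r : R) :
  nu (@circle R) = 1%E -> 0 < r < 1 ->
  nu.-integrable setT (EFin \o (smoothed f M r)) /\
  RInt nu (smoothed f M r) = M%:R^-1 *
    \sum_(j < M) f (ruP M j) * (2 * Re (Uc nu (r%:C * conjc (ruN M j))) - 1).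
Proof.
move=> nuC /andP[r0 r1].
have z1 j : md (r%:C * conjc (ruN M j)) < 1 by rewrite mdM mdC md_conj ru_md mulr1 gtr0_norm.
have E : smoothed f M r = (fun p => M%:R^-1 *
    \sum_(j < M) f (ruP M j) * poi (r%:C * conjc (ruN M j) * toC p)).
  apply/funext => p; rewrite /smoothed mulrC; congr (_ * _); apply: eq_bigr => j _.
  by rewrite mulrAC.
have i1 j : nu.-integrable setT (EFin \o (fun p => f (ruP M j) * poi (r%:C * conjc (ruN M j) * toC p))).
  by apply: integrableZ_R; have [] := integrable_poi nuC (z1 j).
have [i2 e2] := RInt_sum (index_enum _) (fun j : 'I_M => i1 j).
rewrite E; split; first exact: integrableZ_R.
rewrite RIntZ// e2; congr (_ * _); apply: eq_bigr => j _.
by have [i3 e3] := integrable_poi nuC (z1 j); rewrite RIntZ// e3.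
Qed.

Variables nu nu' : probability (R * R)%type R.
Hypotheses (nuC : nu (@circle R) = 1%E) (nuC' : nu' (@circle R) = 1%E).
Hypothesis nuU : forall z, md z < 1 -> Uc nu z = Uc nu' z.

(** The two integrals of [smoothed f] agree, since they see only [Uc] on the circle of radius [r];
    each is close to the integral of [f]. *)
Lemma eq_RInt_lip (f : R * R -> R) (B L : R) : measurable_fun setT f ->
  (forall q, @circle R q -> `|f q| <= B) ->
  (forall q q', @circle R q -> @circle R q' -> `|f q - f q'| <= L * md (toC q - toC q')) ->
  0 <= B -> 0 <= L ->
  RInt nu f = RInt nu' f.
Proof.
move=> mf fB fL B0 L0; apply/eqP; rewrite -subr_eq0 -normr_eq0 eq_le normr_ge0 andbT.
apply/ler_addgt0Pl => e' e'0; rewrite addr0.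
(* Each of the two measures contributes an error [e (2 B + 3 L)]; the final 1 makes [K] positive. *)
pose K := 2 * (2 * B + 3 * L) + 1.
have K0 : 0 < K by rewrite /K; lra.
pose e := Num.min (1 / 2) (e' / K).
have e0 : 0 < e by rewrite /e lt_min divr_gt0// divr_gt0.
have e2 : e <= 1 / 2 by rewrite /e ge_min lexx.
have eK : e * K <= e' by rewrite -ler_pdivlMr// /e ge_min lexx orbT.
(* With [1 - r] of order [e^2] the decay constant is at most [e^2], hence at most [e] after division
   by the scale [dl = e]. Only then is [M] chosen, depending on [r]. *)
pose r := 1 - e ^+ 2 / 4.
have r01 : 0 < r < 1 by rewrite /r; apply/andP; split; nra.
have [r0 r1] := andP r01.
have kE : (1 - r ^+ 2) / r <= e ^+ 2.
  rewrite ler_pdivrMr//; have e4 : e ^+ 2 = 4 * (1 - r) by rewrite /r; field.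
  have : 15 / 16 <= r by rewrite /r; nra.
  by rewrite e4; nra.
have er : 0 < e * (1 - r) / 2 by rewrite divr_gt0// mulr_gt0// subr_gt0.
have [M M0 rM] := expn_small r01 er.
pose a := 2 * r ^+ M / (1 - r).
have ae : a <= e by rewrite /a ler_pdivrMr ?subr_gt0//; lra.
have a0 : 0 <= a.
  apply: divr_ge0; last by rewrite subr_ge0 ltW.
  by apply: mulr_ge0 => //; apply: exprn_ge0; exact: ltW.
have close (n : probability (R * R)%type R) : n (@circle R) = 1%E ->
    `|RInt n f - RInt n (smoothed f M r)| <= e * (2 * B + 3 * L).
  move=> nC; have [i1 _] := smoothed_int f M nC r01.
  have if_ : n.-integrable setT (EFin \o f) by apply: (integrable_bdd mC nC mf fB).
  have -> : RInt n f - RInt n (smoothed f M r) = RInt n (fun p => f p + - 1 * smoothed f M r p).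
    by rewrite RIntD ?RIntZ ?mulN1r//; exact: integrableZ_R.
  apply: (RInt_abs_le mC nC); first by apply: integrableD_R => //; exact: integrableZ_R.
  move=> p pC; rewrite mulN1r.
  apply: le_trans (smoothed_close fB fL L0 M0 r01 e0 pC erefl) _; rewrite -/a.
  have h1 : (1 - r ^+ 2) / r / e <= e by rewrite ler_pdivrMr// -expr2.
  have h2 : B * a <= B * e by rewrite ler_wpM2l.
  have h3 : e * (1 + a) <= 2 * e by nra.
  have : L / 2 * (e * (1 + a) + (1 - r ^+ 2) / r / e) <= L / 2 * (2 * e + e).
    by rewrite ler_wpM2l ?divr_ge0// lerD.
  have : 0 <= B * e by rewrite mulr_ge0// ltW.
  have : 0 <= L * e by rewrite mulr_ge0// ltW.
  lra.
have eqs : RInt nu (smoothed f M r) = RInt nu' (smoothed f M r).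
  rewrite (smoothed_int f M nuC r01).2 (smoothed_int f M nuC' r01).2.
  congr (_ * _); apply: eq_bigr => j _; rewrite nuU//.
  by rewrite mdM mdC md_conj ru_md mulr1 gtr0_norm.
have c1 := close nu nuC; have c2 := close nu' nuC'; rewrite eqs in c1.
set s := RInt nu' (smoothed f M r) in c1 c2.
have -> : RInt nu f - RInt nu' f = (RInt nu f - s) - (RInt nu' f - s) by ring.
apply: le_trans (ler_normB _ _) _; apply: le_trans (lerD c1 c2) _.
apply: le_trans eK; rewrite /K; lra.
Qed.

(** A Lipschitz cut-off vanishing from [a] on, so its limit is the indicator of the open half-line;
    this is why open quadrants serve as generators. *)
Definition ramp (n : nat) (a x : R) : R := Num.max 0 (Num.min 1 (n%:R * (a - x))).

Lemma ramp01 n a x : 0 <= ramp n a x <= 1.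
Proof. by rewrite /ramp le_max lexx/= ge_max ler01/= ge_min lexx. Qed.
Lemma ramp_lip n a x y : `|ramp n a x - ramp n a y| <= n%:R * `|x - y|.
Proof.
wlog xy : x y / x <= y.
  by move=> h; have [/h//|/ltW /h] := leP x y; rewrite distrC [`|y - x|]distrC.
have n0 : 0 <= n%:R :> R by [].
have h : n%:R * (a - y) <= n%:R * (a - x) by rewrite ler_wpM2l// lerD2l lerN2.
have -> : `|x - y| = y - x by rewrite distrC ger0_norm ?subr_ge0.
have -> : n%:R * (y - x) = n%:R * (a - x) - n%:R * (a - y) by ring.
rewrite /ramp; move: (n%:R * (a - x)) (n%:R * (a - y)) h => s t ts.
rewrite ler_norml !maxEle !minEle.
by apply/andP; split; do 4?case: ifPn; rewrite -?ltNge; lra.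
Qed.
Lemma ramp_cvg a x : (fun n => ramp n a x) @ \oo --> (\1_(`]-oo, a[%classic) x : R).
Proof.
rewrite indicE; have [xa|xa] := ltP x a.
  rewrite mem_set/= ?in_itv//=; apply: cvg_near_cst.
  have [N hN] : exists N : nat, (a - x)^-1 < N%:R.
    by exists (Num.Def.truncn (a - x)^-1).+1; exact: truncnS_gt.
  exists N => // n /= Nn; rewrite /ramp.
  have ax : 0 < a - x by rewrite subr_gt0.
  have : 1 <= n%:R * (a - x).
    rewrite -ler_pdivrMr// mul1r (le_trans (ltW hN))// ler_nat//.
  by move=> h; rewrite (min_idPl h); apply/max_idPr.
rewrite memNset/= ?in_itv/=; last by apply/negP; rewrite -leNgt.
apply: cvg_near_cst; apply: nearW => n; rewrite /ramp; apply/max_idPl.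
by rewrite ge_min mulr_ge0_le0 ?orbT// subr_le0.
Qed.
Lemma measurable_ramp n a : measurable_fun setT (ramp n a).
Proof.
apply: measurable_maxr; first exact: measurable_cst.
apply: measurable_minr; first exact: measurable_cst.
by apply: measurable_funM; [exact: measurable_cst|apply: measurable_funB => //; exact: measurable_cst].
Qed.

Lemma eq_quadrant a b : nu (`]-oo, a[%classic `*` `]-oo, b[%classic) =
  nu' (`]-oo, a[%classic `*` `]-oo, b[%classic).
Proof.
set A := _ `*` _.
have mA : measurable A by apply: measurableX; exact: measurable_itv.
pose f n p := ramp n a p.1 * ramp n b p.2.
have f1 n p : `|f n p| <= 1.
  have /andP[h1 h2] := ramp01 n a p.1; have /andP[h3 h4] := ramp01 n b p.2.
  by rewrite normrM !ger0_norm// mulr_ile1.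
have mf n : measurable_fun setT (f n).
  apply: measurable_funM; apply: (measurableT_comp (measurable_ramp n _)).
    exact: measurable_fst.
  exact: measurable_snd.
have eqf n : RInt nu (f n) = RInt nu' (f n).
  apply: (@eq_RInt_lip _ 1 (2 * n%:R)) => // q q' _ _.
  have -> : f n q - f n q' = (ramp n a q.1 - ramp n a q'.1) * ramp n b q.2 +
     ramp n a q'.1 * (ramp n b q.2 - ramp n b q'.2) by rewrite /f; ring.
  apply: le_trans (ler_normD _ _) _; rewrite !normrM mulr2n mulrDl mul1r mulrDl.
  have /andP[h1 h2] := ramp01 n a q'.1; have /andP[h3 h4] := ramp01 n b q.2.
  have d1 : `|q.1 - q'.1| <= md (toC q - toC q') by have := Re_le_md (toC q - toC q'); rewrite !CE.
  have d2 : `|q.2 - q'.2| <= md (toC q - toC q') by have := Im_le_md (toC q - toC q'); rewrite !CE.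
  apply: lerD.
    rewrite (ger0_norm h3); apply: le_trans (ler_piMr (normr_ge0 _) h4) _.
    by apply: le_trans (ramp_lip _ _ _ _) _; rewrite ler_wpM2l.
  rewrite (ger0_norm h1); apply: le_trans (ler_piMl (normr_ge0 _) h2) _.
  by apply: le_trans (ramp_lip _ _ _ _) _; rewrite ler_wpM2l.
have lim (n : probability (R * R)%type R) : (fun k => RInt n (f k)) @ \oo --> fine (n A).
  have -> : fine (n A) = RInt n (fun p => \1_A p).
    by rewrite /RInt integral_indic//= setIT.
  apply: (RInt_dct measurableT (probability_setT n) (M := 1)) => //.
    by apply: measurable_indic.
  move=> p _; rewrite /f.
  have -> : \1_A p = \1_(`]-oo, a[%classic) p.1 * \1_(`]-oo, b[%classic) p.2 :> R.
    by rewrite !indicE -natrM mulnb; congr (nat_of_bool _)%:R; rewrite in_setX.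
  by apply: cvgM; exact: ramp_cvg.
have l1 := lim nu; have l2 := lim nu'.
have e : fine (nu A) = fine (nu' A).
  rewrite (funext eqf) in l1.
  by apply: (cvg_unique _ l1 l2); exact: norm_hausdorff.
by rewrite -(fineK (fin_num_measure nu _ mA)) e fineK// fin_num_measure.
Qed.

(** A half-plane bounding one coordinate is a countable union of quadrants, and half-lines generate
    the Borel sets of each coordinate. *)
Lemma measurable_quadrants : @measurable _ (R * R)%type =
  <<s [set A | exists a b : R, A = `]-oo, a[%classic `*` `]-oo, b[%classic] >>.
Proof.
set G := [set A | _]; rewrite eqEsubset; split; last first.
  apply: smallest_sub; first exact: sigma_algebra_measurable.
  by move=> _ [a [b ->]]; apply: measurableX; exact: measurable_itv.
have sG : sigma_algebra setT <<s G >> by exact: smallest_sigma_algebra.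
have gen (f : R * R -> R) : (forall a, <<s G >> (f @^-1` `]-oo, a[%classic)) ->
    forall B, measurable B -> <<s G >> (f @^-1` B).
  move=> hf B mB.
  have : (@RGenInftyO.G R).-sigma.-measurable B by rewrite -RGenInftyO.measurableE.
  have := sigma_algebra_image f sG => s2.
  move=> mB'; suff : image_set_system setT f <<s G >> B by rewrite /image_set_system/= setTI.
  apply: (smallest_sub s2 _ mB') => _ [x ->].
  by rewrite /image_set_system/= setTI.
have cov (a : R) : [set: R] = \bigcup_n `]-oo, n%:R[%classic.
  apply/seteqP; split => // x _.
  exists (Num.Def.truncn x).+1 => //=; rewrite in_itv/=; exact: truncnS_gt.
apply: smallest_sub; first exact: smallest_sigma_algebra.
move=> _ [] [B mB <-]; rewrite setTI; apply: gen => // a.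
  have -> : fst @^-1` `]-oo, a[%classic = \bigcup_n (`]-oo, a[%classic `*` `]-oo, n%:R[%classic) :> set (R * R).
    apply/seteqP; split => [[x y] /= xa|[x y] [n _ []]//].
    have [n _ yn] : (\bigcup_n `]-oo, n%:R[%classic) y by rewrite -(cov 0).
    by exists n.
  by apply: sigma_algebra_bigcup => n; apply: sub_sigma_algebra; exists a, n%:R.
have -> : snd @^-1` `]-oo, a[%classic = \bigcup_n (`]-oo, n%:R[%classic `*` `]-oo, a[%classic) :> set (R * R).
  apply/seteqP; split => [[x y] /= xa|[x y] [n _ []]//].
  have [n _ yn] : (\bigcup_n `]-oo, n%:R[%classic) x by rewrite -(cov 0).
  by exists n.
by apply: sigma_algebra_bigcup => n; apply: sub_sigma_algebra; exists n%:R, a.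
Qed.

Lemma circle_unique A : measurable A -> nu A = nu' A.
Proof.
move=> mA; pose g (n : nat) : set (R * R) := `]-oo, n%:R[%classic `*` `]-oo, n%:R[%classic.
apply: (@measure_unique _ R (R * R)%type _ g measurable_quadrants _ _ _ nu nu' _ _ A mA).
- move=> _ _ [a [b ->]] [c [d ->]]; exists (Num.min a c), (Num.min b d).
  rewrite -setXI; congr (_ `*` _); apply/seteqP; split => x /=; rewrite !in_itv/= lt_min.
  + by move=> [-> ->].
  + by move=> /andP[-> ->].
  + by move=> [-> ->].
  + by move=> /andP[-> ->].
- by move=> n; exists n%:R, n%:R.
- apply/seteqP; split => // -[x y] _.
  exists (Num.Def.truncn (Num.max x y)).+1 => //; rewrite /g /= !in_itv/=.
  by have := truncnS_gt (Num.max x y); rewrite gt_max => /andP[-> ->].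
- by move=> _ [a [b ->]]; exact: eq_quadrant.
- by move=> n; rewrite (le_lt_trans (probability_le1 _ _)) ?ltry//; apply: measurableX; exact: measurable_itv.
Qed.
End MeasureUniqueness.

(** * The Cayley transform and uniqueness on the line *)

Section Cayley.
Context {R : realType}.
Implicit Types (z w u : R[i]) (x : R).

Lemma Re_i : Re ('i%R : R[i]) = 0. Proof. by []. Qed.
Lemma Im_i : Im ('i%R : R[i]) = 1. Proof. by []. Qed.

(** The point [(x + i) / (x - i)] of the circle, that is the inverse of [cayD] at real [x]: this
    makes [1 - cayD z * zeta] vanish precisely at [x = z]. The point [(1, 0)] is missed and
    corresponds to infinity. *)
Definition cay x : R * R := ((x ^+ 2 - 1) / (x ^+ 2 + 1), 2 * x / (x ^+ 2 + 1)).
Definition icay (p : R * R) : R := p.2 / (1 - p.1).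

Lemma sq1_gt0 x : 0 < x ^+ 2 + 1. Proof. by rewrite ltr_wpDl ?sqr_ge0. Qed.
Lemma cayK x : icay (cay x) = x.
Proof.
have h : x ^+ 2 + 1 != 0 by rewrite gt_eqF ?sq1_gt0.
rewrite /icay /cay/=.
have -> : 1 - (x ^+ 2 - 1) / (x ^+ 2 + 1) = 2 / (x ^+ 2 + 1) by field.
by field.
Qed.
Lemma cay_circle x : @circle R (cay x).
Proof.
have h : x ^+ 2 + 1 != 0 by rewrite gt_eqF ?sq1_gt0.
by rewrite /circle /cay/=; field.
Qed.
Lemma measurable_cay : measurable_fun setT cay.
Proof.
have m2 : measurable_fun setT (fun x : R => x ^+ 2) by apply: measurable_funX.
have mi : measurable_fun setT (fun x : R => (x ^+ 2 + 1)^-1).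
  apply: (measurableT_comp measurable_invr); apply: measurable_funD => //; exact: measurable_cst.
apply/measurable_fun_pairP; split; apply: measurable_funM => //.
by apply: measurable_funB => //; exact: measurable_cst.
Qed.
Lemma measurable_icay : measurable_fun setT icay.
Proof.
apply: measurable_funM; first exact: measurable_snd.
apply: (measurableT_comp measurable_invr); apply: measurable_funB; first exact: measurable_cst.
exact: measurable_fst.
Qed.

Lemma i_neq0 : 'i != 0 :> R[i]. Proof. by rewrite -md_gt0 md_i. Qed.
Lemma ii : 'i * 'i = -1 :> R[i]. Proof. by rewrite -expr2 sqr_i. Qed.

Lemma disc_cexp u : md u < 1 -> u != 0 -> exists2 z, 0 < Im z & cexp ('i * z) = u.
Proof.
move=> u1 /cexp_surj[d du].
have id_ : 'i * - ('i * d) = d by rewrite mulrN mulrA ii mulN1r opprK.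
exists (- ('i * d)); last by rewrite id_.
by move: u1; rewrite -du -{1}id_ md_cexp Re_iM -expR0 ltr_expR oppr_lt0.
Qed.

Lemma toC_cay x : toC (cay x) * (x%:C - 'i) = x%:C + 'i.
Proof.
have h : x ^+ 2 + 1 != 0 by rewrite gt_eqF ?sq1_gt0.
have e (z : R[i]) : z * (x%:C - 'i) = (Re z * x + Im z) +i* (Im z * x - Re z).
  by apply: complex_eq; rewrite !(Re_i, Im_i, CE) ?subr0 ?sub0r ?mulrN1 ?opprK ?[RHS]/= // addrC.
rewrite /toC /cay e; apply: complex_eq; rewrite [LHS]/= ?(ReD, ImD) ?(Re_i, Im_i, ReC, ImC) ?addr0 ?add0r; by field.
Qed.

Definition cayD z : R[i] := (z - 'i) / (z + 'i).
Definition icayD w : R[i] := 'i * (1 + w) / (1 - w).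

Lemma upperD_neq0 z : 0 < Im z -> z + 'i != 0.
Proof.
by move=> z0; apply: upper_neq0; rewrite ImD Im_i addr_gt0.
Qed.
Lemma md_cayD z : 0 < Im z -> md (cayD z) < 1.
Proof.
move=> z0; rewrite mdM mdV ltr_pdivrMr ?md_gt0 ?upperD_neq0// mul1r.
rewrite -(@ltr_pXn2r _ 2)// ?nnegrE ?md_ge0// !md_sq !(Re_i, Im_i, CE); nra.
Qed.
Lemma icayDK z : 0 < Im z -> icayD (cayD z) = z.
Proof.
move=> z0; have h := upperD_neq0 z0; have h2 := i_neq0.
rewrite /icayD /cayD.
have -> : 1 - (z - 'i) / (z + 'i) = 2 * 'i / (z + 'i) by field.
have -> : 1 + (z - 'i) / (z + 'i) = 2 * z / (z + 'i) by field.
by field; rewrite h2 h.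
Qed.
Lemma icayD_Im w : md w < 1 -> Im (icayD w) = (1 - md w ^+ 2) / md (1 - w) ^+ 2.
Proof.
move=> w1; rewrite /icayD -mulrA Im_iM ReM inv_ReE inv_ImE !md_sq !CE.
have : md (1 - w) ^+ 2 != 0 by rewrite expf_neq0// md_eq0 sub1_neq0.
rewrite md_sq !CE sub0r => h.
by field.
Qed.
Lemma icayD_Im_gt0 w : md w < 1 -> 0 < Im (icayD w).
Proof.
move=> w1; rewrite icayD_Im// divr_gt0 ?exprn_gt0 ?md_gt0 ?sub1_neq0// subr_gt0.
by rewrite expr_lt1 ?md_ge0.
Qed.
Lemma cayDK w : md w < 1 -> cayD (icayD w) = w.
Proof.
move=> w1; have h := sub1_neq0 w1; have h2 := i_neq0.
rewrite /icayD /cayD.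
have -> : 'i * (1 + w) / (1 - w) - 'i = 2 * 'i * w / (1 - w) by field.
have -> : 'i * (1 + w) / (1 - w) + 'i = 2 * 'i / (1 - w) by field.
by field; rewrite h2 h.
Qed.

(** Both kernels are Moebius functions of [x] with their pole at [z], hence affine in one another;
    [Uc] on the disc and [G_mu] on the half-plane are thereby interchangeable. *)
Lemma cay_kernel z x : 0 < Im z -> (1 - cayD z * toC (cay x))^-1 =
  (z + 'i) / (- (2 * 'i)) * (-1 + (z - 'i) * (z - x%:C)^-1).
Proof.
move=> z0; have h1 := upperD_neq0 z0; have h2 := i_neq0; have h3 := cauchy_neq0 x z0.
have h4 : x%:C - 'i != 0.
  by apply/eqP => /(congr1 (@complex.Im R)); rewrite !CE Im_i sub0r => /eqP; rewrite oppr_eq0 oner_eq0.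
have e : toC (cay x) = (x%:C + 'i) / (x%:C - 'i) by rewrite -toC_cay mulfK.
rewrite e /cayD.
have -> : 1 - (z - 'i) / (z + 'i) * ((x%:C + 'i) / (x%:C - 'i)) =
   - (2 * 'i) * (z - x%:C) / ((z + 'i) * (x%:C - 'i)) by field; rewrite h1 h4.
have -> : -1 + (z - 'i) * (z - x%:C)^-1 = (x%:C - 'i) / (z - x%:C) by field.
by field; rewrite h1 h2 h3 h4.
Qed.

Lemma Uc_cay (mu : probability R R) (nu : probability (R * R)%type R) z :
  (forall A, measurable A -> nu A = mu (cay @^-1` A)) -> 0 < Im z ->
  Uc nu (cayD z) = (z + 'i) / (- (2 * 'i)) * (-1 + (z - 'i) * G_mu mu z).
Proof.
move=> h z0; have w1 := md_cayD z0.
have i1 : ibl mu (fun x : R => -1 + (z - 'i) * (z - x%:C)^-1).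
  by apply: iblD; [exact: ibl_cst|apply: iblZ; exact: ibl_cauchy].
have e : (fun p : R * R => (1 - cayD z * toC p)^-1) \o cay =
   (fun x => (z + 'i) / (- (2 * 'i)) * (-1 + (z - 'i) * (z - x%:C)^-1)).
  by apply/funext => x /=; rewrite cay_kernel.
rewrite /Uc (CInt_push measurable_cay h (mfC_Uc _)) e; last exact: iblZ.
rewrite CIntZ//; congr (_ * _); rewrite CIntD; last 2 first.
- exact: ibl_cst.
- by apply: iblZ; exact: ibl_cauchy.
by rewrite CInt_cst CIntZ//; exact: ibl_cauchy.
Qed.

Lemma push_cay_circle (mu : probability R R) : push mu measurable_cay (@circle R) = 1%E.
Proof.
rewrite pushE (_ : _ @^-1` _ = setT); first exact: probability_setT.
by apply/seteqP; split => // x _; exact: cay_circle.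
Qed.

(** The images under [cay] have the same [Uc], so [circle_unique] applies to them; the left inverse
    [icay] brings the equality back to the line. *)
Lemma cauchy_unique (mu mu' : probability R R) :
  (forall z, 0 < Im z -> G_mu mu z = G_mu mu' z) ->
  forall A, measurable A -> mu A = mu' A.
Proof.
move=> hG A mA.
have e : cay @^-1` (icay @^-1` A) = A.
  by apply/seteqP; split => x /=; rewrite cayK.
suff : mu (cay @^-1` (icay @^-1` A)) = mu' (cay @^-1` (icay @^-1` A)) by rewrite e.
have mi : measurable (icay @^-1` A).
  by rewrite -[X in measurable X]setTI; exact: measurable_icay.
apply: (circle_unique (push_cay_circle mu) (push_cay_circle mu') _ mi) => w w1.
rewrite -(cayDK w1) (@Uc_cay mu)//; last exact: icayD_Im_gt0.
rewrite (@Uc_cay mu')//; last exact: icayD_Im_gt0.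
by rewrite hG//; exact: icayD_Im_gt0.
Qed.
End Cayley.

(** * Functions with a quadratic remainder *)

Section C11.
Context {R : realType}.
Implicit Types (z w u : R[i]) (S : set R[i]) (C : R).

(* A quadratic remainder term stands in for holomorphy: unlike complex
   differentiability it passes through algebraic operations, composition and integrals
   by estimates alone, and it is all that the Cauchy formula below requires. *)
Definition c11B C S (f f' : R[i] -> R[i]) : Prop := forall z, S z ->
  [/\ md (f z) <= C, md (f' z) <= C &
      forall u, S u -> md (f z - f u - f' u * (z - u)) <= C * md (z - u) ^+ 2].

(** One constant serves the whole family, which is what permits integration over the parameter
    ([c11_CInt]); a single function is a family over [unit]. *)
Definition c11 (X : Type) S (f f' : X -> R[i] -> R[i]) : Prop :=
  exists2 C, 0 <= C & forall x, c11B C S (f x) (f' x).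

Lemma c11B_le C C' S f f' : C <= C' -> c11B C S f f' -> c11B C' S f f'.
Proof.
move=> CC h z Sz; have [h1 h2 h3] := h z Sz; split; [exact: le_trans CC|exact: le_trans CC|].
by move=> u /h3 => h4; apply: le_trans h4 _; rewrite ler_wpM2r ?sqr_ge0.
Qed.

(** No convexity of [S] is involved: at distance at most 1 the remainder estimate applies, at larger
    distance the bound on [f]. *)
Lemma c11B_lip C S f f' z u : 0 <= C -> c11B C S f f' -> S z -> S u ->
  md (f z - f u) <= 2 * C * md (z - u).
Proof.
move=> C0 h Sz Su; have [h1 _ h3] := h z Sz; have [k1 k2 _] := h u Su.
have h4 := h3 _ Su; have m0 := md_ge0 (z - u).
have [d1|d1] := leP (md (z - u)) 1.
  have -> : f z - f u = (f z - f u - f' u * (z - u)) + f' u * (z - u) by ring.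
  apply: le_trans (mdD _ _) _; rewrite mdM.
  have e1 : md (f' u) * md (z - u) <= C * md (z - u) by rewrite ler_wpM2r.
  have : C * md (z - u) ^+ 2 <= C * md (z - u) by rewrite ler_wpM2l// expr2 ler_piMr.
  lra.
by apply: le_trans (mdD _ _) _; rewrite mdN; nra.
Qed.

(** Adding the remainders from [u] to [z] and from [z] to [u] cancels [f] and leaves
    [(f' z - f' u) (z - u)]. *)
Lemma c11B_lip' C S f f' z u : c11B C S f f' -> S z -> S u ->
  md (f' z - f' u) <= 2 * C * md (z - u).
Proof.
move=> h Sz Su; have [_ _ /(_ _ Su) h3] := h z Sz; have [_ _ /(_ _ Sz) k3] := h u Su.
have [->|zu] := eqVneq z u; first by rewrite !subrr md0 mulr0.
have m0 : 0 < md (z - u) by rewrite md_gt0 subr_eq0.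
rewrite -(ler_pM2r m0) -mdM.
have -> : (f' z - f' u) * (z - u) =
   (f z - f u - f' u * (z - u)) + (f u - f z - f' z * (u - z)) by ring.
by apply: le_trans (mdD _ _) _; move: k3; rewrite [md (u - z)]mdB; lra.
Qed.


Lemma c11_common X S (f f' g g' : X -> R[i] -> R[i]) : c11 S f f' -> c11 S g g' ->
  exists2 C, 0 <= C & forall x, c11B C S (f x) (f' x) /\ c11B C S (g x) (g' x).
Proof.
move=> [C C0 h] [C' C'0 h']; exists (C + C'); first exact: addr_ge0.
by move=> x; split; [apply: c11B_le (h x)|apply: c11B_le (h' x)]; rewrite ?lerDl ?lerDr.
Qed.

Lemma c11_reindex X Y (k : Y -> X) S (f f' : X -> R[i] -> R[i]) : c11 S f f' ->
  c11 S (fun y => f (k y)) (fun y => f' (k y)).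
Proof. by move=> [C C0 h]; exists C => // y; exact: h. Qed.

Lemma c11_cst X S (c : X -> R[i]) B : (forall x, md (c x) <= B) ->
  c11 S (fun x _ => c x) (fun _ _ => 0).
Proof.
move=> cB; exists `|B| => // x z Sz; split; rewrite ?md0//.
  by apply: le_trans (cB x) _; exact: ler_norm.
by move=> u _; rewrite mul0r subrr subr0 md0 mulr_ge0 ?sqr_ge0.
Qed.

Lemma c11_id X S B : (forall z, S z -> md z <= B) ->
  c11 S (fun (_ : X) z => z) (fun _ _ => 1).
Proof.
move=> SB; exists (1 + `|B|); first by rewrite addr_ge0.
move=> x z Sz; rewrite md1; split=> [||u _].
- by have := SB z Sz; have := ler_norm B; lra.
- by rewrite lerDl.
by rewrite mul1r subrr md0 mulr_ge0 ?sqr_ge0// addr_ge0.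
Qed.

Lemma c11D X S (f f' g g' : X -> R[i] -> R[i]) : c11 S f f' -> c11 S g g' ->
  c11 S (fun x z => f x z + g x z) (fun x z => f' x z + g' x z).
Proof.
move=> hf hg; have [C C0 h] := c11_common hf hg.
exists (2 * C); first by rewrite mulr_ge0.
move=> x z Sz; have [/(_ z Sz)[h1 h2 h3] /(_ z Sz)[k1 k2 k3]] := h x.
split; [apply: le_trans (mdD _ _) _; lra|apply: le_trans (mdD _ _) _; lra|move=> u Su].
have := h3 u Su; have := k3 u Su.
have -> : f x z + g x z - (f x u + g x u) - (f' x u + g' x u) * (z - u) =
  (f x z - f x u - f' x u * (z - u)) + (g x z - g x u - g' x u * (z - u)) by ring.
by move=> a b; apply: le_trans (mdD _ _) _; nra.
Qed.

Lemma c11M X S (f f' g g' : X -> R[i] -> R[i]) : c11 S f f' -> c11 S g g' ->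
  c11 S (fun x z => f x z * g x z) (fun x z => f' x z * g x z + f x z * g' x z).
Proof.
move=> hf hg; have [C C0 h] := c11_common hf hg.
exists (6 * C ^+ 2); first by rewrite mulr_ge0// sqr_ge0.
move=> x z Sz; have [hx kx] := h x.
have [h1 h2 h3] := hx z Sz; have [k1 k2 k3] := kx z Sz.
have le2 a b : md a <= C -> md b <= C -> md (a * b) <= C ^+ 2.
  by move=> aC bC; rewrite mdM expr2 ler_pM ?md_ge0.
have := le2 _ _ h1 k1; have := le2 _ _ h2 k1; have := le2 _ _ h1 k2 => e1 e2 e3.
split; [nra|apply: le_trans (mdD _ _) _; nra|move=> u Su].
have a1 := h3 u Su; have b1 := k3 u Su.
have a2 := c11B_lip C0 hx Sz Su; have b2 := c11B_lip C0 kx Sz Su.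
have [i1 _ _] := hx u Su; have [j1 _ _] := kx u Su.
have -> : f x z * g x z - f x u * g x u - (f' x u * g x u + f x u * g' x u) * (z - u) =
  (f x z - f x u - f' x u * (z - u)) * g x u + f x u * (g x z - g x u - g' x u * (z - u))
  + (f x z - f x u) * (g x z - g x u) by ring.
have m0 := md_ge0 (z - u).
apply: le_trans (mdD _ _) _; apply: le_trans (lerD (mdD _ _) (lexx _)) _; rewrite !mdM.
have -> : 6 * C ^+ 2 * md (z - u) ^+ 2 = C * md (z - u) ^+ 2 * C + C * (C * md (z - u) ^+ 2)
  + (2 * C * md (z - u)) * (2 * C * md (z - u)) by ring.
by rewrite !lerD// ler_pM ?md_ge0.
Qed.

Lemma c11N X S (f f' : X -> R[i] -> R[i]) : c11 S f f' ->
  c11 S (fun x z => - f x z) (fun x z => - f' x z).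
Proof.
move=> [C C0 h]; exists C => // x z Sz; have [h1 h2 h3] := h x z Sz.
rewrite !mdN; split => // u Su.
have -> : - f x z - - f x u - - f' x u * (z - u) = - (f x z - f x u - f' x u * (z - u)) by ring.
by rewrite mdN h3.
Qed.

Lemma c11V X S (f f' : X -> R[i] -> R[i]) c : 0 < c ->
  (forall x z, S z -> c <= md (f x z)) -> c11 S f f' ->
  c11 S (fun x z => (f x z)^-1) (fun x z => - f' x z / f x z ^+ 2).
Proof.
move=> c0 fc [C C0 h].
pose b := c^-1; have b0 : 0 < b by rewrite invr_gt0.
exists (b + C * b ^+ 2 + (C * b ^+ 2 + C * (2 * C) * b ^+ 3)).
  by rewrite !addr_ge0// ?mulr_ge0// ?exprn_ge0// ltW.
move=> x z Sz.
have fb v : S v -> f x v != 0 /\ md (f x v)^-1 <= b.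
  move=> Sv; have := fc x v Sv => cv; have m0 : 0 < md (f x v) by exact: lt_le_trans cv.
  by rewrite -md_gt0; split=> //; rewrite mdV lef_pV2// posrE.
have [fz0 ifz] := fb z Sz; have [h1 h2 h3] := h x z Sz.
have q1 : 0 <= C * b ^+ 2 by rewrite mulr_ge0// exprn_ge0// ltW.
have q2 : 0 <= C * (2 * C) * b ^+ 3.
  by apply: mulr_ge0; [apply: mulr_ge0 => //; exact: mulr_ge0|apply: exprn_ge0; exact: ltW].
split.
- by apply: le_trans ifz _; lra.
- rewrite mdM mdN -exprVn mdX.
  have : md (f' x z) * md (f x z)^-1 ^+ 2 <= C * b ^+ 2.
    by rewrite ler_pM ?md_ge0 ?exprn_ge0 ?md_ge0// lerXn2r ?nnegrE ?md_ge0// ltW.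
  by lra.
move=> u Su; have [fu0 ifu] := fb u Su.
have a1 := h3 u Su; have a2 := c11B_lip C0 (h x) Sz Su; have [i1 i2 _] := h x u Su.
have -> : (f x z)^-1 - (f x u)^-1 - - f' x u / f x u ^+ 2 * (z - u) =
  - (f x z - f x u - f' x u * (z - u)) * ((f x z)^-1 * (f x u)^-1)
  + f' x u * (f x z - f x u) * (z - u) * ((f x z)^-1 * (f x u)^-1 ^+ 2).
  by field; rewrite fz0 fu0.
apply: le_trans (mdD _ _) _; rewrite !mdM mdN.
have m0 := md_ge0 (z - u).
have e1 : md (f x z)^-1 * md (f x u)^-1 <= b ^+ 2 by rewrite expr2 ler_pM ?md_ge0.
have e2 : md (f x z)^-1 * (md (f x u)^-1 * md (f x u)^-1) <= b ^+ 3.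
  by rewrite exprS expr2; do 2![apply: ler_pM; rewrite ?mulr_ge0 ?md_ge0//].
have e3 : md (f' x u) * md (f x z - f x u) * md (z - u) <= C * (2 * C * md (z - u)) * md (z - u).
  by rewrite ler_wpM2r// ler_pM ?md_ge0.
apply: (@le_trans _ _ (C * md (z - u) ^+ 2 * b ^+ 2 + C * (2 * C * md (z - u)) * md (z - u) * b ^+ 3)).
  by rewrite lerD// ler_pM ?md_ge0 ?mulr_ge0 ?md_ge0.
have p0 : 0 <= (b + C * b ^+ 2) * md (z - u) ^+ 2 by rewrite mulr_ge0 ?sqr_ge0// addr_ge0// ltW.
have -> : (b + C * b ^+ 2 + (C * b ^+ 2 + C * (2 * C) * b ^+ 3)) * md (z - u) ^+ 2 =
  (b + C * b ^+ 2) * md (z - u) ^+ 2 + (C * md (z - u) ^+ 2 * b ^+ 2 + C * (2 * C * md (z - u)) * md (z - u) * b ^+ 3) by ring.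
by rewrite lerDr.
Qed.

Lemma c11_comp X S S' (f f' : R[i] -> R[i]) (g g' : X -> R[i] -> R[i]) :
  c11 S' (fun _ : unit => f) (fun=> f') -> c11 S g g' ->
  (forall x z, S z -> S' (g x z)) ->
  c11 S (fun x z => f (g x z)) (fun x z => f' (g x z) * g' x z).
Proof.
move=> [Cf Cf0 /(_ tt) hf] [Cg Cg0 hg] gS.
pose C := Cf + Cg; have C0 : 0 <= C by rewrite addr_ge0.
have {}hf : c11B C S' f f' by apply: c11B_le hf; rewrite lerDl.
have {}hg x : c11B C S (g x) (g' x) by apply: c11B_le (hg x); rewrite lerDr.
exists (C + C ^+ 2 + (4 * C ^+ 3)).
  by rewrite !addr_ge0// ?mulr_ge0 ?exprn_ge0.
move=> x z Sz.
have p2 : 0 <= C ^+ 2 by rewrite exprn_ge0.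
have p3 : 0 <= C ^+ 3 by rewrite exprn_ge0.
have [h1 h2 h3] := hf _ (gS x _ Sz); have [k1 k2 k3] := hg x z Sz.
split; first by lra.
  have : md (f' (g x z)) * md (g' x z) <= C ^+ 2 by rewrite expr2 ler_pM ?md_ge0.
  by rewrite mdM; lra.
move=> u Su; have a := h3 _ (gS x _ Su); have b := k3 _ Su.
have l := c11B_lip C0 (hg x) Sz Su.
have [_ h4 _] := hf _ (gS x _ Su).
have -> : f (g x z) - f (g x u) - f' (g x u) * g' x u * (z - u) =
  (f (g x z) - f (g x u) - f' (g x u) * (g x z - g x u)) +
  f' (g x u) * (g x z - g x u - g' x u * (z - u)) by ring.
apply: le_trans (mdD _ _) _; rewrite mdM.
have e1 : md (f' (g x u)) * md (g x z - g x u - g' x u * (z - u)) <= C * (C * md (z - u) ^+ 2).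
  by rewrite ler_pM ?md_ge0.
have e2 : md (g x z - g x u) ^+ 2 <= (2 * C * md (z - u)) ^+ 2.
  by rewrite lerXn2r ?nnegrE ?mulr_ge0 ?md_ge0.
have e3 : C * md (g x z - g x u) ^+ 2 <= C * (2 * C * md (z - u)) ^+ 2 by rewrite ler_wpM2l.
have m2 : 0 <= C * md (z - u) ^+ 2 by rewrite mulr_ge0 ?sqr_ge0.
have -> : (C + C ^+ 2 + 4 * C ^+ 3) * md (z - u) ^+ 2 = C * md (z - u) ^+ 2 +
  C * (C * md (z - u) ^+ 2) + C * (2 * C * md (z - u)) ^+ 2 by ring.
lra.
Qed.

Lemma c11_eq X S (f f' g g' : X -> R[i] -> R[i]) : (forall x z, S z -> f x z = g x z) ->
  (forall x z, S z -> f' x z = g' x z) -> c11 S f f' -> c11 S g g'.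
Proof.
move=> e e' [C C0 h]; exists C => // x z Sz; have [h1 h2 h3] := h x z Sz.
rewrite -e// -e'//; split=> // u Su.
by rewrite -e// -e'// h3.
Qed.

Lemma c11_cexp S B : (forall z, S z -> md z <= B) ->
  c11 S (fun _ : unit => @cexp R) (fun=> @cexp R).
Proof.
move=> SB.
pose K := expR B * (8 * expR (2 * `|B|) * (1 + 2 * `|B|)).
have K0 : 0 <= K by rewrite /K !mulr_ge0 ?expR_ge0// addr_ge0// mulr_ge0.
exists (expR B + K); first by rewrite addr_ge0// expR_ge0.
have eB z : S z -> md (cexp z) <= expR B.
  by move=> Sz; rewrite md_cexp ler_expR; apply: le_trans (Re_le _) (SB _ Sz).
move=> _ z Sz; have := eB z Sz => h; split; [lra|lra|move=> u Su].
have -> : cexp z - cexp u - cexp u * (z - u) = cexp u * (cexp (z - u) - 1 - (z - u)).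
  have -> : cexp z = cexp u * cexp (z - u) by rewrite -cexpD addrC subrK.
  by ring.
have d2 : md (z - u) <= 2 * `|B|.
  apply: le_trans (mdD _ _) _; rewrite mdN.
  by have := SB _ Sz; have := SB _ Su; have := ler_norm B; lra.
rewrite mdM; apply: (@le_trans _ _ (K * md (z - u) ^+ 2)); last first.
  by rewrite ler_wpM2r ?sqr_ge0// lerDr expR_ge0.
by rewrite /K -mulrA ler_pM ?md_ge0 ?eB// cexp_quad.
Qed.

End C11.

(** * The Cauchy formula over roots of unity *)

Section DiscreteCauchy.
Context {R : realType}.
Implicit Types (z w u : R[i]).


Definition udisc (r : R) : set R[i] := [set z | md z <= r].

(* Both terms are values of [t |-> (1/M) sum_j f (w + t (w_j - w)) / (1 - w / w_j)], [w_j]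
   the roots of unity; its derivative [(1/M) sum_j f' (p_j) w_j] is a Riemann sum of an
   exact differential along a closed polygon. *)
Lemma discrete_cauchy C (f f' : R[i] -> R[i]) w M : 0 <= C -> c11B C (udisc 1) f f' ->
  md w < 1 -> (1 < M)%N ->
  md (M%:R^-1 * \sum_(j < M) f (ruN M j) / (1 - w * (ruN M j)^-1) - f w / (1 - w ^+ M))
    <= C * md (ruN M 1 - 1).
Proof.
move=> C0 hf w1 M1.
have M0 : (0 < M)%N by exact: ltnW.
have MR : 0 < M%:R :> R by rewrite ltr0n.
have Mi : M%:R != 0 :> R[i] by rewrite pnatr_eq0 -lt0n.
have r1 : ruN M 1 - 1 != 0 :> R[i] by rewrite subr_eq0 ru_neq1.
pose p (j : nat) (t : R) : R[i] := w + t%:C * (ruN M j - w).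
have Sp j t : 0 <= t -> t <= 1 -> udisc 1 (p j t).
  move=> t0 t1; rewrite /udisc/= /p.
  have -> : w + t%:C * (ruN M j - w) = (1 - t)%:C * w + t%:C * ruN M j.
    by rewrite rmorphB rmorph1; ring.
  apply: le_trans (mdD _ _) _; rewrite (mdM (1 - t)%:C) (mdM t%:C) !mdC ru_md !ger0_norm ?subr_ge0//.
  by have := md_ge0 w; nra.
(* The edges of the polygon are [t (w_1 - 1) w_j]: the sum in question, times [t (w_1 - 1)], is the
   linear part of increments of [f] that cancel around the polygon. At [t = 0], where division
   fails, the roots of unity sum to zero. *)
have A t : 0 <= t -> t <= 1 ->
    md (\sum_(j < M) f' (p j t) * ruN M j) <= M%:R * (C * md (ruN M 1 - 1)).
  move=> t0 t1; move: t0; rewrite le_eqVlt => /predU1P[<-|t0].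
    rewrite (_ : \sum_(j < M) _ = 0) ?md0; last first.
      transitivity (f' w * \sum_(j < M) ruN M (j * 1)); last by rewrite ru_sum ?mulr0.
      by rewrite mulr_sumr; apply: eq_bigr => j _; rewrite /p mul0r addr0 muln1.
    by rewrite !mulr_ge0 ?md_ge0.
  have h : md (\sum_(j < M) (f (p j.+1 t) - f (p j t) - f' (p j t) * (p j.+1 t - p j t)))
      <= \sum_(j < M) C * (t * md (ruN M 1 - 1)) ^+ 2.
    apply: le_trans (md_sum _ _ _) _; apply: ler_sum => j _.
    have [_ _ k] := hf _ (Sp j.+1 t (ltW t0) t1).
    apply: le_trans (k _ (Sp j t (ltW t0) t1)) _.
    have -> : p j.+1 t - p j t = t%:C * (ruN M j * (ruN M 1 - 1)).
      by rewrite /p -addn1 ruD; ring.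
    by rewrite (mdM t%:C) (mdM (ruN M j)) ru_md mul1r mdC gtr0_norm.
  move: h; rewrite sumr_const card_ord -[C * _ *+ M]mulr_natl.
  rewrite big_split/= -[X in X + _](big_mkord xpredT (fun j => f (p j.+1 t) - f (p j t))).
  rewrite telescope_sumr// {1}/p ruM// {1}/p ru0 subrr add0r sumrN mdN.
  have -> : \sum_(j < M) f' (p j t) * (p j.+1 t - p j t) =
     t%:C * (ruN M 1 - 1) * \sum_(j < M) f' (p j t) * ruN M j.
    by rewrite mulr_sumr; apply: eq_bigr => j _; rewrite /p -addn1 ruD; ring.
  have tm : 0 < t * md (ruN M 1 - 1) by rewrite mulr_gt0// md_gt0.
  rewrite mdM mdM mdC gtr0_norm// => h; rewrite -(ler_pM2l tm).
  apply: le_trans h _.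
  have -> : t * md (ruN M 1 - 1) * (M%:R * (C * md (ruN M 1 - 1))) =
    M%:R * C * t * md (ruN M 1 - 1) ^+ 2 by ring.
  have -> : M%:R * (C * (t * md (ruN M 1 - 1)) ^+ 2) =
    M%:R * C * t * md (ruN M 1 - 1) ^+ 2 * t by ring.
  rewrite ler_piMr//; apply: mulr_ge0; last exact: sqr_ge0.
  by apply: mulr_ge0; [apply: mulr_ge0 => //|]; exact: ltW.
pose kap (j : nat) : R[i] := (1 - w * (ruN M j)^-1)^-1.
have k0 j : ruN M j - w != 0.
  by rewrite subr_eq0; apply/eqP => e; move: w1; rewrite -e ru_md ltxx.
have kapE j : kap j = ruN M j / (ruN M j - w).
  by have h1 := ru_neq0 M j; have h2 := k0 j; rewrite /kap; field; rewrite h1 h2.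
pose phi t := M%:R^-1 * \sum_(j < M) f (p j t) * kap j.
have -> : M%:R^-1 * \sum_(j < M) f (ruN M j) / (1 - w * (ruN M j)^-1) = phi 1.
  rewrite /phi; congr (_ * _); apply: eq_bigr => j _; congr (f _ * _).
  by rewrite /p mul1r addrC subrK.
have -> : f w / (1 - w ^+ M) = phi 0.
  have wM : 1 - w ^+ M != 0 by rewrite sub1_neq0// mdX exprn_ilt1 ?md_ge0// -lt0n.
  transitivity (M%:R^-1 * (f w * \sum_(j < M) kap j)); last first.
    by rewrite /phi mulr_sumr; congr (_ * _); apply: eq_bigr => j _; rewrite /p mul0r addr0.
  rewrite (_ : \sum_(j < M) kap j = M%:R / (1 - w ^+ M)); first by field; rewrite wM Mi.
  (* [ru_poisson] involves the roots and not their inverses; conjugation exchanges the two. *)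
  have cM : md (conjc w) < 1 by rewrite md_conj.
  apply: (can_inj (@conjcK R)).
  rewrite conjc_sum -[RHS](_ : M%:R / (1 - conjc w ^+ M) = _).
    rewrite -ru_poisson//; apply: eq_bigr => j _.
    by rewrite /kap -(md1_conj (ru_md _ _)) conjc_inv; congr (_^-1); rewrite rmorphB rmorphM rmorph1/= conjcK.
  by rewrite [RHS]rmorphM/= fmorphV/= rmorphB rmorphXn rmorph1 rmorph_nat.
apply: (@quad_telescope _ _ _ (2 * C)) => s t s0 st t1.
have -> : phi t - phi s =
    M%:R^-1 * (\sum_(j < M) (f (p j t) - f (p j s) - f' (p j s) * (p j t - p j s)) * kap j
     + (t - s)%:C * \sum_(j < M) f' (p j s) * ruN M j).
  rewrite /phi -mulrBr -sumrB [(t - s)%:C * _]mulr_sumr -big_split/=; congr (_ * _); apply: eq_bigr => j _.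
  have -> : ruN M j = (ruN M j - w) * kap j by have := k0 j; rewrite kapE => ?; field.
  by rewrite /p rmorphB; ring.
have s1 := le_trans st t1; have t0 := le_trans s0 st.
rewrite mdM mdV md_nat mulrC ler_pdivrMr//.
apply: le_trans (mdD _ _) _; rewrite addrC.
have -> : (C * md (ruN M 1 - 1) * (t - s) + 2 * C * (t - s) ^+ 2) * M%:R =
  (t - s) * (M%:R * (C * md (ruN M 1 - 1))) + \sum_(j < M) (2 * C * (t - s) ^+ 2).
  by rewrite sumr_const card_ord -[2 * C * _ *+ M]mulr_natl; ring.
rewrite lerD//.
  by rewrite mdM mdC ger0_norm ?subr_ge0// ler_wpM2l ?subr_ge0// A.
apply: le_trans (md_sum _ _ _) _; apply: ler_sum => j _.
have [_ _ k] := hf _ (Sp j t t0 t1); have := k _ (Sp j s s0 s1).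
have -> : p j t - p j s = (t - s)%:C * (ruN M j - w) by rewrite /p rmorphB; ring.
rewrite mdM mdM mdC ger0_norm ?subr_ge0// => h.
rewrite kapE (mdM (ruN M j)) mdV ru_md mul1r ler_pdivrMr ?md_gt0 ?k0//.
apply: le_trans h _; rewrite exprMn.
have m2 : md (ruN M j - w) <= 2.
  by apply: le_trans (mdD _ _) _; rewrite mdN ru_md; lra.
have m0 := md_ge0 (ruN M j - w).
have -> : C * ((t - s) ^+ 2 * md (ruN M j - w) ^+ 2) = C * (t - s) ^+ 2 * md (ruN M j - w) * md (ruN M j - w) by ring.
rewrite ler_wpM2r// mulrC mulrA; apply: ler_wpM2r; first by rewrite sqr_ge0.
by rewrite ler_wpM2r.
Qed.

End DiscreteCauchy.

(** * Compactness of monotone functions and discrete quantile functions *)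

Lemma fmap_ultra T U (G : set_system T) (f : T -> U) :
  UltraFilter G -> UltraFilter (f @ G).
Proof.
move=> GU; split; first by apply: fmap_proper_filter; exact: ultra_proper.
move=> H HP fH; apply/seteqP; split=> // A HA.
have [//|GA] := in_ultra_setVsetC (f @^-1` A) GU.
have HC : H (~` A) by exact: fH.
have : H set0 by rewrite -(setICr A); exact: filterI.
by move=> /(@filter_not_empty _ _ HP).
Qed.

Section Helly.
Context {R : realType}.

(** One free ultrafilter serves all bounded sequences at once. Besides [helly] it provides the
    compactness of discs in [lip_lower_bound]. *)
Lemma ultralimit : exists2 G : set_system nat, ProperFilter G &
  (forall N, G [set n | (N <= n)%N]) /\
  forall (x : nat -> R) a b, (forall n, a <= x n <= b) ->
    exists2 l, a <= l <= b & forall e : R, 0 < e -> G [set n | `|x n - l| <= e].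
Proof.
have [G [GU sG]] := @ultraFilterLemma nat \oo _.
exists G; first exact: ultra_proper.
split=> [N|x a b xab]; first by apply: sG; exists N.
have := @segment_compact R a b; rewrite compact_ultra.
move=> /(_ (x @ G)) [||l [lab xl]].
- exact: fmap_ultra.
- by rewrite /fmap/=; apply: filterE => n; rewrite /= in_itv/=.
exists l; first by move: lab; rewrite /= in_itv.
move=> e e0; move/cvgrPdist_le: xl => /(_ e e0).
by apply: filterS => n /=; rewrite distrC.
Qed.


Lemma CInt_partition (f : R -> R[i]) K N (del : nat -> R) : mfC f ->
  (forall x, 0 < x <= 1 -> md (f x) <= K) -> (0 < N)%N ->
  (forall k x, (k < N)%N -> k%:R / N%:R < x <= k.+1%:R / N%:R -> md (f x) <= del k) ->
  md (CInt U01 f) <= (\sum_(k < N) del k) / N%:R.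
Proof.
move=> mf fK N0 fd.
have NR : 0 < N%:R :> R by rewrite ltr0n.
have step n : (n <= N)%N -> md (CInt U01 (cutI f 0 (n%:R / N%:R))) <= (\sum_(k < n) del k) / N%:R.
  elim: n => [|n ih] nN; first by rewrite big_ord0 !mul0r CInt_cut0 md0.
  have a0 : 0 <= n%:R / N%:R :> R by rewrite divr_ge0.
  have ab : n%:R / N%:R <= n.+1%:R / N%:R :> R by rewrite ler_pM2r ?invr_gt0// ler_nat.
  have b1 : n.+1%:R / N%:R <= 1 :> R by rewrite ler_pdivrMr// mul1r ler_nat.
  have e : n.+1%:R / N%:R - n%:R / N%:R = N%:R^-1 :> R.
    by rewrite -mulrBl -natr1 addrAC subrr add0r mul1r.
  rewrite (CInt_cutD mf fK a0 ab) big_ord_recr/= mulrDl.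
  apply: le_trans (mdD _ _) _; rewrite lerD ?ih 1?ltnW//.
  have := @CInt_cutI R f K _ _ 0 (del n) mf fK a0 ab b1; rewrite e mulr0 subr0; apply.
  by move=> y yn; rewrite subr0; exact: fd.
have := step N (leqnn N); rewrite divff ?gt_eqF// (_ : CInt U01 (cutI f 0 1) = CInt U01 f)//.
exact: cutI_unit fK.
Qed.

(* Pointwise limits along an ultrafilter replace the extraction of a subsequence; monotone
   functions that are close on a finite grid are close in mean. *)
Lemma helly (Q_ : nat -> R -> R) (B : R) : (forall n, {homo Q_ n : s t / s <= t}) ->
  (forall n t, 0 <= Q_ n t <= B) ->
  exists Q, [/\ {homo Q : s t / s <= t}, forall t, 0 <= Q t <= B &
   forall (g : R -> R[i]) L K l, (forall t, md (g t) <= K) -> mfC g ->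
     (forall s t, md (g t - g s) <= L * `|t - s|) ->
     ccvg (fun n => CInt U01 (fun t => g (Q_ n t))) l ->
     CInt U01 (fun t => g (Q t)) = l].
Proof.
move=> Qhomo QB; have [G GP [Gn Gl]] := ultralimit.
pose Q t := xget 0 [set l | 0 <= l <= B /\ forall e : R, 0 < e -> G [set n | `|Q_ n t - l| <= e]].
have hQ t : 0 <= Q t <= B /\ forall e : R, 0 < e -> G [set n | `|Q_ n t - Q t| <= e].
  have [l lB hl] := Gl (Q_ ^~ t) 0 B (QB ^~ t).
  exact: (@xgetPex _ 0 [set l | 0 <= l <= B /\ forall e : R, 0 < e -> G [set n | `|Q_ n t - l| <= e]] (ex_intro _ l (conj lB hl))).
have Qh : {homo Q : s t / s <= t}.
  move=> s t st; rewrite -subr_le0; apply: (@le0_divn R _ 2) => N N0.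
  have NR : 0 < N%:R^-1 :> R by rewrite invr_gt0 ltr0n.
  have [_ /(_ _ NR) h1] := hQ s; have [_ /(_ _ NR) h2] := hQ t.
  have [n [/= k1 k2]] := filter_ex (filterI h1 h2).
  by move: k1 k2 (Qhomo n _ _ st); rewrite !ler_norml => /andP[? ?] /andP[? ?] ?; lra.
exists Q; split=> [//|t|g L K l gK mg gL gl]; first by have [] := hQ t.
have L0 : 0 <= L.
  by have := gL 0 1; rewrite subr0 normr1 mulr1; apply: le_trans; exact: md_ge0.
have mQ n : measurable_fun setT (Q_ n) by apply: nondecreasing_measurable; [|exact: Qhomo].
have mQ0 : measurable_fun setT Q by apply: nondecreasing_measurable.
have B0 : 0 <= B by have /andP[] := QB 0%N 0; exact: le_trans.
apply: mdB_le0.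
apply: (@le0_divn R _ (1 + L * (1 + B))) => N N0.
have NR : 0 < N%:R^-1 :> R by rewrite invr_gt0 ltr0n.
have [N1 hN1] := gl _ NR.
have Gk m : G [set n | forall k, (k < m)%N -> `|Q_ n (k%:R / N%:R) - Q (k%:R / N%:R)| <= N%:R^-1].
  elim: m => [|m ih]; first by apply: filterE => n k; rewrite ltn0.
  have [_ /(_ _ NR) h1] := hQ (m%:R / N%:R).
  apply: filterS (filterI ih h1) => n [/= k1 k2] k.
  by rewrite ltnS leq_eqVlt => /predU1P[->//|]; exact: k1.
have [n [/= n1 nk]] := filter_ex (filterI (Gn N1) (Gk N.+1)).
have {}n1 := hN1 n n1.
have i1 : ibl U01 (fun t => g (Q_ n t)).
  by apply: (ibl_bdd measurableT (probability_setT _) (M := K)) => //; exact: mfC_comp mg (mQ n).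
have i2 : ibl U01 (fun t => g (Q t)).
  by apply: (ibl_bdd measurableT (probability_setT _) (M := K)) => //; exact: mfC_comp mg mQ0.
apply: le_trans (mdBD _ (CInt U01 (fun t => g (Q_ n t))) _) _.
rewrite mulrDl mul1r addrC lerD// -CIntB//.
(* Inside a cell monotonicity traps both functions between their grid values, which agree up to
   [1 / N]; the increments of [Q] telescope to at most [B]. *)
pose del k := L * (N%:R^-1 + (Q (k.+1%:R / N%:R) - Q (k%:R / N%:R))).
apply: (le_trans (@CInt_partition _ (2 * K) N del _ _ N0 _)).
- by apply: mfCB; [exact: mfC_comp mg mQ0|exact: mfC_comp mg (mQ n)].
- move=> x _; apply: le_trans (mdD _ _) _; rewrite mdN.
  by have := gK (Q x); have := gK (Q_ n x); lra.
- move=> k x kN /andP[kx xk]; apply: le_trans (gL _ _) _; rewrite /del ler_wpM2l//.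
  have := nk k (ltnW kN); have := nk k.+1 kN; rewrite !ler_norml.
  have := Qhomo n _ _ (ltW kx); have := Qhomo n _ _ xk.
  have := Qh _ _ (ltW kx); have := Qh _ _ xk.
  by move=> ? ? ? ? /andP[? ?] /andP[? ?]; apply/andP; split; lra.
rewrite ler_pM2r// -mulr_sumr ler_wpM2l// big_split/= sumr_const card_ord.
rewrite -[_ *+ N]mulr_natl mulfV ?gt_eqF ?ltr0n// lerD2l.
rewrite -(big_mkord xpredT (fun k => Q (k.+1%:R / N%:R) - Q (k%:R / N%:R))) telescope_sumr//.
have [/andP[? ?] _] := hQ (N%:R / N%:R); have [/andP[? ?] _] := hQ (0 / N%:R).
by lra.
Qed.
End Helly.
Section StepQuantile.
Context {R : realType}.

(* [Q] is the quantile function of the discrete law with mass [P j] at [c * j]. *)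
Lemma step_quantile M (P : nat -> R) (c : R) : (forall j, 0 <= P j) ->
  \sum_(j < M) P j = 1 -> 0 <= c ->
  exists Q : R -> R, [/\ {homo Q : s t / s <= t}, forall t, 0 <= Q t <= c * M%:R &
    forall (g : R -> R[i]) K, mfC g -> (forall x, md (g x) <= K) ->
      CInt U01 (fun t => g (Q t)) = \sum_(j < M) (P j)%:C * g (c * j%:R)].
Proof.
move=> P0 P1 c0.
pose S k := \sum_(j < k) P j.
have SS k : S k.+1 = S k + P k by rewrite /S big_ord_recr.
have S0 k : 0 <= S k by apply: sumr_ge0.
have Sh : {homo S : j k / (j <= k)%N >-> j <= k}.
  by apply: homo_leq => // [? ? ?|k]; [exact: le_trans|rewrite SS lerDl].
(* Counting starts at 1 because [S 0 = 0 < t] holds throughout []0, 1]]; thus the count is [k] on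
   []S k, S k.+1]]. *)
pose cnt (t : R) := (\sum_(1 <= j < M) (S j < t)%R)%N.
have cntE k t : (k < M)%N -> S k < t -> t <= S k.+1 -> cnt t = k.
  move=> kM kt tk; rewrite /cnt (@big_cat_nat _ _ _ k.+1)//=.
  rewrite [X in (X + _)%N](eq_big_nat _ _ (F2 := fun=> 1%N)); last first.
    by move=> j /andP[_ jk]; rewrite (le_lt_trans (Sh j k _) kt).
  rewrite [X in (_ + X)%N](eq_big_nat _ _ (F2 := fun=> 0%N)); last first.
    by move=> j /andP[kj _]; rewrite le_gtF ?(le_trans tk)// Sh.
  by rewrite !sum_nat_const_nat muln1 muln0 addn0 subn1.
exists (fun t => c * (cnt t)%:R); split=> [s t st|t|g K mg gK].
- rewrite ler_wpM2l// ler_nat; apply: leq_sum => j _.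
  by case: (ltP (S j) s) => // js; rewrite (lt_le_trans js st).
- rewrite mulr_ge0//= ler_wpM2l// ler_nat.
  apply: leq_trans (_ : \sum_(1 <= j < M) 1 <= M)%N; last by rewrite sum_nat_const_nat muln1 leq_subr.
  by apply: leq_sum => j _; case: (_ < _).
set f := fun t => _.
have mf : mfC f.
  apply: (mfC_comp mg); apply: measurable_funM; first exact: measurable_cst.
  apply: nondecreasing_measurable => // s t st; rewrite ler_nat; apply: leq_sum => j _.
  by case: (ltP (S j) s) => // js; rewrite (lt_le_trans js st).
have fK t : 0 < t <= 1 -> md (f t) <= K by move=> _; exact: gK.
rewrite -(cutI_unit mf fK).
have S1 k : (k <= M)%N -> S k <= 1 by move=> kM; rewrite -P1; exact: Sh.
suff h k : (k <= M)%N -> CInt U01 (cutI f 0 (S k)) = \sum_(j < k) (P j)%:C * g (c * j%:R).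
  by rewrite -h// /S P1.
elim: k => [|k ih] kM.
  by rewrite big_ord0 {1}/S big_ord0 CInt_cut0.
have Skk : S k <= S k.+1 by exact: Sh.
rewrite (CInt_cutD mf fK (S0 k) Skk) big_ord_recr/= ih 1?ltnW//; congr (_ + _).
apply: mdB_le0.
have := @CInt_cutI R f K (S k) (S k.+1) (g (c * k%:R)) 0 mf fK (S0 k) Skk (S1 _ kM).
rewrite {3}SS [S k + _]addrC addrK mul0r; apply=> y /andP[y1 y2].
by rewrite /f (cntE k)// subrr md0.
Qed.
End StepQuantile.
Lemma ccvgE (R : realType) (u : nat -> R[i]) (l : R[i]) : ccvg u l <->
  ((u : nat -> (R[i] : numFieldType)^o) @ \oo --> (l : (R[i] : numFieldType)^o)).
Proof.
split=> [h|/cvgrPdist_le h].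
  apply/cvgrPdist_le => e e0.
  have e1 : e = (Re e)%:C.
    by apply: complex_eq => //=; move: e0; rewrite ltcE => /andP[/eqP ->].
  have e2 : 0 < Re e by move: e0; rewrite ltcE => /andP[].
  have [N hN] := h _ e2; exists N => // n /= /hN; rewrite e1 normE lecR mdB.
  by [].
move=> e e0; have [|N _ hN] := h e%:C; first by rewrite ltcR.
by exists N => n /hN /=; rewrite normE lecR mdB.
Qed.
Section CcvgAlg.
Context {R : realType}.
Implicit Types (u v : nat -> R[i]) (a b : R[i]).
Lemma ccvgD u v a b : ccvg u a -> ccvg v b -> ccvg (fun n => u n + v n) (a + b).
Proof. by rewrite !ccvgE; exact: cvgD. Qed.
Lemma ccvgN u a : ccvg u a -> ccvg (fun n => - u n) (- a).
Proof. by rewrite !ccvgE; exact: cvgN. Qed.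
Lemma ccvgM u v a b : ccvg u a -> ccvg v b -> ccvg (fun n => u n * v n) (a * b).
Proof. by rewrite !ccvgE; exact: cvgM. Qed.
Lemma ccvgV u a : a != 0 -> ccvg u a -> ccvg (fun n => (u n)^-1) a^-1.
Proof. by move=> a0; rewrite !ccvgE; exact: cvgV. Qed.
Lemma ccvg_conj u a : ccvg u a -> ccvg (fun n => conjc (u n)) (conjc a).
Proof. by move=> h e /h[N hN]; exists N => n /hN; rewrite -md_conj rmorphB. Qed.
End CcvgAlg.

(** * The Herglotz representation on the disc *)

Section Herglotz.
Context {R : realType}.
Implicit Types (z w u : R[i]) (x y : R).

(** The circle kernel as a function of a real angle, so that measures on the circle can be given by
    monotone functions and [helly] applies. *)
Definition ker w x : R[i] := (1 - w * toC (wrapT x))^-1.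

Lemma md_wrapT x : md (toC (wrapT x) : R[i]) = 1.
Proof. by have /circleP := wrapT_circle x. Qed.
Lemma md_ker w x : md w < 1 -> md (ker w x) <= (1 - md w)^-1.
Proof. by move=> w1; apply: md_inv1 => //; exact: md_wrapT. Qed.
Lemma mfC_ker w : mfC (ker w).
Proof. by apply: (mfC_comp (mfC_Uc w)); exact: measurable_wrapT. Qed.

Lemma toC_wrapT_lip : exists L : R, forall x y,
  md (toC (wrapT y) - toC (wrapT x)) <= L * `|y - x|.
Proof.
exists ((1 + 8 * expR 1 * (1 + 1) * 1) + 2) => x y.
have L0 : 0 <= 1 + 8 * expR 1 * (1 + 1) * 1 :> R.
  by have := expR_gt0 (1 : R); lra.
have n0 := normr_ge0 (y - x).
have [d1|d1] := leP `|y - x| 1; last first.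
  apply: le_trans (mdD _ _) _; rewrite mdN !md_wrapT; nra.
rewrite !toC_wrapT.
have -> : - ('i * y%:C) = - ('i * x%:C) + - ('i * (y - x)%:C) :> R[i].
  by rewrite -opprD -mulrDr -rmorphD/= addrC subrK.
rewrite cexpD -[X in _ - X]mulr1 -mulrBr mdM -toC_wrapT md_wrapT mul1r.
have e : md (- ('i * (y - x)%:C) : R[i]) = `|y - x| by rewrite mdN mdM md_i mul1r mdC.
apply: le_trans (cexp_lip (B := 1) _) _; rewrite e//; nra.
Qed.

Lemma ker_lip w : md w < 1 -> exists L : R, forall x y, md (ker w y - ker w x) <= L * `|y - x|.
Proof.
move=> w1; have [L hL] := toC_wrapT_lip; pose b := (1 - md w)^-1; exists (L * b ^+ 2) => x y.
have b0 : 0 <= b by rewrite invr_ge0 subr_ge0 ltW.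
have h1 := sub1M_neq0 w1 (md_wrapT x); have h2 := sub1M_neq0 w1 (md_wrapT y).
have -> : ker w y - ker w x = w * (toC (wrapT y) - toC (wrapT x)) * (ker w y * ker w x).
  by rewrite /ker; field; rewrite h1 h2.
rewrite mdM (mdM (ker w y)) mdM.
have -> : L * b ^+ 2 * `|y - x| = L * `|y - x| * (b * b) by ring.
apply: ler_pM; rewrite ?mulr_ge0 ?md_ge0//.
  by apply: le_trans (hL x y); rewrite ler_piMl ?md_ge0// ltW.
by apply: ler_pM; rewrite ?md_ge0 ?md_ker.
Qed.

Lemma ker_ru w M j : ker w (2 * pi / M%:R * j%:R) = (1 - w * (ruN M j)^-1)^-1.
Proof. by rewrite /ker toC_wrapT cexpN /ruN [j%:R * _]mulrC. Qed.

Lemma ru1_cvg : (fun n => md (ruN n.+2 1 - 1 : R[i])) @ \oo --> 0.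
Proof.
pose L : R := (1 + 8 * expR (2 * pi) * (1 + 2 * pi) * (2 * pi)).
have p0 := pi_gt0 R.
have h n : 0 <= md (ruN n.+2 1 - 1 : R[i]) <= L * (2 * pi) * n.+2%:R^-1.
  rewrite md_ge0/= /ruN.
  have e : md ('i * (1%:R * (2 * pi / n.+2%:R))%:C : R[i]) = 2 * pi / n.+2%:R.
    by rewrite mdM md_i !mul1r mdC ger0_norm// divr_ge0// ltW// mulr_gt0.
  apply: le_trans (cexp_lip (B := 2 * pi) _) _; rewrite e; last by rewrite -[leRHS]mulrA.
  by rewrite ler_piMr ?invf_le1 ?ler1n// ltW// mulr_gt0.
apply: (squeeze_cvgr (f := fun=> 0) (h := fun n => L * (2 * pi) * n.+2%:R^-1)).
- by apply: nearW => n; exact: h.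
- exact: cvg_cst.
rewrite -[X in _ --> X](mulr0 (L * (2 * pi))); apply: cvgM; first exact: cvg_cst.
by have := @cvg_harmonic R; rewrite -cvg_shiftS.
Qed.

Lemma pow_ccvg w : md w < 1 -> ccvg (fun n => w ^+ n.+2) 0.
Proof.
move=> w1; apply: (@ccvg_le _ _ _ (fun n => md w ^+ n.+2)).
  by move=> n; rewrite subr0 mdX.
have := @cvg_expr R (md w); rewrite ger0_norm ?md_ge0// => /(_ w1) h.
by move: h; rewrite -(cvg_shiftn 2); under eq_fun do rewrite addn2.
Qed.

Lemma cauchy_ccvg (f f' : R[i] -> R[i]) w : c11 (udisc 1) (fun _ : unit => f) (fun=> f') ->
  md w < 1 -> ccvg (fun n => n.+2%:R^-1 * \sum_(j < n.+2) f (ruN n.+2 j) / (1 - w * (ruN n.+2 j)^-1)) (f w).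
Proof.
move=> [C C0 /(_ tt) hf] w1.
have h1 : ccvg (fun n => f w / (1 - w ^+ n.+2)) (f w).
  rewrite -[X in ccvg _ X]mulr1 -[X in ccvg _ (_ * X)]invr1 -[X in ccvg _ (_ * X^-1)](subr0 1).
  apply: ccvgM; first exact: ccvg_cst.
  apply: ccvgV; first by rewrite subr0 oner_eq0.
  apply: ccvgD; first exact: ccvg_cst.
  by apply: ccvgN; exact: pow_ccvg.
have h2 : ccvg (fun n => n.+2%:R^-1 * \sum_(j < n.+2) f (ruN n.+2 j) / (1 - w * (ruN n.+2 j)^-1) -
    f w / (1 - w ^+ n.+2)) 0.
  apply: (@ccvg_le _ _ _ (fun n => C * md (ruN n.+2 1 - 1 : R[i]))).
    by move=> n; rewrite subr0; exact: discrete_cauchy hf _ _.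
  by rewrite -(mulr0 C); apply: cvgM; [exact: cvg_cst|exact: ru1_cvg].
have := ccvgD h2 h1; rewrite add0r; apply: ccvg_eq => n.
by rewrite subrK.
Qed.

(** The discrete law has mass proportional to [Re h] at the roots of unity. Writing [2 Re h] as [h]
    plus its conjugate, the first part tends to [h w] and the second to [h 0 = 1]. The masses are
    divided by their sum, since the discrete mean of [Re h] is 1 only in the limit. *)
Lemma herglotz_closed (h h' : R[i] -> R[i]) :
  c11 (udisc 1) (fun _ : unit => h) (fun=> h') ->
  (forall z, udisc 1 z -> 0 < Re (h z)) -> h 0 = 1 ->
  exists Q : R -> R, [/\ {homo Q : s t / s <= t}, forall t, 0 <= Q t <= 2 * pi &
    forall w, md w < 1 -> CInt U01 (fun t => ker w (Q t)) = (h w + 1) / 2].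
Proof.
move=> hf h0 h1.
have S1 M j : udisc 1 (ruN M j : R[i]) by rewrite /udisc/= ru_md.
pose p n j := Re (h (ruN n.+2 j)).
have p0 n j : 0 < p n j by exact: h0.
pose s n := \sum_(j < n.+2) p n j.
have s0 n : 0 < s n by rewrite /s big_ord_recl ltr_pwDl// sumr_ge0// => j _; exact: ltW.
pose P n j := p n j / s n.
have P0 n j : 0 <= P n j by rewrite divr_ge0// ltW.
have P1 n : \sum_(j < n.+2) P n j = 1 by rewrite /P -mulr_suml -/(s n) divff ?gt_eqF.
have c0 n : 0 <= 2 * pi / n.+2%:R :> R by rewrite divr_ge0// mulr_ge0// pi_ge0.
have [Q_ hQ] := choice (fun n => step_quantile (P0 n) (P1 n) (c0 n)).
have [||Q [Qh Q2 Ql]] := @helly R Q_ (2 * pi).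
- by move=> n; have [] := hQ n.
- by move=> n t; have [_ /(_ t)] := hQ n; rewrite divfK// pnatr_eq0.
exists Q; split => // w w1.
have [L hL] := ker_lip w1.
apply: (Ql _ L (1 - md w)^-1) => [t|||]; [exact: md_ker|exact: mfC_ker|by move=> x y; exact: hL|].
have w1' : md (conjc w) < 1 by rewrite md_conj.
have A := cauchy_ccvg hf w1.
have z1 : md (0 : R[i]) < 1 by rewrite md0.
(* The conjugate of the sum with [conj h] is the Cauchy sum at the point [0] for this function,
   whose value there is [h 0]. *)
have hf2 : c11 (udisc 1) (fun _ : unit => fun z => h z * (1 - conjc w * z)^-1)
    (fun _ z => h' z * (1 - conjc w * z)^-1 + h z * (- (0 + - (0 * z + conjc w * 1)) / (1 - conjc w * z) ^+ 2)).
  apply: c11M => //; apply: (@c11V R unit _ (fun _ z => 1 - conjc w * z) _ (1 - md w)); first by rewrite subr_gt0.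
    move=> _ z z1'; apply: le_trans (md_sub1_ge _); rewrite lerD2l lerN2 mdM md_conj.
    by rewrite ler_piMr ?md_ge0.
  apply: c11D; first exact: (@c11_cst _ _ _ (fun=> 1) (md 1)).
  apply: c11N; apply: c11M; first exact: (@c11_cst _ _ _ (fun=> conjc w) (md (conjc w))).
  exact: (@c11_id _ _ _ 1).
have B := ccvg_conj (cauchy_ccvg hf2 z1).
have D := cauchy_ccvg hf z1.
rewrite mulr0 subr0 divr1 h1 in B; rewrite h1 in D.
have D' := ccvg_conj D.
have E := ccvgD D D'.
have c1 : conjc (1 : R[i]) = 1 by apply: complex_eq; rewrite !CE// oppr0.
rewrite c1 in B E.
have n2 : (1 + 1 : R[i]) != 0 by rewrite -[1 + 1]/(2%:R) pnatr_eq0.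
have := ccvgM (ccvgD A B) (ccvgV n2 E).
apply: ccvg_eq => n.
have [_ _ /(_ _ (1 - md w)^-1) ->] := hQ n; [|exact: mfC_ker|by move=> x; exact: md_ker].
have nR : n.+2%:R != 0 :> R[i] by rewrite pnatr_eq0.
have hc z : (Re z)%:C = (z + conjc z) / 2.
  apply: (canRL (@mulfK R[i] 2 _)); first by rewrite pnatr_eq0.
  by apply: complex_eq; rewrite !CE; lra.
have sR : (s n)%:C != 0 :> R[i] by rewrite -md_eq0 mdC normr_eq0 gt_eqF.
have e1 : n.+2%:R^-1 * (\sum_(j < n.+2) h (ruN n.+2 j) / (1 - w * (ruN n.+2 j)^-1)) +
    conjc (n.+2%:R^-1 * \sum_(j < n.+2) h (ruN n.+2 j) * (1 - conjc w * ruN n.+2 j)^-1 / (1 - 0 * (ruN n.+2 j)^-1))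
    = n.+2%:R^-1 * (2 * \sum_(j < n.+2) (p n j)%:C / (1 - w * (ruN n.+2 j)^-1)).
  have -> : forall a b : R[i], conjc (a * b) = conjc a * conjc b by move=> a b; exact: rmorphM.
  rewrite (_ : conjc (n.+2%:R^-1) = n.+2%:R^-1) ?fmorphV ?rmorph_nat//.
  rewrite -mulrDr conjc_sum; congr (_ * _); rewrite -big_split/= [RHS]mulr_sumr; apply: eq_bigr => j _.
  rewrite /p hc mul0r subr0 divr1.
  have -> : conjc (h (ruN n.+2 j) / (1 - conjc w * ruN n.+2 j)) =
      conjc (h (ruN n.+2 j)) / (1 - w * (ruN n.+2 j)^-1).
    rewrite -(md1_conj (ru_md _ _)) [LHS]rmorphM/= fmorphV/=; congr (_ / _).
    by rewrite rmorphB rmorphM rmorph1/= conjcK.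
  by rewrite -mulrDl [2 * _]mulrA mulrC [2 * _]mulrC divfK ?pnatr_eq0// mulrC.
have e2 : n.+2%:R^-1 * (\sum_(j < n.+2) h (ruN n.+2 j) / (1 - 0 * (ruN n.+2 j)^-1)) +
   conjc (n.+2%:R^-1 * (\sum_(j < n.+2) h (ruN n.+2 j) / (1 - 0 * (ruN n.+2 j)^-1)))
    = n.+2%:R^-1 * (2 * (s n)%:C).
  have -> : forall a b : R[i], conjc (a * b) = conjc a * conjc b by move=> a b; exact: rmorphM.
  rewrite (_ : conjc (n.+2%:R^-1) = n.+2%:R^-1) ?fmorphV ?rmorph_nat//.
  rewrite -mulrDr conjc_sum; congr (_ * _); rewrite -big_split/=.
  rewrite /s rmorph_sum mulr_sumr; apply: eq_bigr => j _.
  by rewrite /p /= hc mul0r subr0 divr1 mulrC divfK// pnatr_eq0.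
rewrite e1 e2.
have -> : \sum_(j < n.+2) (P n j)%:C * ker w (2 * pi / n.+2%:R * j%:R) =
   (\sum_(j < n.+2) (p n j)%:C / (1 - w * (ruN n.+2 j)^-1)) / (s n)%:C.
  rewrite mulr_suml; apply: eq_bigr => j _.
  by rewrite ker_ru /P rmorphM fmorphV/= mulrAC.
have fr (a b c : R[i]) : a != 0 -> c != 0 -> a^-1 * (2 * b) / (a^-1 * (2 * c)) = b / c.
  by move=> a0 c0'; field; rewrite a0 c0'.
exact: fr.
Qed.
End Herglotz.
Section HerglotzOpen.
Context {R : realType}.
Implicit Types (z w : R[i]).

(** The closed case applies to the dilations [h (r w)]; a second use of [helly] lets [r] tend to
    1. *)
Lemma herglotz (h h' : R[i] -> R[i]) :
  (forall r, 0 <= r < 1 -> c11 (udisc r) (fun _ : unit => h) (fun=> h')) ->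
  (forall z, md z < 1 -> 0 < Re (h z)) -> h 0 = 1 ->
  exists Q : R -> R, [/\ {homo Q : s t / s <= t}, forall t, 0 <= Q t <= 2 * pi &
    forall w, md w < 1 -> CInt U01 (fun t => ker w (Q t)) = (h w + 1) / 2].
Proof.
move=> hf h0 h1.
pose r n : R := 1 - n.+2%:R^-1.
have r1 n : 0 <= r n < 1.
  by rewrite /r subr_ge0 invf_le1// ler1n/= ltrBlDr ltrDl invr_gt0.
have rw n w : md w <= 1 -> md ((r n)%:C * w) <= r n.
  by have /andP[r0 _] := r1 n; move=> w1; rewrite mdM mdC ger0_norm// ler_piMr.
have : forall n, exists Q : R -> R, [/\ {homo Q : s t / s <= t}, forall t, 0 <= Q t <= 2 * pi &
    forall w, md w < 1 -> CInt U01 (fun t => ker w (Q t)) = (h ((r n)%:C * w) + 1) / 2].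
  move=> n; have /andP[r0 rl] := r1 n.
  apply: (@herglotz_closed R (fun w => h ((r n)%:C * w)) (fun w => h' ((r n)%:C * w) * (0 * w + (r n)%:C * 1))).
  - apply: (c11_comp (hf _ (r1 n))) => [|_ z z1]; last exact: rw.
    apply: c11M; first exact: (@c11_cst _ _ _ (fun=> (r n)%:C) (md (r n)%:C)).
    exact: (@c11_id _ _ _ 1).
  - by move=> z z1; apply: h0; apply: le_lt_trans (rw n _ z1) rl.
  - by rewrite mulr0.
move=> /choice[Q_ hQ].
have [||Q [Qh Q2 Ql]] := @helly R Q_ (2 * pi).
- by move=> n; have [] := hQ n.
- by move=> n t; have [_ /(_ t)] := hQ n.
exists Q; split => // w w1.
have [L hL] := ker_lip w1.
apply: (Ql _ L (1 - md w)^-1) => [t|||]; [exact: md_ker|exact: mfC_ker|by move=> x y; exact: hL|].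
apply: (ccvg_eq (u := fun n => (h ((r n)%:C * w) + 1) / 2)).
  by move=> n; have [_ _ /(_ w w1)] := hQ n.
apply: ccvgM; last exact: ccvg_cst.
apply: ccvgD; last exact: ccvg_cst.
have [|C C0 /(_ tt) hC] := hf (md w); first by rewrite md_ge0.
apply: (@ccvg_le _ _ _ (fun n => 2 * C * n.+2%:R^-1)).
  move=> n; have /andP[r0 rl] := r1 n.
  apply: le_trans (c11B_lip C0 hC _ _) _; rewrite /udisc/=//.
    by rewrite mdM mdC ger0_norm// ler_piMl ?md_ge0// ltW.
  rewrite -[X in _ - X]mul1r -mulrBl -(rmorph1 (@real_complex R)) -rmorphB mdM mdC.
  rewrite /r addrC addrA addNr add0r normrN ger0_norm ?invr_ge0//.
  by rewrite ler_wpM2l ?mulr_ge0// ler_piMr ?invr_ge0// ltW.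
rewrite -(mulr0 (2 * C)); apply: cvgM; first exact: cvg_cst.
by have := @cvg_harmonic R; rewrite -cvg_shiftS.
Qed.
End HerglotzOpen.

(** * Parameter integrals, lower bounds and logarithms *)

Section C11Integral.
Context d {T : measurableType d} {R : realType} (P : probability T R).
Variable D : set T.
Hypotheses (mD : measurable D) (PD : P D = 1%E).
Implicit Types (S : set R[i]).

(** Differentiation under the integral without a limit: the remainder estimate is uniform in the
    parameter and is integrated as it stands. The subtype index restricts it to the full set [D]. *)
Lemma c11_CInt S (F F' : T -> R[i] -> R[i]) :
  (forall z, S z -> mfC (F ^~ z)) -> (forall z, S z -> mfC (F' ^~ z)) ->
  c11 S (fun x : {x | D x} => F (sval x)) (fun x => F' (sval x)) ->
  c11 S (fun _ : unit => fun z => CInt P (F ^~ z)) (fun _ z => CInt P (F' ^~ z)).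
Proof.
move=> mF mF' [C C0 h]; exists C => // _ z Sz.
have hx x : D x -> c11B C S (F x) (F' x) by move=> Dx; exact: (h (exist _ x Dx)).
have iF u : S u -> ibl P (F ^~ u).
  by move=> Su; apply: (ibl_bdd mD PD (M := C)); [auto|move=> x /hx /(_ _ Su) []].
have iF' u : S u -> ibl P (F' ^~ u).
  by move=> Su; apply: (ibl_bdd mD PD (M := C)); [auto|move=> x /hx /(_ _ Su) []].
split; [|apply: (md_CInt mD PD); first exact: iF'|].
- by apply: (md_CInt mD PD); [exact: iF|move=> x /hx /(_ _ Sz)[]].
- by move=> x /hx /(_ _ Sz)[].
move=> u Su.
have i1 : ibl P (fun x => F x z - F x u) by apply: iblB; exact: iF.
have i2 : ibl P (fun x => (z - u) * F' x u) by apply: iblZ; exact: iF'.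
have -> : CInt P (F ^~ z) - CInt P (F ^~ u) - CInt P (F' ^~ u) * (z - u) =
    CInt P (fun x => F x z - F x u - (z - u) * F' x u).
  rewrite CIntB// CIntB ?CIntZ//; [|exact: iF'|exact: iF|exact: iF].
  by rewrite [_ * (z - u)]mulrC.
apply: (md_CInt mD PD); first exact: iblB.
by move=> x /hx /(_ _ Sz)[_ _ /(_ _ Su)]; rewrite [_ * (z - u)]mulrC.
Qed.
End C11Integral.

Section Lipschitz.
Context {R : realType}.

Lemma mfC_lip (f : R -> R[i]) L : (forall x y, md (f y - f x) <= L * `|y - x|) -> mfC f.
Proof.
move=> fL.
have h (g : R -> R) : (forall x y, `|g y - g x| <= L * `|y - x|) -> measurable_fun setT g.
  move=> gL; apply: continuous_measurable_fun => x.
  apply/cvgrPdist_le => e e0.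
  have L1 : 0 < `|L| + 1 by rewrite ltr_wpDl.
  near=> y.
  apply: le_trans (gL y x) _.
  apply: (@le_trans _ _ ((`|L| + 1) * `|x - y|)).
    by rewrite ler_wpM2r//; have := ler_norm L; lra.
  rewrite mulrC -ler_pdivlMr//.
  by near: y; apply: cvgr_dist_le => //; rewrite divr_gt0.
split; apply: h => x y; apply: le_trans (fL x y).
  by rewrite -ReN -ReD; exact: Re_le_md.
by rewrite -ImN -ImD; exact: Im_le_md.
Unshelve. all: by end_near. Qed.

Definition clamp (t : R) : R := Num.max 0 (Num.min t 1).
Lemma clamp_itv t : 0 <= clamp t <= 1.
Proof. by rewrite /clamp le_max lexx/= ge_max ler01 ge_min lexx orbT. Qed.
Lemma clampE t : 0 <= t -> t <= 1 -> clamp t = t.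
Proof. by move=> t0 t1; rewrite /clamp min_l// max_r. Qed.
Lemma clamp_lip s t : `|clamp t - clamp s| <= `|t - s|.
Proof.
rewrite /clamp /Num.max /Num.min /Order.max /Order.min.
by do ?case: ifPn; rewrite -?leNgt => *; rewrite ler_norml; apply/andP; split;
  have := ler_norm (t - s); have := ler_norm (- (t - s)); rewrite normrN; lra.
Qed.
Lemma md_clamp z t : md ((clamp t)%:C * z) <= md z.
Proof.
have /andP[c0 c1] := clamp_itv t.
by rewrite mdM mdC ger0_norm// ler_piMl ?md_ge0.
Qed.

(** Otherwise points with [|f| <= 1 / n.+1] would accumulate, along the ultrafilter and coordinate
    by coordinate, at a zero of [f] in the closed disc. *)
Lemma lip_lower_bound C r (f : R[i] -> R[i]) : 0 <= C ->
  (forall z u, udisc r z -> udisc r u -> md (f z - f u) <= C * md (z - u)) ->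
  (forall z, udisc r z -> f z != 0) -> exists2 c, 0 < c & forall z, udisc r z -> c <= md (f z).
Proof.
move=> C0 hf f0; apply: contrapT => hn.
have : forall n : nat, exists z, udisc r z /\ md (f z) <= n.+1%:R^-1.
  move=> n; apply: contrapT => hz; apply: hn; exists n.+1%:R^-1; first by rewrite invr_gt0.
  by move=> z rz; rewrite leNgt; apply/negP => h; apply: hz; exists z; split=> //; exact: ltW.
move=> /choice[z hz].
have zb n : - r <= Re (z n) <= r /\ - r <= Im (z n) <= r.
  have [zr _] := hz n; rewrite -!ler_norml.
  by split; apply: le_trans zr; [exact: Re_le_md|exact: Im_le_md].
have [G GP [Gn Gl]] := @ultralimit R.
have [a _ ha] := Gl _ _ _ (fun n => (zb n).1).
have [b _ hb] := Gl _ _ _ (fun n => (zb n).2).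
have near e : 0 < e -> forall N, exists2 n, (N <= n)%N & md (z n - (a +i* b)) <= 2 * e.
  move=> e0 N; have [n [/= Nn [/= h1 h2]]] := filter_ex (filterI (Gn N) (filterI (ha e e0) (hb e e0))).
  exists n => //; apply: le_trans (md_le _) _; rewrite ReD ImD ReN ImN /=; lra.
have zr : udisc r (a +i* b).
  rewrite /udisc/= -subr_le0; apply: (@le0_divn R _ 2) => N N0.
  have [|n _ hn'] := near N%:R^-1 _ 0%N; first by rewrite invr_gt0 ltr0n.
  have [zr _] := hz n; have := md_sub (a +i* b) (z n); rewrite mdB.
  by move: zr; rewrite /udisc/=; lra.
have := f0 _ zr; rewrite -md_gt0 ltNge => /negP; apply.
apply: (@le0_divn R _ (1 + 2 * C)) => N N0.
have [|n Nn hn'] := near N%:R^-1 _ N; first by rewrite invr_gt0 ltr0n.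
have [zr' fz] := hz n.
have l := hf _ _ zr' zr; have := md_sub (f (a +i* b)) (f (z n)); rewrite mdB.
have e1 : n.+1%:R^-1 <= N%:R^-1 :> R.
  by rewrite lef_pV2 ?posrE ?ltr0n// ler_nat (leq_trans Nn).
have e2 : C * md (z n - (a +i* b)) <= C * (2 * N%:R^-1) by rewrite ler_wpM2l.
have -> : (1 + 2 * C) / N%:R = N%:R^-1 + C * (2 * N%:R^-1) by ring.
rewrite lerBlDr => k; apply: le_trans k _.
by rewrite addrC lerD//; [exact: le_trans fz e1|exact: le_trans l e2].
Qed.
End Lipschitz.
Section Logarithm.
Context {R : realType}.
Implicit Types (z w : R[i]).

(* The logarithm is obtained by integrating [q' / q] along rays; the clamp only makes
   the integrand globally measurable. *)
Lemma c11_log (q q1 q2 : R[i] -> R[i]) :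
  (forall r, 0 <= r < 1 -> c11 (udisc r) (fun _ : unit => q) (fun=> q1)) ->
  (forall r, 0 <= r < 1 -> c11 (udisc r) (fun _ : unit => q1) (fun=> q2)) ->
  (forall z, md z < 1 -> q z != 0) ->
  exists l l' : R[i] -> R[i],
    (forall r, 0 <= r < 1 -> c11 (udisc r) (fun _ : unit => l) (fun=> l')) /\
    forall z, md z < 1 -> cexp (l z) = q z.
Proof.
move=> hq hq1 q0.
have lb r : 0 <= r < 1 -> exists2 c, 0 < c & forall z, udisc r z -> c <= md (q z).
  move=> r01; have [C C0 /(_ tt) hC] := hq r r01; have /andP[_ r1] := r01.
  apply: (@lip_lower_bound _ (2 * C)) => [|z u zr ur|z zr]; first exact: mulr_ge0.
    exact: c11B_lip hC _ _.
  by apply: q0; exact: le_lt_trans r1.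
pose g z := q1 z / q z.
pose g' z := q2 z * (q z)^-1 + q1 z * (- q1 z / q z ^+ 2).
have hg r : 0 <= r < 1 -> c11 (udisc r) (fun _ : unit => g) (fun=> g').
  move=> r01; have [c c0 hc] := lb r r01.
  by apply: c11M; [exact: hq1|apply: (c11V c0) => //; exact: hq].
have hcl r : 0 <= r < 1 -> c11 (udisc r) (fun t z => (clamp t)%:C * z : R[i]) (fun t z => 0 * z + (clamp t)%:C * 1).
  move=> /andP[r0 r1]; apply: c11M; last exact: (@c11_id _ _ _ r).
  apply: (@c11_cst _ _ _ (fun t : R => (clamp t)%:C) 1) => t.
  by have /andP[? ?] := clamp_itv t; rewrite mdC ger0_norm.
have clr r t z : udisc r z -> udisc r ((clamp t)%:C * z).
  by move=> zr; apply: le_trans (md_clamp _ _) zr.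
have hgt r : 0 <= r < 1 -> c11 (udisc r) (fun t z => g ((clamp t)%:C * z))
    (fun t z => g' ((clamp t)%:C * z) * (0 * z + (clamp t)%:C * 1)).
  by move=> r01; apply: c11_comp (hg r r01) (hcl r r01) _ => t z; exact: clr.
have lipC z s t : md ((clamp t)%:C * z - (clamp s)%:C * z) <= md z * `|t - s|.
  by rewrite -mulrBl -rmorphB mdM mdC mulrC ler_wpM2l ?md_ge0// clamp_lip.
have mdr z : md z < 1 -> 0 <= md z < 1 by rewrite md_ge0.
have mg z : md z < 1 -> mfC (fun t => g ((clamp t)%:C * z)).
  move=> z1; have [C C0 /(_ tt) hC] := hg _ (mdr z z1).
  apply: (@mfC_lip _ _ (2 * C * md z)) => s t.
  apply: le_trans (c11B_lip C0 hC (clr _ _ _ (lexx _)) (clr _ _ _ (lexx _))) _.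
  by rewrite -[leRHS]mulrA ler_wpM2l ?mulr_ge0.
have mcl : mfC (fun t : R => (clamp t)%:C : R[i]).
  by apply: (@mfC_lip _ _ 1) => s t; rewrite -rmorphB mdC mul1r clamp_lip.
have mg' z : md z < 1 -> mfC (fun t => g' ((clamp t)%:C * z) * (0 * z + (clamp t)%:C * 1)).
  move=> z1; have [C C0 /(_ tt) hC] := hg _ (mdr z z1); apply: mfCM.
    apply: (@mfC_lip _ _ (2 * C * md z)) => s t.
    apply: le_trans (c11B_lip' hC (clr _ _ _ (lexx _)) (clr _ _ _ (lexx _))) _.
    by rewrite -[leRHS]mulrA ler_wpM2l ?mulr_ge0.
  by under eq_fun do rewrite mul0r add0r mulr1.
have z00 : md (0 : R[i]) < 1 by rewrite md0.
have [c0 hc0] := cexp_surj (q0 0 z00).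
pose L z := CInt U01 (fun t => g ((clamp t)%:C * z)).
pose L' z := CInt U01 (fun t => g' ((clamp t)%:C * z) * (0 * z + (clamp t)%:C * 1)).
have hL r : 0 <= r < 1 -> c11 (udisc r) (fun _ : unit => L) (fun=> L').
  move=> r01; have /andP[_ r1] := r01.
  apply: (c11_CInt measurableT (probability_setT U01)) => [z zr|z zr|].
  - by apply: mg; exact: le_lt_trans r1.
  - by apply: mg'; exact: le_lt_trans r1.
  - exact: (c11_reindex sval (hgt r r01)).
exists (fun z => c0 + z * L z), (fun z => 0 + (1 * L z + z * L' z)); split=> [r r01|z z1].
  apply: c11D; first exact: (@c11_cst _ _ _ (fun=> c0) (md c0)).
  by apply: c11M; [exact: (@c11_id _ _ _ r)|exact: hL].
pose f s := g ((clamp s)%:C * z).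
have [Cq Cq0 /(_ tt) hCq] := hq _ (mdr z z1).
have [Cg Cg0 /(_ tt) hCg] := hg _ (mdr z z1).
have mf : mfC f by exact: mg.
have fC s : 0 < s <= 1 -> md (f s) <= Cg.
  by move=> _; have [] := hCg _ (clr _ s _ (lexx _)).
pose lam t := c0 + z * CInt U01 (cutI f 0 t).
(* Formally the derivative of [phi] is [z (q1 - g q) e^{- lam} = 0], by the choice of [g]; at
   [t = 0] its value is 1, as [c0] is a logarithm of [q 0]. *)
pose phi t := q (t%:C * z) * cexp (- lam t).
have lam0 : lam 0 = c0 by rewrite /lam CInt_cut0 mulr0 addr0.
have lam1 : lam 1 = c0 + z * L z by rewrite /lam (cutI_unit mf fC).
suff phi1 : phi 1 = phi 0.
  move: phi1; rewrite /phi lam0 lam1 mul0r mul1r -hc0 -cexpD subrr cexp0 cexpN => e.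
  by rewrite -[LHS]mul1r -e divfK ?cexp_neq0.
apply: mdB_le0.
pose K := 8 * expR (3 * Cg) * (1 + 3 * Cg).
have K0 : 0 <= K by rewrite /K !mulr_ge0 ?expR_ge0// addr_ge0// mulr_ge0.
pose B := Cq * (K * (3 * Cg) ^+ 2) + (Cq + 2 * Cg * Cq + 3 * Cg * (2 * Cq)).
apply: (@quad_telescope _ _ _ (expR (md c0 + Cg) * B)) => s t s0 st t1.
have s1 := le_trans st t1; have t0 := le_trans s0 st.
have d0 : 0 <= t - s by rewrite subr_ge0.
have d1 : t - s <= 1 by lra.
have usc x : 0 <= x -> x <= 1 -> udisc (md z) (x%:C * z).
  by move=> x0 x1; rewrite /udisc/= mdM mdC ger0_norm// ler_piMl ?md_ge0.
have ut := usc t t0 t1; have us := usc s s0 s1.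
pose E1 := z * (CInt U01 (cutI f s t) - (t - s)%:C * g (s%:C * z)).
pose del := lam t - lam s.
have delE : del = (t - s)%:C * z * g (s%:C * z) + E1.
  by rewrite /del /lam /E1 (CInt_cutD mf fC s0 st); ring.
have hE1 : md E1 <= 2 * Cg * (t - s) ^+ 2.
  rewrite /E1 mdM; apply: le_trans (ler_piMl (md_ge0 _) (ltW z1)) _.
  have -> : 2 * Cg * (t - s) ^+ 2 = 2 * Cg * (t - s) * (t - s) by ring.
  apply: (CInt_cutI mf fC s0 st t1) => x /andP[sx xt].
  have x0 : 0 <= x by exact: le_trans (ltW sx).
  have x1 : x <= 1 by exact: le_trans t1.
  rewrite /f clampE//; apply: le_trans (c11B_lip Cg0 hCg (usc _ x0 x1) us) _.
  rewrite ler_wpM2l ?mulr_ge0// -mulrBl -rmorphB mdM mdC ger0_norm ?subr_ge0 ?(ltW sx)//.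
  by apply: le_trans (ler_piMr _ (ltW z1)) _; rewrite ?subr_ge0 ?(ltW sx)// lerD2r.
have [qs q1s _] := hCq _ us; have [qt _ /(_ _ us) hE3] := hCq _ ut.
have [gs _ _] := hCg _ us.
have e3 : t%:C * z - s%:C * z = (t - s)%:C * z by rewrite rmorphB; ring.
have mdz : md ((t - s)%:C * z) <= t - s.
  by rewrite mdM mdC ger0_norm// ler_piMr// ltW.
have hdel : md del <= 3 * Cg * (t - s).
  rewrite delE; apply: le_trans (mdD _ _) _; rewrite mdM.
  have : md ((t - s)%:C * z) * md (g (s%:C * z)) <= (t - s) * Cg by rewrite ler_pM ?md_ge0.
  have : 2 * Cg * (t - s) ^+ 2 <= 2 * Cg * (t - s).
    by rewrite ler_wpM2l ?mulr_ge0// expr2 ler_piMr.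
  lra.
have hE2 : md (cexp (- del) - 1 + del) <= K * (3 * Cg) ^+ 2 * (t - s) ^+ 2.
  have d3 : md (- del) <= 3 * Cg.
    by rewrite mdN; apply: le_trans hdel _; rewrite ler_piMr// mulr_ge0.
  have := cexp_quad d3; rewrite opprK mdN -/K => h; apply: le_trans h _.
  by rewrite -mulrA ler_wpM2l// -exprMn lerXn2r ?nnegrE ?md_ge0// mulr_ge0// mulr_ge0.
have hq2 : md (q (t%:C * z) - q (s%:C * z)) <= 2 * Cq * (t - s).
  apply: le_trans (c11B_lip Cq0 hCq ut us) _.
  by rewrite e3 ler_wpM2l// mulr_ge0.
have hE3' : md (q (t%:C * z) - q (s%:C * z) - q1 (s%:C * z) * ((t - s)%:C * z)) <= Cq * (t - s) ^+ 2.
  rewrite -e3; apply: le_trans hE3 _; rewrite ler_wpM2l// e3.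
  by rewrite lerXn2r ?nnegrE ?md_ge0.
rewrite mul0r add0r.
have -> : phi t - phi s = cexp (- lam s) * (q (t%:C * z) * (cexp (- del) - 1 + del) +
   ((q (t%:C * z) - q (s%:C * z) - q1 (s%:C * z) * ((t - s)%:C * z)) - E1 * q (s%:C * z)
    - del * (q (t%:C * z) - q (s%:C * z)))).
  rewrite /phi (_ : - lam t = - lam s + - del) ?cexpD; last by rewrite /del; ring.
  have gq : q1 (s%:C * z) = g (s%:C * z) * q (s%:C * z).
    by rewrite /g divfK// q0//; exact: le_lt_trans us z1.
  by rewrite {1}gq delE; ring.
have lams : md (cexp (- lam s)) <= expR (md c0 + Cg).
  rewrite md_cexp ler_expR; apply: le_trans (Re_le _) _; rewrite mdN.
  apply: le_trans (mdD _ _) _; rewrite lerD2l mdM.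
  apply: le_trans (ler_piMl (md_ge0 _) (ltW z1)) _.
  have := @CInt_cutI R f Cg 0 s 0 Cg mf fC (lexx _) s0 s1; rewrite mulr0 !subr0 => h.
  apply: le_trans (h _) _; last by rewrite ler_piMr.
  by move=> x /andP[x0 xs]; rewrite subr0; apply: fC; rewrite x0/= (le_trans xs).
rewrite mdM -mulrA; apply: ler_pM; rewrite ?md_ge0//.
apply: le_trans (mdD _ _) _; rewrite mdM.
have k1 : md (q (t%:C * z)) * md (cexp (- del) - 1 + del) <= Cq * (K * (3 * Cg) ^+ 2 * (t - s) ^+ 2).
  by rewrite ler_pM ?md_ge0.
have k2 : md (E1 * q (s%:C * z)) <= 2 * Cg * (t - s) ^+ 2 * Cq by rewrite mdM ler_pM ?md_ge0.
have k3 : md (del * (q (t%:C * z) - q (s%:C * z))) <= 3 * Cg * (t - s) * (2 * Cq * (t - s)).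
  by rewrite mdM ler_pM ?md_ge0.
have -> : B * (t - s) ^+ 2 = Cq * (K * (3 * Cg) ^+ 2 * (t - s) ^+ 2) +
   (Cq * (t - s) ^+ 2 + 2 * Cg * (t - s) ^+ 2 * Cq + 3 * Cg * (t - s) * (2 * Cq * (t - s))).
  by rewrite /B; ring.
apply: lerD => //; apply: le_trans (mdD _ _) _; rewrite mdN; apply: lerD => //.
by apply: le_trans (mdD _ _) _; rewrite mdN; exact: lerD.
Qed.
End Logarithm.

(** * Regularity of the quotient [eta z / z] *)

Section DiscFunctions.
Context {R : realType}.
Implicit Types (z w : R[i]).

(** A family that contains the kernels of [Uc] and [Vc] and is closed under differentiation in [z]
    up to the factor [j]. *)
Definition kerm (m j : nat) (p : R * R) z : R[i] := toC p ^+ m * (1 - z * toC p)^-1 ^+ j.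

Lemma c11_kerm m j r : 0 <= r < 1 ->
  c11 (udisc r) (fun p : {p | @circle R p} => kerm m j (sval p))
    (fun p z => j%:R * kerm m.+1 j.+1 (sval p) z).
Proof.
move=> /andP[r0 r1].
have ctoC (p : {p | @circle R p}) : md (toC (sval p)) <= 1.
  by case: p => p /= /circleP ->.
have hk : c11 (udisc r) (fun (p : {p | @circle R p}) z => (1 - z * toC (sval p))^-1)
    (fun p => kerm 1 2 (sval p)).
  have := @c11V R {p | @circle R p} (udisc r) (fun p z => 1 - z * toC (sval p))
    (fun p z => 0 + - (1 * toC (sval p) + z * 0)) (1 - r).
  move=> /(_ _ _ _) h; apply: c11_eq (h _ _ _) => // [p z zr|||].
  - by rewrite /kerm mul1r mulr0 addr0 add0r opprK expr1 exprVn.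
  - by rewrite subr_gt0.
  - case=> p /circleP p1 z zr /=; apply: le_trans (md_sub1_ge _).
    by rewrite lerD2l lerN2 mdM p1 mulr1.
  apply: c11D; first exact: (@c11_cst _ _ _ (fun=> 1) (md 1)).
  apply: c11N; apply: c11M; first exact: (@c11_id _ _ _ r).
  exact: (@c11_cst _ _ _ (fun p : {p | @circle R p} => toC (sval p)) 1).
have hm : c11 (udisc r) (fun (p : {p | @circle R p}) (_ : R[i]) => toC (sval p) ^+ m) (fun _ _ => 0).
  apply: (@c11_cst _ _ _ (fun p : {p | @circle R p} => toC (sval p) ^+ m) 1) => p.
  by rewrite mdX exprn_ile1 ?md_ge0.
elim: j => [|j ih].
  by apply: c11_eq hm => p z zr; rewrite /kerm ?expr0 ?mulr1 ?mul0r.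
apply: c11_eq (c11M ih hk) => p z zr; rewrite /kerm.
  by rewrite -mulrA -exprSr.
by rewrite !exprS !expr0 -natr1; ring.
Qed.

Lemma mfC_kerm m j z : mfC (kerm m j ^~ z).
Proof.
have hX (f : R * R -> R[i]) n : mfC f -> mfC (fun p => f p ^+ n).
  move=> mf; elim: n => [|n ih]; first exact: mfC_cst.
  by under eq_fun do rewrite exprS; exact: mfCM.
by apply: mfCM; [apply: hX; exact: mfC_toC|apply: hX; exact: mfC_Uc].
Qed.

Variable nu : probability (R * R)%type R.
Hypothesis nuC : nu (@circle R) = 1%E.

Definition Ikerm m j z := CInt nu (kerm m j ^~ z).

Lemma c11_Ikerm m j r : 0 <= r < 1 ->
  c11 (udisc r) (fun _ : unit => Ikerm m j) (fun _ z => j%:R * Ikerm m.+1 j.+1 z).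
Proof.
move=> r01; have /andP[r0 r1] := r01.
have h : c11 (udisc r) (fun _ : unit => Ikerm m j)
    (fun _ z => CInt nu (fun p => j%:R * kerm m.+1 j.+1 p z)).
  apply: (c11_CInt measurable_circle nuC (F' := fun p z => j%:R * kerm m.+1 j.+1 p z)) => [z _|z _|].
  - exact: mfC_kerm.
  - by apply: mfCM; [exact: mfC_cst|exact: mfC_kerm].
  - exact: c11_kerm.
apply: c11_eq h => // _ z zr; rewrite CIntZ//.
have [C C0 hC] := c11_kerm m.+1 j.+1 r01.
apply: (ibl_bdd measurable_circle nuC (M := C)) => [|p p1]; first exact: mfC_kerm.
by have [] := hC (exist _ p p1) z zr.
Qed.

Lemma Uc_Ikerm z : Uc nu z = Ikerm 0 1 z.
Proof. by rewrite /Uc /Ikerm; congr CInt; apply/funext => p; rewrite /kerm expr0 mul1r expr1. Qed.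
Lemma Vc_Ikerm z : Vc nu z = Ikerm 1 1 z.
Proof. by rewrite /Vc /Ikerm; congr CInt; apply/funext => p; rewrite /kerm !expr1. Qed.

(** Two derivatives are provided because [c11_log] needs the quadratic remainder for [q1 / q].
    Division by [Uc] is safe by [Uc_lower]. *)
Lemma c11_quotient : exists q1 q2 : R[i] -> R[i],
  (forall r, 0 <= r < 1 -> c11 (udisc r) (fun _ : unit => fun z => Vc nu z / Uc nu z) (fun=> q1)) /\
  (forall r, 0 <= r < 1 -> c11 (udisc r) (fun _ : unit => q1) (fun=> q2)).
Proof.
have hV m j r (r01 : 0 <= r < 1) := @c11_Ikerm m j r r01.
have hi r : 0 <= r < 1 -> c11 (udisc r) (fun _ : unit => fun z => (Ikerm 0 1 z)^-1)
    (fun _ z => - (1%:R * Ikerm 1 2 z) / Ikerm 0 1 z ^+ 2).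
  move=> r01; have /andP[_ r1] := r01.
  apply: (@c11V _ unit _ (fun=> Ikerm 0 1) _ 2^-1) => //; last exact: hV.
  move=> _ z zr; rewrite -Uc_Ikerm -div1r; apply: Uc_lower => //; exact: le_lt_trans r1.
pose q1 z := 1%:R * Ikerm 2 2 z * (Ikerm 0 1 z)^-1 +
  Ikerm 1 1 z * (- (1%:R * Ikerm 1 2 z) / Ikerm 0 1 z ^+ 2).
have hq r : 0 <= r < 1 -> c11 (udisc r) (fun _ : unit => fun z => Vc nu z / Uc nu z) (fun=> q1).
  move=> r01; apply: c11_eq (c11M (hV 1%N 1%N r r01) (hi r r01)) => // _ z _.
  by rewrite Uc_Ikerm Vc_Ikerm.
suff [q2 hq2] : exists q2, forall r, 0 <= r < 1 -> c11 (udisc r) (fun _ : unit => q1) q2.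
  by exists q1, (q2 tt); split=> // r r01; exact: (c11_reindex (fun _ : unit => tt) (hq2 r r01)).
have h1 (r : R) : c11 (udisc r) (fun (_ : unit) (_ : R[i]) => 1%:R) (fun _ _ => 0).
  exact: (@c11_cst _ _ _ (fun=> 1%:R) (md 1%:R)).
eexists => r r01.
rewrite /q1; apply: c11D.
  apply: c11M; last exact: hi.
  by apply: c11M; [exact: h1|exact: hV].
apply: c11M; first exact: hV.
apply: (@c11_eq _ unit _ (fun _ z => - (1%:R * Ikerm 1 2 z) * ((Ikerm 0 1 z)^-1 * (Ikerm 0 1 z)^-1))).
- by move=> _ z _; rewrite -exprVn expr2.
- by [].
apply: c11M; last by apply: c11M; exact: hi.
by apply: c11N; apply: c11M; [exact: h1|exact: hV].
Qed.
End DiscFunctions.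

(** * The Herglotz function attached to a logarithm *)

Section Surjectivity.
Context {R : realType}.
Implicit Types (z w : R[i]).

Lemma full_eq d (T : measurableType d) (P : probability T R) (D A B : set T) :
  measurable D -> P D = 1%E -> measurable A -> measurable B -> A `&` D = B `&` D -> P A = P B.
Proof.
move=> mD PD mA mB AB.
have h X : measurable X -> P X = P (X `&` D).
  move=> mX; rewrite -[in LHS](setIT X) -(setUv D) setIUr measureU0//.
  - exact: measurableI.
  - by apply: measurableI => //; exact: measurableC.
  - apply: (@subset_measure0 _ _ _ P _ (~` D)); last exact: full_setC.
    + by apply: measurableI => //; exact: measurableC.
    + exact: measurableC.
    + exact: subIsetr.
by rewrite h// AB -h.
Qed.

Lemma expRN_lt1 (x : R) : 0 < x -> 0 <= expR (- x) < 1.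
Proof. by move=> x0; rewrite expR_ge0/= -expR0 ltr_expR oppr_lt0. Qed.

(** For [z = x + iy] and [w = a + ib] the numerator over [|w|^2] is [y (a - x)^2 + (b - y) x^2 + b y
    (b - y) + b]; [y <= b] makes the first three terms nonnegative and the last gives strictness. *)
Lemma herglotz_Re_gt0 z w : 0 < Im z -> Im z <= Im w ->
  0 < Re ('i * ((z ^+ 2 + 1) / w - z)).
Proof.
move=> z0 zw; have w0 := lt_le_trans z0 zw.
have m0 : 0 < md w ^+ 2 by rewrite exprn_gt0// md_gt0 upper_neq0.
have -> : Re ('i * ((z ^+ 2 + 1) / w - z)) =
  (Im z * md w ^+ 2 - (Im (z ^+ 2 + 1) * Re w - Re (z ^+ 2 + 1) * Im w)) / md w ^+ 2.
  rewrite Re_iM ImD ImN ImM inv_ReE inv_ImE; set m := md w ^+ 2 in m0 *.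
  by field; rewrite gt_eqF.
rewrite divr_gt0// md_sq expr2 !CE.
move: (Re z) (Im z) (Re w) (Im w) z0 zw w0 => x y a b y0 yb b0.
have -> : y * (a ^+ 2 + b ^+ 2) - ((x * y + y * x + 0) * a - (x * x - y * y + 1) * b) =
  y * (a - x) ^+ 2 + (b - y) * x ^+ 2 + b * y * (b - y) + b by ring.
have h1 : 0 <= y * (a - x) ^+ 2 by rewrite mulr_ge0 ?sqr_ge0 ?ltW.
have h2 : 0 <= (b - y) * x ^+ 2 by rewrite mulr_ge0 ?sqr_ge0 ?subr_ge0.
have h3 : 0 <= b * y * (b - y).
  by apply: mulr_ge0; [apply: mulr_ge0; exact: ltW|rewrite subr_ge0].
lra.
Qed.

Variables l l' : R[i] -> R[i].
Hypothesis hl : forall r, 0 <= r < 1 -> c11 (udisc r) (fun _ : unit => l) (fun=> l').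
Hypothesis lRe : forall w, md w < 1 -> w != 0 -> Re (l w) <= 0.

Definition Fl z := z - 'i * l (cexp ('i * z)).

Lemma Fl_Im z : 0 < Im z -> Im z <= Im (Fl z).
Proof.
move=> z0; rewrite /Fl ImD ImN Im_iM lerDl oppr_ge0 lRe ?cexp_neq0//.
exact: md_exp_lt1.
Qed.
Lemma Fl_neq0 z : 0 < Im z -> Fl z != 0.
Proof. by move=> z0; apply: upper_neq0; apply: lt_le_trans (Fl_Im z0). Qed.
Lemma Fl_period z : Fl (z + (2 * pi)%:C) = Fl z + (2 * pi)%:C.
Proof. by rewrite /Fl (mulrDr 'i z) cexpD cexp_2pi mulr1 addrAC. Qed.

(* The Herglotz function on the disc whose representing measure becomes, under the Cayley
   transform, the measure with Cauchy transform [1 / Fl]. *)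
Definition hl_ w := 'i * ((icayD w ^+ 2 + 1) / Fl (icayD w) - icayD w).

(** A quantitative distance from the real axis: it keeps [Fl] away from zero and [e^{iz}] in a disc
    of radius below 1, where the bounds on [l] hold. *)
Lemma icayD_lower r w : 0 <= r < 1 -> udisc r w -> (1 - r ^+ 2) / 4 <= Im (icayD w).
Proof.
move=> /andP[r0 r1] wr; have w1 : md w < 1 by exact: le_lt_trans r1.
have m0 : 0 < md (1 - w) by rewrite md_gt0 sub1_neq0.
have m2 : md (1 - w) <= 2.
  by apply: le_trans (mdD _ _) _; rewrite mdN md1; lra.
rewrite icayD_Im//; apply: ler_pM.
- by rewrite subr_ge0 expr_le1// ltW.
- by rewrite invr_ge0.
- by rewrite lerD2l lerN2 lerXn2r ?nnegrE ?md_ge0.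
- have -> : 4 = 2 ^+ 2 :> R by ring.
  by rewrite lef_pV2 ?posrE ?exprn_gt0// lerXn2r ?nnegrE ?md_ge0.
Qed.

Lemma c11_hl : exists h', forall r, 0 <= r < 1 -> c11 (udisc r) (fun _ : unit => hl_) (fun=> h').
Proof.
suff [h' hh] : exists h', forall r, 0 <= r < 1 -> c11 (udisc r) (fun _ : unit => hl_) h'.
  by exists (h' tt) => r r01; exact: (c11_reindex (fun _ : unit => tt) (hh r r01)).
have c1 (a : R[i]) r : c11 (udisc r) (fun (_ : unit) (_ : R[i]) => a) (fun _ _ => 0).
  exact: (@c11_cst _ _ _ (fun=> a) (md a)).
have cid r : c11 (udisc r) (fun (_ : unit) (z : R[i]) => z) (fun _ _ => 1) by exact: (@c11_id _ _ _ r).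
have [dz hz] : exists dz : unit -> R[i] -> R[i], forall r, 0 <= r < 1 -> c11 (udisc r) (fun _ : unit => @icayD R) dz.
  eexists => r r01; have /andP[r0 r1] := r01.
  apply: c11M; first by apply: c11M; [exact: c1|apply: c11D; [exact: c1|exact: cid]].
  apply: (@c11V _ _ _ (fun _ z => 1 - z) _ (1 - r)); rewrite ?subr_gt0//.
    by move=> _ z zr; apply: le_trans (md_sub1_ge _); rewrite lerD2l lerN2.
  by apply: c11D; [exact: c1|apply: c11N; exact: cid].
have [de he] : exists de, forall r, 0 <= r < 1 ->
    c11 (udisc r) (fun _ : unit => fun w => cexp ('i * icayD w)) de.
  eexists => r r01; have /andP[r0 r1] := r01.
  have hiz := c11M (c1 'i r) (hz r r01).
  have [C C0 hC] := hiz.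
  apply: (c11_comp (S' := udisc C) (c11_cexp (B := C) _) hiz) => //.
  by move=> [] w wr; have [] := hC tt w wr.
have [f' hf] : exists f', forall r, 0 <= r < 1 ->
    c11 (udisc r) (fun _ : unit => fun w => Fl (icayD w)) f'.
  eexists => r r01; have /andP[r0 r1] := r01.
  apply: c11D; first exact: hz.
  apply: c11N; apply: c11M; first exact: c1.
  have k0 : 0 < (1 - r ^+ 2) / 4 by rewrite divr_gt0// subr_gt0 expr_lt1.
  apply: (c11_comp (S' := udisc (expR (- ((1 - r ^+ 2) / 4)))) (hl _) (he r r01)).
    exact: expRN_lt1.
  move=> _ w wr; rewrite /udisc/= md_cexp ler_expR Re_iM lerN2.
  exact: icayD_lower.
eexists => r r01; have /andP[r0 r1] := r01.
rewrite /hl_; apply: c11M; first exact: c1.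
apply: c11D; last by apply: c11N; exact: hz.
apply: c11M.
  apply: c11D; last exact: c1.
  by under [X in c11 _ X]eq_fun do (under eq_fun do rewrite expr2); apply: c11M; exact: hz.
have k0 : 0 < (1 - r ^+ 2) / 4 by rewrite divr_gt0// subr_gt0 expr_lt1.
apply: (c11V k0); last exact: hf.
move=> _ w wr; have lo := icayD_lower r01 wr.
apply: le_trans (Im_le _); apply: le_trans lo (Fl_Im _).
exact: lt_le_trans k0 (icayD_lower r01 wr).
Qed.

Lemma hl_gt0 w : md w < 1 -> 0 < Re (hl_ w).
Proof.
move=> w1; have z0 := icayD_Im_gt0 w1.
by apply: herglotz_Re_gt0 => //; exact: Fl_Im.
Qed.
(** The centre of the disc corresponds to [z = i], where [z^2 + 1] vanishes: the normalisation holds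
    whatever [l] is. *)
Lemma hl_0 : hl_ 0 = 1.
Proof.
rewrite /hl_ (_ : icayD 0 = 'i); last by rewrite /icayD addr0 subr0 divr1 mulr1.
by rewrite expr2 ii addNr mul0r sub0r mulrN ii opprK.
Qed.
End Surjectivity.

(** * The representing measure has no atom at infinity *)

Section Nevanlinna.
Context {R : realType}.
Implicit Types (z w : R[i]).
Variables l l' : R[i] -> R[i].
Hypothesis hl : forall r, 0 <= r < 1 -> c11 (udisc r) (fun _ : unit => l) (fun=> l').
Hypothesis lRe : forall w, md w < 1 -> w != 0 -> Re (l w) <= 0.

Lemma cay_icay (p : R * R) : @circle R p -> p.1 != 1 -> cay (icay p) = p.
Proof.
case: p => a b; rewrite /circle /cay /icay/= => ab a1.
have a0 : 1 - a != 0 by rewrite subr_eq0 eq_sym.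
have e : (b / (1 - a)) ^+ 2 + 1 = 2 / (1 - a).
  have hb : b ^+ 2 = (1 - a) * (1 + a) by apply: (addrI (a ^+ 2)); rewrite ab; ring.
  by rewrite expr_div_n hb; field.
congr (_, _).
  have -> : (b / (1 - a)) ^+ 2 - 1 = 2 / (1 - a) - 2 by rewrite -e; ring.
  by rewrite e; field.
by rewrite e; field.
Qed.

Lemma nevanlinna_measure : exists nu : probability (R * R)%type R,
  nu (@circle R) = 1%E /\ forall w, md w < 1 -> Uc nu w = (hl_ l w + 1) / 2.
Proof.
have [h' hh] := c11_hl hl lRe.
have [Q [Qh _ hQ]] := herglotz hh (hl_gt0 lRe) (hl_0 l).
have mX : measurable_fun setT (fun t => wrapT (Q t) : R * R).
  by apply: (measurableT_comp measurable_wrapT); exact: nondecreasing_measurable.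
exists (push U01 mX); split.
  rewrite pushE (_ : _ @^-1` _ = setT); first exact: probability_setT.
  by apply/seteqP; split => // x _; exact: wrapT_circle.
move=> w w1; rewrite -hQ// /Uc (CInt_push mX (fun A _ => pushE U01 mX A) (mfC_Uc w))//.
apply: (ibl_bdd measurableT (probability_setT U01) (M := (1 - md w)^-1)).
  by apply: (mfC_comp (mfC_Uc w)); exact: mX.
by move=> t _; exact: md_ker.
Qed.

Section NoAtom.
Variable nu : probability (R * R)%type R.
Hypothesis nuC : nu (@circle R) = 1%E.
Hypothesis hU : forall w, md w < 1 -> Uc nu w = (hl_ l w + 1) / 2.

Definition pt1 : set (R * R) := [set (1, 0)].
Lemma measurable_pt1 : measurable pt1.
Proof.
rewrite (_ : pt1 = [set 1] `*` [set 0]); first by apply: measurableX; exact: measurable_set1.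
by apply/seteqP; split => [_ ->|[a b] /= [-> ->]].
Qed.

(** The function [(1 - s) Re (1 - s zeta)^-1] is 1 at [zeta = 1] and nonnegative on the circle, so
    it dominates the indicator of the point. *)
Lemma atom_bound (s : R) : 0 <= s -> s < 1 ->
  fine (nu pt1) <= (1 - s) * Re (Uc nu s%:C).
Proof.
move=> s0 s1; have ms : md (s%:C : R[i]) < 1 by rewrite mdC ger0_norm.
have [i1 i2] := ibl_Uc nuC ms.
have -> : fine (nu pt1) = RInt nu (\1_pt1 : R * R -> R).
  by rewrite /RInt integral_indic ?setIT//; exact: measurable_pt1.
rewrite /Uc Re_CInt -RIntZ//.
apply: (RInt_le measurable_circle nuC).
- apply: (integrable_bdd measurable_circle nuC (M := 1)).
    by apply: measurable_indic; exact: measurable_pt1.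
  by move=> x _; rewrite indicE; case: (_ \in _); rewrite ?normr1 ?normr0.
- exact: integrableZ_R.
move=> p pC; have p1 := circleP pC.
rewrite indicE; have [|_] := boolP (p \in pt1).
  rewrite inE => ->; have -> : toC (1, 0) = 1 :> R[i] by [].
  by rewrite mulr1 -(rmorph1 (@real_complex R)) -rmorphB -fmorphV/= mulfV// subr_eq0 gt_eqF.
rewrite inv_ReE mulr_ge0 ?subr_ge0 ?(ltW s1)// divr_ge0 ?sqr_ge0//.
rewrite ReD ReN Re1 subr_ge0; apply: le_trans (Re_le _) _.
by rewrite mdM p1 mulr1 ltW.
Qed.

(** Radial approach to 1 is [z = iy] with [y] large. There [Fl z = i (y - L)] with [L] bounded, so
    [hl_] is [(1 - y L) / (y - L)], which stays bounded, while the factor [1 - s] is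
    [2 / (y + 1)]. *)
Lemma no_atom : nu pt1 = 0%E.
Proof.
have [|K K0 /(_ tt) hK] := hl (r := expR (- 1)); first exact: expRN_lt1.
suff h : fine (nu pt1) <= 0.
  have fin := fin_num_measure nu _ measurable_pt1.
  rewrite -(fineK fin); congr EFin; apply/le_anti; rewrite h/= fine_ge0//.
apply: (@le0_divn R _ (3 + 2 * K)) => N N0.
have NR : 0 < N%:R :> R by rewrite ltr0n.
(* [y >= 2 K + 1] keeps [y - L] away from zero and gives the bound [2 + 2 K] on [hl_]; [y >= N]
   gives the final rate. *)
have [y yE] : exists y : R, y = N%:R + 2 * K + 1 by eexists.
have y1 : 1 <= y by rewrite yE; lra.
pose s : R := (y - 1) / (y + 1).
have s0 : 0 <= s by rewrite divr_ge0//; lra.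
have s1 : s < 1 by rewrite ltr_pdivrMr; lra.
apply: le_trans (atom_bound s0 s1) _.
have zi : Im ('i * y%:C : R[i]) = y by rewrite Im_iM.
have z0 : 0 < Im ('i * y%:C : R[i]) by rewrite zi; lra.
have sE : s%:C = cayD ('i * y%:C) :> R[i].
  have i0 := @i_neq0 R.
  have y0 : (y%:C + 1 : R[i]) != 0.
    by rewrite -(rmorph1 (@real_complex R)) -rmorphD -md_eq0 mdC normr_eq0 gt_eqF//; lra.
  rewrite /s fmorph_div/= rmorphB rmorphD rmorph1 /cayD.
  have -> : 'i * y%:C - 'i = 'i * (y%:C - 1) :> R[i] by ring.
  have -> : 'i * y%:C + 'i = 'i * (y%:C + 1) :> R[i] by ring.
  by field; rewrite y0 i0.
rewrite hU; last by rewrite sE; exact: md_cayD.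
set L := l (cexp ('i * ('i * y%:C))).
have LK : md L <= K.
  have [] // := hK (cexp ('i * ('i * y%:C))).
  by rewrite /udisc/= md_cexp Re_iM zi ler_expR lerN2.
have FE : Fl l ('i * y%:C) = 'i * (y%:C - L) by rewrite /Fl mulrBr.
have D0 : y%:C - L != 0.
  by apply/eqP => e; have := Fl_neq0 lRe z0; rewrite FE e mulr0 eqxx.
have hE : hl_ l s%:C = (1 - y%:C * L) / (y%:C - L).
  rewrite /hl_ sE icayDK// FE exprMn sqr_i.
  have i0 := @i_neq0 R.
  have -> : 'i * ((-1 * y%:C ^+ 2 + 1) / ('i * (y%:C - L)) - 'i * y%:C) =
     (1 - y%:C ^+ 2) / (y%:C - L) - ('i * 'i) * y%:C :> R[i] by field; rewrite D0 i0.
  by rewrite ii; field.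
have yK : 0 < y - K by rewrite yE; lra.
have hm : md (hl_ l s%:C) <= 2 + 2 * K.
  rewrite hE mdM mdV ler_pdivrMr ?md_gt0//.
  have m1 : y - K <= md (y%:C - L).
    apply: le_trans (md_sub _ _); rewrite mdC ger0_norm ?lerD2l ?lerN2//; lra.
  have m2 : md (1 - y%:C * L) <= 1 + y * K.
    apply: le_trans (mdD _ _) _; rewrite mdN md1 mdM mdC ger0_norm ?lerD2l ?ler_wpM2l//; lra.
  apply: le_trans m2 _; apply: (@le_trans _ _ ((2 + 2 * K) * (y - K))); last first.
    by rewrite ler_wpM2l// addr_ge0// mulr_ge0.
  have : 2 * K + 1 <= y by rewrite yE; lra.
  nra.
have -> : 1 - s = 2 / (y + 1) by rewrite /s; field; rewrite gt_eqF//; lra.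
have hR : Re ((hl_ l s%:C + 1) / 2) <= (3 + 2 * K) / 2.
  apply: le_trans (Re_le _) _; rewrite mdM mdV md_nat ler_pM2r ?invr_gt0//.
  by apply: le_trans (mdD _ _) _; rewrite md1; lra.
have y0 : 0 < y + 1 by lra.
apply: (@le_trans _ _ (2 / (y + 1) * ((3 + 2 * K) / 2))).
  by rewrite ler_pM2l// divr_gt0.
have -> : 2 / (y + 1) * ((3 + 2 * K) / 2) = (3 + 2 * K) / (y + 1) by field; rewrite gt_eqF.
rewrite ler_pM2l; last by lra.
by rewrite lef_pV2 ?posrE//; rewrite yE; lra.
Qed.
End NoAtom.
End Nevanlinna.

(** * Reciprocal Cauchy transforms with a prescribed logarithm *)

Section Representation.
Context {R : realType}.
Implicit Types (z w : R[i]).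
Variables l l' : R[i] -> R[i].
Hypothesis hl : forall r, 0 <= r < 1 -> c11 (udisc r) (fun _ : unit => l) (fun=> l').
Hypothesis lRe : forall w, md w < 1 -> w != 0 -> Re (l w) <= 0.

Lemma circle_fst1 (p : R * R) : @circle R p -> ~ pt1 p -> p.1 != 1.
Proof.
case: p => a b; rewrite /circle/= => ab h; apply/eqP => a1; apply: h.
move: ab; rewrite a1 expr1n => ab; have : b ^+ 2 = 0 by lra.
by move/eqP; rewrite sqrf_eq0 => /eqP ->.
Qed.

(** With [Fl_cont] this recovers the value at [z = i], the one point where the Cayley identity says
    nothing about [G_mu]. *)
Lemma cauchy_cont (mu : probability R R) (e : R) : 0 < e ->
  md (G_mu mu 'i - G_mu mu ('i * (1 + e)%:C)) <= e.
Proof.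
move=> e0; have i1 : 0 < Im ('i : R[i]) by rewrite Im_i.
have i2 : 0 < Im ('i * (1 + e)%:C : R[i]) by rewrite Im_iM/=; lra.
rewrite /G_mu -CIntB; [|exact: ibl_cauchy|exact: ibl_cauchy].
apply: (md_CInt measurableT (probability_setT mu)); first by apply: iblB; exact: ibl_cauchy.
move=> x _; have n1 := cauchy_neq0 x i1; have n2 := cauchy_neq0 x i2.
have -> : ('i - x%:C)^-1 - ('i * (1 + e)%:C - x%:C)^-1 =
   'i * e%:C * (('i - x%:C)^-1 * ('i * (1 + e)%:C - x%:C)^-1) :> R[i].
  have -> : 'i * e%:C = ('i * (1 + e)%:C - x%:C) - ('i - x%:C) :> R[i] by rewrite rmorphD rmorph1; ring.
  have fr (a b : R[i]) : a != 0 -> b != 0 -> a^-1 - b^-1 = (b - a) * (a^-1 * b^-1).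
    by move=> a0 b0; field; rewrite a0 b0.
  exact: fr.
rewrite mdM (mdM 'i) md_i mul1r mdC gtr0_norm// -[leRHS]mulr1 ler_pM2l// mdM.
have := md_cauchy x i1; have := md_cauchy x i2; rewrite Im_i invr1 Im_iM/= => h2 h1.
have h3 : (1 + e)^-1 <= 1 by rewrite invf_le1; lra.
by rewrite -[leRHS]mulr1 ler_pM ?md_ge0//; apply: le_trans h2 h3.
Qed.

Lemma Fl_cont : exists2 C, 0 <= C & forall e : R, 0 < e ->
  md (Fl l ('i * (1 + e)%:C) - Fl l 'i) <= C * e.
Proof.
have [|K K0 /(_ tt) hK] := hl (r := expR (- 1)); first exact: expRN_lt1.
exists (1 + 2 * K) => [|e e0]; first by rewrite addr_ge0// mulr_ge0.
have e1 : - (1 + e) <= - 1 :> R by lra.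
have u1 : udisc (expR (- 1)) (cexp ('i * 'i) : R[i]) by rewrite /udisc/= md_cexp Re_iM Im_i.
have u2 : udisc (expR (- 1)) (cexp ('i * ('i * (1 + e)%:C)) : R[i]).
  by rewrite /udisc/= md_cexp Re_iM Im_iM/= ler_expR.
rewrite /Fl.
have -> : 'i * (1 + e)%:C - 'i * l (cexp ('i * ('i * (1 + e)%:C))) - ('i - 'i * l (cexp ('i * 'i))) =
  'i * (e%:C - (l (cexp ('i * ('i * (1 + e)%:C))) - l (cexp ('i * 'i)))).
  by rewrite rmorphD rmorph1; ring.
rewrite mdM md_i mul1r mulrDl mul1r; apply: le_trans (mdD _ _) _.
rewrite mdN mdC gtr0_norm// lerD2l; apply: le_trans (c11B_lip K0 hK u2 u1) _.
rewrite ler_wpM2l ?mulr_ge0// !mulrA ii.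
have -> : -1 * (1 + e)%:C = (- (1 + e))%:C :> R[i] by rewrite rmorphN mulN1r.
have -> : -1 = (-1)%:C :> R[i] by rewrite rmorphN rmorph1.
have cR (x : R) : cexp x%:C = (expR x)%:C :> R[i].
  by rewrite /cexp/= cos0 sin0 mulr1.
rewrite !cR -rmorphB mdC distrC ger0_norm ?subr_ge0 ?ler_expR//.
rewrite opprD expRD -[X in X - _]mulr1 -mulrBr.
have /andP[_ /ltW a1] := expRN_lt1 (@ltr01 R).
have a2 := expR_ge1Dx (- e); have a3 := expR_gt0 (-1 : R).
have /andP[_ a4] := expRN_lt1 e0.
by apply: le_trans (ler_piMl _ a1) _; lra.
Qed.

Lemma nevanlinna : exists mu : probability R R,
  forall z, 0 < Im z -> F_mu mu z = Fl l z.
Proof.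
have [nu [nuC hU]] := nevanlinna_measure hl lRe.
exists (push nu (@measurable_icay R)); set mu := push _ _.
have nu1 := no_atom hl lRe nuC hU.
have m1 := @measurable_pt1 R; have mC := @measurable_circle R.
have hD : nu (@circle R `\` @pt1 R) = 1%E.
  rewrite -nuC -(measureU0 (measurableD mC m1) m1 nu1).
  congr (nu _); apply/seteqP; split => [p [[]//|->]|p pC]; first by rewrite /circle/= expr1n expr0n/= addr0.
  by have [|] := pselect (pt1 p); [right|left].
(* At [(1, 0)] the map [icay] takes a default value, so [cay] inverts it only off that point, which
   is negligible by [no_atom]. *)
have hnu A : measurable A -> nu A = mu (@cay R @^-1` A).
  move=> mA; have mA' : measurable ((fun p : R * R => cay (icay p)) @^-1` A).
    rewrite -[X in measurable X]setTI.
    by apply: (measurableT_comp (@measurable_cay R) (@measurable_icay R)).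
  apply: (full_eq (measurableD mC m1) hD mA mA').
  apply/seteqP; split => p [pA [pC p1]]; split => //=; move: pA; rewrite /= cay_icay//.
    exact: circle_fst1.
  exact: circle_fst1.
have hG z : 0 < Im z -> z != 'i -> G_mu mu z = (Fl l z)^-1.
  move=> z0 zi; have := Uc_cay hnu z0; rewrite hU ?md_cayD// /hl_ icayDK// => e.
  have i0 := @i_neq0 R; have d0 := upperD_neq0 z0; have F0 := Fl_neq0 lRe z0.
  have zi' : z - 'i != 0 by rewrite subr_eq0.
  (* This identity dictates the formula of [hl_]: [(h + 1) / 2] is the right-hand side of [Uc_cay]
     with [1 / Fl] in place of [G_mu]. *)
  have e2 : ('i * ((z ^+ 2 + 1) / Fl l z - z) + 1) / 2 =
      (z + 'i) / (- (2 * 'i)) * (-1 + (z - 'i) / Fl l z).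
    have -> : z ^+ 2 + 1 = (z + 'i) * (z - 'i) by rewrite mulrC -subr_sqr sqr_i opprK.
    have -> : (z + 'i) / (- (2 * 'i)) = - ('i * 'i) * ((z + 'i) / (- (2 * 'i))).
      by rewrite ii opprK mul1r.
    have -> : - ('i * 'i) * ((z + 'i) / (- (2 * 'i))) * (-1 + (z - 'i) / Fl l z) =
        ('i * ((z + 'i) * (z - 'i) / Fl l z - z) - 'i * 'i) / 2 by field; rewrite F0 i0.
    by rewrite ii opprK.
  have c0 : (z + 'i) / (- (2 * 'i)) != 0.
    by rewrite mulf_neq0// invr_eq0 oppr_eq0 mulf_neq0// pnatr_eq0.
  move: e; rewrite e2 => /(mulfI c0) /addrI /(mulfI zi') ->.
  by [].
move=> z z0; rewrite /F_mu; apply: (canLR (@invrK _)).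
have [zi|zi] := eqVneq z 'i; last exact: hG.
rewrite {}zi in z0 *.
have [C C0 hC] := Fl_cont.
apply: mdB_le0.
apply: (@le0_divn R _ (1 + C)) => N N0.
have NR : 0 < N%:R^-1 :> R by rewrite invr_gt0 ltr0n.
set z1 := 'i * (1 + N%:R^-1)%:C : R[i].
have z10 : 0 < Im z1 by rewrite /z1 Im_iM/= addr_gt0.
have F1 u : 1 <= Im u -> 1 <= md (Fl l u).
  move=> u1; have u0 : 0 < Im u by exact: lt_le_trans u1.
  by apply: le_trans (Im_le _); apply: le_trans u1 (Fl_Im lRe u0).
have z11 : 1 <= Im z1 by rewrite /z1 Im_iM/= lerDl ltW.
have i1 : 1 <= Im ('i%R : R[i]) by rewrite Im_i.
have hz1 : G_mu mu z1 = (Fl l z1)^-1.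
  apply: hG => //; apply/eqP => /(congr1 (@complex.Im R)); rewrite /z1 Im_iM/= => h.
  by move: NR; rewrite -(ltrD2l 1) h addr0 ltxx.
apply: le_trans (mdBD _ (G_mu mu z1) _) _; rewrite mulrDl mul1r lerD//; first exact: cauchy_cont.
have n1 := Fl_neq0 lRe z10; have n2 := Fl_neq0 lRe z0.
rewrite hz1 mdB.
have -> : (Fl l 'i)^-1 - (Fl l z1)^-1 = (Fl l z1 - Fl l 'i) * ((Fl l 'i)^-1 * (Fl l z1)^-1).
  by field; rewrite n1 n2.
rewrite mdM -[leRHS]mulr1 ler_pM ?md_ge0//; first exact: hC.
rewrite mdM !mdV -[leRHS]mulr1 ler_pM ?invr_ge0 ?md_ge0//.
  by rewrite invf_le1 ?F1// (lt_le_trans _ (F1 _ i1)).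
by rewrite invf_le1 ?F1// (lt_le_trans _ (F1 _ z11)).
Qed.
End Representation.

(** * Surjectivity of the wrapping map *)

Section Onto.
Context {R : realType}.
Implicit Types (z w : R[i]).

(** Off [0] a zero of the quotient is a zero of eta. At [0] its value is the derivative [L], by
    comparison with the difference quotients at small real points. *)
Lemma ID_star_quotient_neq0 (nu : probability (R * R)%type R) : ID_star nu ->
  forall z, md z < 1 -> Vc nu z / Uc nu z != 0.
Proof.
move=> [nuC [[L [L0 hL]] h0]] z z1.
have [->|zn0] := eqVneq z 0; last first.
  apply/eqP => e; move/eqP: zn0; apply; apply: h0; first by rewrite normE ltcR.
  by rewrite etaE// e mulr0.
suff -> : Vc nu 0 / Uc nu 0 = L by [].
have [q1 [q2 [hq _]]] := c11_quotient nuC.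
have [|C C0 /(_ tt) hC] := hq 2^-1; first by rewrite invr_ge0 ler0n invf_lt1 ?ltr1n.
apply: mdB_le0.
apply: (@le0_divn R _ (1 + 2 * C)) => N N0.
have NR : 0 < N%:R^-1 :> R by rewrite invr_gt0 ltr0n.
have [del [del0 hd]] := hL _ NR.
pose x := Num.min (del / 2) (Num.min (N%:R^-1) 2^-1).
have x0 : 0 < x by rewrite /x !lt_min NR !divr_gt0//= invr_gt0.
have xd : x < del by apply: (@le_lt_trans _ _ (del / 2)); [rewrite ge_min lexx|lra].
have xN : x <= N%:R^-1 by rewrite /x ge_min ge_min lexx !orbT.
have x2 : x <= 2^-1 by rewrite /x ge_min ge_min lexx !orbT.
clearbody x.
have mx : md (x%:C : R[i]) = x by rewrite mdC gtr0_norm.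
have xn0 : x%:C != 0 :> R[i] by rewrite -md_gt0 mx.
have x1 : x < 1 by lra.
have := hd x%:C xn0; rewrite !normE !ltcR mx => /(_ x1 xd).
rewrite eta0 // subr0 etaE ?mx// mulrAC mulfV// mul1r => h.
have := @c11B_lip _ C (udisc 2^-1) _ _ x%:C 0 C0 hC.
rewrite /udisc/= mx md0 invr_ge0 => /(_ x2 (ler0n _ _)); rewrite subr0 mx mdB => h2.
apply: le_trans (mdBD _ (Vc nu x%:C / Uc nu x%:C) _) _; rewrite addrC mulrDl mul1r lerD ?(ltW h)//.
by apply: le_trans h2 _; rewrite ler_wpM2l// mulr_ge0.
Qed.

Lemma wrap_onto (nu : probability (R * R)%type R) : ID_star nu ->
  exists mu : probability R R, in_L mu /\ is_wrap mu nu.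
Proof.
move=> nuID; have [nuC _] := nuID; have q0 := ID_star_quotient_neq0 nuID.
have [q1 [q2 [hq1 hq2]]] := c11_quotient nuC.
have [l [l' [hl hexp]]] := c11_log hq1 hq2 q0.
have lRe w : md w < 1 -> w != 0 -> Re (l w) <= 0.
  move=> w1 w0; rewrite -ler_expR expR0 -md_cexp hexp//.
  by have := md_eta nuC w1; rewrite etaE// mdM ger_pMr ?md_gt0.
have [mu hmu] := nevanlinna hl lRe.
have muL : in_L mu.
  by move=> z z0; rewrite !hmu// ?Fl_period// ImD ImC addr0.
exists mu; split=> //.
pose nu' := push mu (@measurable_wrapT R).
have hw : is_wrap mu nu' by move=> A _; exact: pushE.
have nuC' := wrap_circle hw.
move=> A mA; transitivity (nu' A); last exact: hw.
apply: circle_unique => // u u1; apply: eta_psi => //.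
(* Only nonzero points of the disc have the form [e^{iz}]; at [0] both eta-transforms vanish. *)
have [->|un0] := eqVneq u 0; first by rewrite !eta0.
have [z z0 zu] := disc_cexp u1 un0.
have := eta_wrap hw muL z0; rewrite zu => <-.
rewrite hmu// /Fl mulrBr cexpB zu -cexpN.
have -> : - ('i * ('i * l u)) = l u by rewrite mulrA ii mulN1r opprK.
by rewrite hexp// etaE.
Qed.
End Onto.

(** * The image of the wrapping map *)

Section Into.
Context {R : realType}.
Implicit Types (z w : R[i]).

Lemma cauchy_at_infty (mu : probability R R) :
  ccvg (fun n => 'i * n.+1%:R * G_mu mu ('i * (n.+1%:R)%:C)) 1.
Proof.
have z0 n : 0 < Im ('i * (n.+1%:R)%:C : R[i]) by rewrite Im_iM/= ltr0n.
have nC n : n.+1%:R = (n.+1%:R)%:C :> R[i] by rewrite rmorph_nat.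
have i0 := @i_neq0 R.
have mn n : md ('i * n.+1%:R : R[i]) = n.+1%:R by rewrite mdM md_i mul1r md_nat.
have le_md n x : n.+1%:R <= md ('i * (n.+1%:R)%:C - x%:C : R[i]).
  by apply: le_trans (Im_le _); rewrite cauchy_im Im_iM.
pose f n (x : R) : R[i] := 'i * n.+1%:R * ('i * (n.+1%:R)%:C - x%:C)^-1.
apply: (ccvg_eq (u := fun n => CInt mu (f n))).
  by move=> n; rewrite CIntZ//; exact: ibl_cauchy.
rewrite -(CInt_cst mu 1).
apply: (CInt_dct measurableT (probability_setT mu) (M := 1)) => [n|||].
- by apply: mfCM; [exact: mfC_cst|exact: mfC_cauchy].
- exact: mfC_cst.
- move=> n x _; rewrite /f mdM mn mdV ler_pdivrMr ?mul1r//.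
  by rewrite md_gt0 cauchy_neq0.
move=> x _; apply: (@ccvg_le _ _ _ (fun n => `|x| * n.+1%:R^-1)); last first.
  by rewrite -(mulr0 `|x|); apply: cvgM; [exact: cvg_cst|exact: cvg_harmonic].
move=> n; have h := cauchy_neq0 x (z0 n).
have -> : f n x - 1 = x%:C * ('i * (n.+1%:R)%:C - x%:C)^-1.
  by rewrite /f nC -[X in _ - X](mulfV h) -mulrBl opprB addrC subrK.
by rewrite mdM mdC mdV ler_wpM2l// lef_pV2 ?posrE ?ltr0n// md_gt0.
Qed.

(** If the quotient vanished at [0], eta would be of second order there, and the exponential formula
    would force [Im F(iy) >= 2 y - 2 C]. This contradicts [iy G(iy) -> 1]. *)
Lemma wrap_mean_neq0 (mu : probability R R) (nu : probability (R * R)%type R) :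
  is_wrap mu nu -> in_L mu -> Vc nu 0 / Uc nu 0 != 0.
Proof.
move=> hw muL; have nuC := wrap_circle hw; apply/eqP => q0.
have [q1 [q2 [hq _]]] := c11_quotient nuC.
have r01 : 0 <= expR (-1 : R) < 1 by exact: expRN_lt1.
have [C C0 /(_ tt) hC] := hq _ r01.
have hF (y : R) : 1 <= y -> 2 * y - 2 * C <= Im (F_mu mu ('i * y%:C)).
  move=> y1; have z0 : 0 < Im ('i * y%:C : R[i]) by rewrite Im_iM/=; lra.
  have := eta_wrap hw muL z0; set u := cexp ('i * ('i * y%:C)).
  have mu_ : md u = expR (- y) by rewrite md_cexp Re_iM Im_iM.
  have ur : udisc (expR (-1)) u by rewrite /udisc/= mu_ ler_expR lerN2.
  have /andP[r0 r1] := r01.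
  have u1 : md u < 1 by exact: le_lt_trans r1.
  rewrite etaE// => /(congr1 (@md R)); rewrite md_cexp Re_iM mdM mu_ => e.
  have z00 : udisc (expR (-1)) (0 : R[i]) by rewrite /udisc/= md0.
  have h : md (Vc nu u / Uc nu u) <= 2 * C * expR (- y).
    by move: (c11B_lip C0 hC ur z00); rewrite q0 !subr0 mu_.
  (* The factor [2 C] is bounded by [expR (2 C)], which avoids the logarithm of a possibly zero
     constant. *)
  have h2 : expR (- Im (F_mu mu ('i * y%:C))) <= expR (2 * C - 2 * y).
    rewrite e (_ : 2 * C - 2 * y = - y + (2 * C + - y)); last by ring.
    rewrite expRD ler_wpM2l ?expR_ge0//; apply: le_trans h _.
    rewrite expRD ler_wpM2r ?expR_ge0//.
    by apply: le_trans (expR_ge1Dx _); rewrite lerDr.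
  by move: h2; rewrite ler_expR; move: (Im (F_mu _ _)) => v; lra.
(* Closeness [1/4] gives [|iy G(iy)| >= 3/4], while [y > 3 C] makes [y / (2 y - 2 C)] smaller than
   [3/4]. *)
have [N hN] := @cauchy_at_infty mu (4^-1) ltac:(by rewrite invr_gt0).
have [n1 n1C] : exists n : nat, 3 * C < n%:R.
  by exists (Num.truncn (3 * C)).+1; exact: truncnS_gt.
pose n := (maxn N n1).
have := hN n (leq_maxl _ _).
have -> : n.+1%:R = (n.+1%:R)%:C :> R[i] by rewrite rmorph_nat.
set y : R := n.+1%:R.
have yC : 3 * C < y.
  by apply: lt_le_trans n1C _; rewrite ler_nat leqW// leq_maxr.
have y1 : 1 <= y by rewrite ler1n.
clearbody y.
have z0 : 0 < Im ('i * y%:C : R[i]) by rewrite Im_iM/=; lra.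
set X := 'i * y%:C * G_mu mu ('i * y%:C) => hX.
have h1 : 1 - md X <= 4^-1.
  by apply: le_trans hX; rewrite mdB; have := md_sub 1 X; rewrite md1.
have F0 : 0 < 2 * y - 2 * C by lra.
have h2 : md X <= y / (2 * y - 2 * C).
  rewrite /X mdM mdM md_i mul1r mdC ger0_norm; last by lra.
  rewrite G_invF mdV ler_pM2l; last by lra.
  rewrite lef_pV2 ?posrE//; last by rewrite md_gt0 F_neq0.
  by apply: le_trans (Im_le _); exact: hF.
have h3 : y / (2 * y - 2 * C) < 3 / 4 by rewrite ltr_pdivrMr//; lra.
by have := le_lt_trans h2 h3; clear -h1; lra.
Qed.
(** An exponential never vanishes, so neither does eta off [0]; its derivative at [0] is the value
    there of the Lipschitz quotient [Vc / Uc], nonzero by [wrap_mean_neq0]. *)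
Lemma wrap_into (mu : probability R R) : in_L mu ->
  exists nu : probability (R * R)%type R, is_wrap mu nu /\ ID_star nu.
Proof.
move=> muL; pose nu := push mu (@measurable_wrapT R).
have hw : is_wrap mu nu by move=> A _; exact: pushE.
have nuC := wrap_circle hw; exists nu; split=> //; split=> //; split; last first.
  move=> u; rewrite normE ltcR => u1 e; apply: contrapT => /eqP un0.
  have [z z0 zu] := disc_cexp u1 un0.
  by have := eta_wrap hw muL z0; rewrite zu e => /eqP; rewrite (negbTE (cexp_neq0 _)).
exists (Vc nu 0 / Uc nu 0); split; first exact: wrap_mean_neq0 hw muL.
have [q1 [q2 [hq _]]] := c11_quotient nuC.
have r01 : 0 <= (2^-1 : R) < 1 by rewrite invr_ge0 ler0n invf_lt1 ?ltr1n.
have [C C0 /(_ tt) hC] := hq _ r01; move=> e e0.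
have C1 : 0 < 2 * C + 1 by rewrite ltr_wpDl// mulr_ge0.
exists (Num.min 2^-1 (e / (2 * C + 1))); split; first by rewrite lt_min invr_gt0 ltr0n divr_gt0.
move=> z z0; rewrite !normE !ltcR => z1; rewrite lt_min => /andP[z2 ze].
rewrite eta0// subr0 etaE// mulrAC mulfV// mul1r.
have := @c11B_lip _ C (udisc 2^-1) _ _ z 0 C0 hC.
rewrite /udisc/= md0 subr0 => /(_ (ltW z2)) h; have {}h := h (ltac:(by rewrite invr_ge0)).
apply: le_lt_trans h _; move: ze; rewrite ltr_pdivlMr// => ze.
by apply: le_lt_trans ze; rewrite mulrC ler_wpM2l ?md_ge0// lerDl.
Qed.
End Into.

(** * Measures with the same image under wrapping *)

Section Translate.
Context {R : realType}.
Implicit Types (z w : R[i]).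

Lemma cexp_eq1 w : cexp w = 1 -> exists n : int, w = 'i * (n%:~R * (2 * pi))%:C.
Proof.
move=> e; have p2 : 0 < 2 * pi :> R by rewrite mulr_gt0// pi_gt0.
have r0 : Re w = 0.
  apply: (@expR_inj R); rewrite expR0 -md_cexp e md1//.
pose n := Num.floor (Im w / (2 * pi)).
exists n; apply: complex_eq; rewrite ?Re_iM ?Im_iM/= ?oppr0//.
pose x := Im w - n%:~R * (2 * pi).
suff x0 : x = 0 by apply/eqP; rewrite -subr_eq0 -/x x0.
have ex : cexp ('i * x%:C) = 1.
  rewrite /x rmorphB mulrBr cexpB cexp_2pi_int divr1 -e; congr cexp.
  by apply: complex_eq; rewrite ?Re_iM ?Im_iM/= ?oppr0 ?r0.
have /andP[h1 h2] : 0 <= x < 2 * pi.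
  have := Num.Theory.floor_itv (Im w / (2 * pi)); rewrite -/n intrD.
  rewrite ler_pdivlMr// ltr_pdivrMr// => /andP[a b]; rewrite /x; apply/andP; split; lra.
apply/eqP; rewrite eq_le h1 andbT leNgt; apply/negP => x0.
have := cos_lt1 x0 h2; move/(congr1 (@complex.Re R)): ex; rewrite cexp_i/= => ->.
by rewrite ltxx.
Qed.

Lemma wrapT_periodic (n : int) (x : R) : wrapT (x + n%:~R * (2 * pi)) = wrapT x.
Proof.
apply: toC_inj; rewrite !toC_wrapT rmorphD mulrDr opprD cexpD [X in _ * X]cexpN.
by rewrite cexp_2pi_int invr1 mulr1.
Qed.

Lemma cauchy_lip (mu : probability R R) (y : R) z w : 0 < y -> y <= Im z -> y <= Im w ->
  md (G_mu mu z - G_mu mu w) <= y^-1 * y^-1 * md (z - w).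
Proof.
move=> y0 yz yw; have z0 := lt_le_trans y0 yz; have w0 := lt_le_trans y0 yw.
rewrite /G_mu -CIntB; [|exact: ibl_cauchy|exact: ibl_cauchy].
apply: (md_CInt measurableT (probability_setT mu)); first by apply: iblB; exact: ibl_cauchy.
move=> x _; have n1 := cauchy_neq0 x z0; have n2 := cauchy_neq0 x w0.
have -> : (z - x%:C)^-1 - (w - x%:C)^-1 = (z - x%:C)^-1 * (w - x%:C)^-1 * (w - z).
  by field; rewrite n1 n2.
rewrite mdM mdM [md (w - z)]mdB ler_wpM2r ?md_ge0// ler_pM ?md_ge0//.
  by apply: le_trans (md_cauchy x z0) _; rewrite lef_pV2 ?posrE.
by apply: le_trans (md_cauchy x w0) _; rewrite lef_pV2 ?posrE.
Qed.

Lemma F_lip_segment (mu : probability R R) z w : 0 < Im z -> 0 < Im w ->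
  exists2 L : R, 0 <= L & forall s t, 0 <= s -> s <= t -> t <= 1 ->
    md (F_mu mu (z + t%:C * (w - z)) - F_mu mu (z + s%:C * (w - z))) <= L * (t - s).
Proof.
move=> z0 w0; pose y := Num.min (Im z) (Im w).
have y0 : 0 < y by rewrite lt_min z0.
have yz : y <= Im z by rewrite ge_min lexx.
have yw : y <= Im w by rewrite ge_min lexx orbT.
clearbody y; pose p (t : R) := z + t%:C * (w - z).
have yp t : 0 <= t -> t <= 1 -> y <= Im (p t).
  move=> t0 t1; rewrite /p ImD ImZ ImD ImN; nra.
have y2 : 0 <= y^-1 * y^-1 by rewrite mulr_ge0// invr_ge0 ltW.
pose K := y^-1 * y^-1 * md (w - z); have K0 : 0 <= K by rewrite mulr_ge0 ?md_ge0.
have Gp s t : 0 <= s -> s <= 1 -> 0 <= t -> t <= 1 -> md (G_mu mu (p t) - G_mu mu (p s)) <= K * `|t - s|.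
  move=> s0 s1 t0 t1; apply: le_trans (cauchy_lip mu y0 (yp t t0 t1) (yp s s0 s1)) _.
  rewrite /p (_ : _ - _ = (t - s)%:C * (w - z)); last by rewrite rmorphB; ring.
  by rewrite (mdM (t - s)%:C) mdC [_ * md (w - z)]mulrC mulrA.
have cl (u : R[i]) : 0 <= clamp (Re u) /\ clamp (Re u) <= 1.
  by apply/andP; exact: clamp_itv.
(* [lip_lower_bound] speaks of discs; clamping the real part spreads the segment over the unit
   disc. *)
have [||c c0 hc] := @lip_lower_bound R K 1 (fun u => G_mu mu (p (clamp (Re u)))) K0.
- move=> u v _ _; have [a1 a2] := cl u; have [b1 b2] := cl v.
  apply: le_trans (Gp _ _ b1 b2 a1 a2) _; rewrite ler_wpM2l//.
  by apply: le_trans (clamp_lip _ _) _; rewrite -ReN -ReD; exact: Re_le_md.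
- by move=> u _; have [a1 a2] := cl u; apply: G_neq0; apply: lt_le_trans (yp _ a1 a2).
have Fc t : 0 <= t -> t <= 1 -> md (F_mu mu (p t)) <= c^-1.
  move=> t0 t1; rewrite /F_mu mdV lef_pV2 ?posrE ?md_gt0 ?G_neq0//; last 1 first.
  - exact: lt_le_trans (yp t t0 t1).
  have := hc t%:C; rewrite /udisc/= mdC ger0_norm// clampE//; exact.
exists (K * (c^-1 * c^-1)) => [|s t s0 st t1].
  by rewrite mulr_ge0// mulr_ge0// invr_ge0 ltW.
have s1 := le_trans st t1; have t0 := le_trans s0 st.
have n1 := G_neq0 mu (lt_le_trans y0 (yp t t0 t1)).
have n2 := G_neq0 mu (lt_le_trans y0 (yp s s0 s1)).
rewrite -!/(p _).
have -> : F_mu mu (p t) - F_mu mu (p s) =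
    (G_mu mu (p s) - G_mu mu (p t)) * (F_mu mu (p t) * F_mu mu (p s)).
  by rewrite /F_mu; field; rewrite n1 n2.
rewrite mdM mdB mulrAC; apply: ler_pM; rewrite ?md_ge0//.
  by apply: le_trans (Gp s t s0 s1 t0 t1) _; rewrite ger0_norm// subr_ge0.
by rewrite mdM ler_pM ?md_ge0 ?Fc.
Qed.
End Translate.
Section Fibres.
Context {R : realType}.
Variables mu mu' : probability R R.
Hypotheses (muL : in_L mu) (muL' : in_L mu').

Lemma translate_wrap (n : int) : is_translate mu mu' (n%:~R * (2 * pi)) ->
  forall A : set (R * R), measurable A -> mu (wrapT @^-1` A) = mu' (wrapT @^-1` A).
Proof.
move=> ht A mA; rewrite ht.
  by congr (mu _); apply/seteqP; split => x /=; rewrite wrapT_periodic.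
by rewrite -[X in measurable X]setTI; exact: measurable_wrapT.
Qed.

Hypothesis hW : forall A : set (R * R), measurable A -> mu (wrapT @^-1` A) = mu' (wrapT @^-1` A).

Lemma F_shift_int z : 0 < Im z ->
  exists n : int, F_mu mu' z - F_mu mu z = (n%:~R * (2 * pi))%:C.
Proof.
move=> z0; pose nu := push mu (@measurable_wrapT R).
have hw : is_wrap mu nu by move=> A _; exact: pushE.
have hw' : is_wrap mu' nu by move=> A mA; rewrite -hW.
have [|n hn] := @cexp_eq1 R ('i * (F_mu mu' z - F_mu mu z)).
  by rewrite mulrBr cexpB (eta_wrap hw' muL' z0) -(eta_wrap hw muL z0) mulfV ?cexp_neq0.
by exists n; exact: (mulfI (@i_neq0 R)).
Qed.

(* The difference is Lipschitz along segments and takes values in a discrete set, so its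
   increments are bounded by the square of the step. *)
Lemma F_shift_const z w : 0 < Im z -> 0 < Im w ->
  F_mu mu' z - F_mu mu z = F_mu mu' w - F_mu mu w.
Proof.
move=> z0 w0.
have [L L0 hL] := F_lip_segment mu z0 w0; have [L' L0' hL'] := F_lip_segment mu' z0 w0.
pose p t := z + t%:C * (w - z).
have p0 t : 0 <= t -> t <= 1 -> 0 < Im (p t).
  move=> t0 t1; rewrite /p ImD ImZ ImD ImN.
  have -> : Im z + t * (Im w - Im z) = (1 - t) * Im z + t * Im w by ring.
  have [t2|t2] := ltP t 1; first by rewrite ltr_pwDl ?mulr_gt0 ?subr_gt0// mulr_ge0// ltW.
  have -> : t = 1 by lra.
  by rewrite subrr mul0r add0r mul1r.
pose D t := F_mu mu' (p t) - F_mu mu (p t).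
suff : D 1 = D 0 by rewrite /D /p mul0r addr0 mul1r [z + (w - z)]addrC subrK => ->.
apply: mdB_le0.
apply: (@quad_telescope _ _ _ ((L + L') ^+ 2)) => s t s0 st t1.
have s1 := le_trans st t1; have t0 := le_trans s0 st.
have hD : md (D t - D s) <= (L + L') * (t - s).
  have sub4 (a b c d : R[i]) : a - b - (c - d) = a - c - (b - d) by ring.
  rewrite /D sub4.
  apply: le_trans (mdD _ _) _; rewrite mdN mulrDl addrC lerD//; [exact: hL|exact: hL'].
rewrite mul0r add0r.
have [n hn] := F_shift_int (p0 t t0 t1); have [m hm] := F_shift_int (p0 s s0 s1).
have e : D t - D s = ((n - m)%:~R * (2 * pi))%:C by rewrite /D hn hm -rmorphB -mulrBl -intrB.
have [nm|nm] := eqVneq (n - m) 0.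
  by rewrite e nm mul0r md0 mulr_ge0 ?sqr_ge0.
have h1 : 1 <= md (D t - D s).
  rewrite e mdC normrM; have p2 := pi_ge2 R.
  have : 1 <= `|(n - m)%:~R : R| by rewrite norm_intr_ge1 ?intr_int ?intr_eq0.
  have : 1 <= `|2 * pi : R| by apply: le_trans (ler_norm _); lra.
  by move=> a b; exact: mulr_ege1.
have h0 := md_ge0 (D t - D s).
rewrite -exprMn; apply: (@le_trans _ _ (md (D t - D s) ^+ 2)).
  by rewrite expr2 ler_peMl.
by rewrite lerXn2r ?nnegrE// (le_trans h0).
Qed.

Lemma wrap_translate : exists n : int, is_translate mu mu' (n%:~R * (2 * pi)).
Proof.
have i1 : 0 < Im ('i : R[i]) by rewrite Im_i.
(* The sign changes because [F_mu' z = F_mu (z + 2 pi n)] describes the image of [mu] under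
   [x -> x - 2 pi n]. *)
have [n hn] := F_shift_int i1; exists (- n).
set a := (- n)%:~R * (2 * pi).
have ea : a%:C = - (n%:~R * (2 * pi))%:C :> R[i] by rewrite /a intrN mulNr rmorphN.
have ma : measurable_fun setT (fun x : R => x + a).
  by apply: measurable_funD => //; exact: measurable_cst.
move=> A mA; transitivity (push mu ma A); last by [].
apply: cauchy_unique => // z z0.
have e : F_mu mu' z = F_mu mu (z + (n%:~R * (2 * pi))%:C).
  by rewrite in_L_int// -hn (F_shift_const i1 z0) addrC subrK.
have zn : 0 < Im (z + (n%:~R * (2 * pi))%:C) by rewrite ImD ImC addr0.
rewrite G_invF e -G_invF {1}/G_mu [RHS](CInt_push ma (fun A _ => pushE mu ma A) (mfC_cauchy z)).
  congr CInt; apply/funext => x /=; congr (_^-1).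
  by rewrite rmorphD/= ea opprD opprK addrAC addrA.
rewrite (_ : _ \o _ = fun x : R => (z + (n%:~R * (2 * pi))%:C - x%:C)^-1); first exact: ibl_cauchy.
apply/funext => x /=; congr (_^-1).
by rewrite rmorphD/= ea opprD opprK addrAC addrA.
Qed.
End Fibres.

Theorem theorem4p3 (R : realType) :
  (* W maps L into ID_* *)
  (forall mu : probability R R, in_L mu ->
     exists nu : probability (R * R)%type R, is_wrap mu nu /\ ID_star nu) /\
  (* W maps L onto ID_* *)
  (forall nu : probability (R * R)%type R, ID_star nu ->
     exists mu : probability R R, in_L mu /\ is_wrap mu nu) /\
  (* exp(i F_mu(z)) = eta_{W(mu)}(e^{iz}) *)
  (forall (mu : probability R R) (nu : probability (R * R)%type R),
     in_L mu -> is_wrap mu nu ->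
     forall z : R[i], 0 < complex.Im z ->
       cexp ('i * F_mu mu z) = eta_nu nu (cexp ('i * z))) /\
  (* W(mu) = W(mu') iff mu' is a translate of mu by 2 pi n, n in Z *)
  (forall mu mu' : probability R R, in_L mu -> in_L mu' ->
     ((forall A : set (R * R), measurable A ->
         mu (wrapT @^-1` A) = mu' (wrapT @^-1` A)) <->
      exists n : int, is_translate mu mu' (n%:~R * (2 * pi)))).
Proof.
split; [|split; [|split]].
- exact: wrap_into.
- exact: wrap_onto.
- by move=> mu nu muL hw z z0; exact: eta_wrap.
- move=> mu mu' muL muL'; split; first exact: wrap_translate.
  by move=> [n ht]; exact: translate_wrap ht.
Qed.
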